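(* Let the flux function $f$ satisfy $f\in C^2$, $f''<0$, $f(0)=f(\rho_{jam})=0$. Assume that all $N$ groups of drivers have the same departure cost $\varphi_i=\varphi$ and possibly different arrival costs $\psi_1,\dots,\psi_N$, satisfying, for every $i=1,\dots,N$, $$\varphi'<0,\qquad \psi_i>0,\quad \psi_i'>0,\qquad \lim_{|t|\to\infty}\big(\varphi(t)+\psi_i(t)\big)=+\infty .$$ Let $(\bar u_1,\dots,\bar u_N)$ be optimal departure rates, minimizing the total cost $J$ to all drivers. Then the corresponding solution $u$ does not contain shocks. Moreover, there exist constants $C_1,\dots,C_N$ such that, setting $$\psi(t)\doteq\min_{k}\,\big(\psi_k(t)-C_k\big),$$ the following holds. (i) For any $t\in\mathbb{R}$, let $T(t)$ be the unique time such that $$\varphi(t)+\psi(T(t))=0.$$ Then, for every point $(t',x')$ along the segment with endpoints $(t,0)$ and $(T(t),L)$, one has $$u(t',x')=\begin{cases}\gamma\left(\dfrac{T(t)-t}{L}\right) & \text{if } \dfrac{T(t)-t}{L}\ge g'(0),\\[2mm] 0 & \text{otherwise.}\end{cases}$$ (ii) Calling $u_i(\cdot,L)$ the arrival rate of drivers of the $i$-th group, one has, for every $i=1,\dots,N$, $$\mathrm{Supp}(u_i(\cdot,L))\subseteq\{s\,:\ \psi(s)=\psi_i(s)-C_i\}.$$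
   Context: **Road and flux.** A single road is parametrized by $x\in[0,L]$, $L>0$. The traffic density $\rho(t,x)\in[0,\rho_{jam}]$ satisfies $\rho_t+f(\rho)_x=0$, where $f(\rho)=\rho\,v(\rho)$ and $v$ is the (decreasing) car velocity; in particular $v(0)=f'(0)$. Let $\rho^{max}$ be the point where $f$ attains its maximum and $M\doteq\max_\rho f(\rho)=f(\rho^{max})$. The function $g:[0,M]\to[0,\rho^{max}]$ is the inverse of $f$ restricted to $[0,\rho^{max}]$, so $g(f(\rho))=\rho$. It is strictly convex, $g'(0)=1/v(0)$, and $g'(u)\to+\infty$ as $u\to M$. It is extended by $g(u)=g'(0+)\,u$ for $u<0$ and $g(u)=+\infty$ for $u>M$. Its Legendre transform is $g^*(p)=\max_u\{pu-g(u)\}$, with $g^*(p)=+\infty$ for $p<g'(0)$. The function $\gamma:[g'(0),+\infty[\,\to[0,M[$ is defined by $g'(\gamma(p))=p$. **Departure rates.** There are $N$ groups of drivers, of sizes $G_1,\dots,G_N>0$; set $G=\sum_i G_i$. Admissible departure rates are measurable functions $\bar u_1,\dots,\bar u_N:\mathbb{R}\to[0,\infty[$ with $\int_{-\infty}^{\infty}\bar u_i(t)\,dt=G_i$ and $\bar u(t)\doteq\sum_i\bar u_i(t)\in[0,M]$ for all $t$. Write $\bar u_i=\bar\theta_i\bar u$ with $\bar\theta_i\ge0$, $\sum_i\bar\theta_i=1$. **Corresponding solution.** The flux $u(t,x)=f(\rho(t,x))$ is the entropy weak solution of $$u_x+g(u)_t=0,\qquad u(t,0)=\bar u(t),$$ with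 $x\in[0,L]$ playing the role of the evolution variable. Let $\overline U(t)=\int_{-\infty}^t\bar u(s)\,ds$ and $U(t,x)=\int_{-\infty}^t u(s,x)\,ds$. Then for $x>0$ (Lax formula) $$U(t,x)=\min_\tau\Big\{x\,g^*\Big(\frac{t-\tau}{x}\Big)+\overline U(\tau)\Big\},\qquad u(t,x)=\gamma\Big(\frac{t-\tau(t,x)}{x}\Big),$$ where $\tau(t,x)$ is the minimizer (when unique). The solution contains a shock through $(t,x)$ if the minimizer is not unique, equivalently if $u(t+,x)<u(t-,x)$ (one-sided limits in $t$). Functions such as $\bar u$ are, as usual, identified when they agree almost everywhere. **Fractions and arrival rates.** For $s\in\,]0,G]$ put $\bar\tau(s)=\inf\{t:\overline U(t)\ge s\}$ and $\Theta_i(s)=\bar\theta_i(\bar\tau(s))$. The fraction of drivers of group $i$ at $(t,x)$ is $\theta_i(t,x)=\Theta_i(U(t,x))$ (it is constant along car trajectories and satisfies $\theta_{i,t}+v(\rho)\theta_{i,x}=0$), and $u_i(t,x)=\theta_i(t,x)\,u(t,x)$ is the flux of drivers of group $i$. In particular $u_i(\cdot,L)$ is the arrival rate of group $i$. **Optimality.** With departure costs $\varphi_i$ and arrival costs $\psi_i$, the total cost is $$J(\bar u_1,\dots,\bar u_N)=\sum_{i=1}^N\int_{-\infty}^{+\infty}\big[\bar u_i(t)\,\varphi_i(t)+u_i(t,L)\,\psi_i(t)\big]\,dt .$$ Departure rates are optimal if they are admissible and minimize $J$ among all admissible departure rates. **Support.** $\mathrm{Supp}(w)$ denotes the closure of the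 set of times where $w(t)>0$ (the essential support, for functions defined up to null sets).
   Formalization: In (i), T(t) is claimed to exist and be unique only for those t for which φ(t)+ψ(s) ≤ 0 for some s; for very negative t no T(t) exists, since φ(t)→+∞ as t→−∞ while ψ is bounded below. *)

(* Defs.v *)
From HB Require Import structures.
From mathcomp Require Import all_boot all_order all_algebra.
From mathcomp Require Import all_classical all_reals all_analysis.

Set Implicit Arguments.
Unset Strict Implicit.
Unset Printing Implicit Defensive.

Import Order.TTheory GRing.Theory Num.Theory.
Import numFieldNormedType.Exports.
Local Open Scope classical_set_scope.
Local Open Scope ring_scope.

(* Derivative of [h] at [x] relative to a set [A]: two-sided at interior points
   of [A], one-sided at the endpoints of an interval. *)
Definition rel_quotient (R : realType) (h : R -> R) (x y : R) : R :=
  (h y - h x) / (y - x).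

Definition derivable_on (R : realType) (A : set R) (h : R -> R) (x : R) : Prop :=
  cvg (rel_quotient h x y @[y --> within A x^']).

Definition deriv_on (R : realType) (A : set R) (h : R -> R) (x : R) : R :=
  lim (rel_quotient h x y @[y --> within A x^']).

Definition C2_on (R : realType) (A : set R) (h : R -> R) : Prop :=
  [/\ forall x, A x -> derivable_on A h x,
      forall x, A x -> derivable_on A (deriv_on A h) x &
      {within A, continuous (deriv_on A (deriv_on A h))}].

(* In the following, [f] is a flux on the density interval [0, rhojam]. *)

Definition max_flux (R : realType) (f : R -> R) (rhojam : R) : R :=
  sup (f @` `[0, rhojam]).

Definition rho_max (R : realType) (f : R -> R) (rhojam : R) : R :=
  xget 0 [set r | 0 <= r <= rhojam /\ f r = max_flux f rhojam].

Definition flux_inv (R : realType) (f : R -> R) (rhojam : R) (u : R) : R :=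
  xget 0 [set r | 0 <= r <= rho_max f rhojam /\ f r = u].

Definition dflux_inv (R : realType) (f : R -> R) (rhojam : R) (u : R) : R :=
  deriv_on `[0, max_flux f rhojam[ (flux_inv f rhojam) u.

(* The extension of the inverse to the whole line: linear on the left of 0. *)
Definition flux_inv_ext (R : realType) (f : R -> R) (rhojam : R) (u : R) :
    \bar R :=
  if u < 0 then (dflux_inv f rhojam 0 * u)%:E
  else if u <= max_flux f rhojam then (flux_inv f rhojam u)%:E
  else +oo%E.

Definition legendre (R : realType) (f : R -> R) (rhojam : R) (p : R) : \bar R :=
  ereal_sup (range (fun u : R => ((p * u)%:E - flux_inv_ext f rhojam u)%E)).

(* Only meaningful for [dflux_inv f rhojam 0 <= p]. *)
Definition gamma (R : realType) (f : R -> R) (rhojam : R) (p : R) : R :=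
  xget 0 [set u | 0 <= u < max_flux f rhojam /\ dflux_inv f rhojam u = p].

Definition total_rate (R : realType) (n : nat) (ub : 'I_n -> R -> R) (t : R) :
  R := \sum_(i < n) ub i t.

Definition cum_departures (R : realType) (w : R -> R) (t : R) : R :=
  \int[lebesgue_measure]_(s in `]-oo, t]) w s.

(* Entropy solution of u_x + g(u)_t = 0, u(t,0) = w(t), represented pointwise,
   for x > 0, by the Lax formula. *)
Definition lax_cost (R : realType) (f : R -> R) (rhojam : R) (w : R -> R)
    (t x tau : R) : \bar R :=
  (x%:E * legendre f rhojam ((t - tau) / x) + (cum_departures w tau)%:E)%E.

Definition lax_minimizer (R : realType) (f : R -> R) (rhojam : R) (w : R -> R)
    (t x tau : R) : Prop :=
  forall tau',
    (lax_cost f rhojam w t x tau <= lax_cost f rhojam w t x tau')%E.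

Definition lax_tau (R : realType) (f : R -> R) (rhojam : R) (w : R -> R)
    (t x : R) : R := xget 0 (lax_minimizer f rhojam w t x).

Definition lax_potential (R : realType) (f : R -> R) (rhojam : R) (w : R -> R)
    (t x : R) : R :=
  if x == 0 then cum_departures w t
  else fine (ereal_inf (range (lax_cost f rhojam w t x))).

Definition lax_solution (R : realType) (f : R -> R) (rhojam : R) (w : R -> R)
    (t x : R) : R :=
  if x == 0 then w t
  else gamma f rhojam ((t - lax_tau f rhojam w t x) / x).

Definition has_shock (R : realType) (f : R -> R) (rhojam : R) (w : R -> R)
    (t x : R) : Prop :=
  exists tau1 tau2, [/\ lax_minimizer f rhojam w t x tau1,
    lax_minimizer f rhojam w t x tau2 & tau1 <> tau2].

(* Where nobody departs the fractions are irrelevant; any choice that is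
   nonnegative and sums to one will do. *)
Definition dep_fraction (R : realType) (n : nat) (ub : 'I_n -> R -> R)
    (i : 'I_n) (t : R) : R :=
  if total_rate ub t == 0 then n%:R^-1 else ub i t / total_rate ub t.

Definition dep_time (R : realType) (n : nat) (ub : 'I_n -> R -> R) (s : R) : R :=
  inf [set t | s <= cum_departures (total_rate ub) t].

Definition fraction (R : realType) (n : nat) (f : R -> R) (rhojam : R)
    (ub : 'I_n -> R -> R) (i : 'I_n) (t x : R) : R :=
  dep_fraction ub i
    (dep_time ub (lax_potential f rhojam (total_rate ub) t x)).

Definition group_flux (R : realType) (n : nat) (f : R -> R) (rhojam : R)
    (ub : 'I_n -> R -> R) (i : 'I_n) (t x : R) : R :=
  fraction f rhojam ub i t x * lax_solution f rhojam (total_rate ub) t x.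

Definition admissible (R : realType) (n : nat) (f : R -> R) (rhojam : R)
    (G : 'I_n -> R) (ub : 'I_n -> R -> R) : Prop :=
  [/\ forall i, measurable_fun setT (ub i),
      forall i t, 0 <= ub i t,
      forall i, (\int[lebesgue_measure]_t (ub i t)%:E)%E = (G i)%:E &
      forall t, total_rate ub t <= max_flux f rhojam].

Definition cost_density (R : realType) (n : nat) (f : R -> R) (rhojam L : R)
    (phi psi : 'I_n -> R -> R) (ub : 'I_n -> R -> R) (i : 'I_n) (t : R) : R :=
  ub i t * phi i t + group_flux f rhojam ub i t L * psi i t.

Definition total_cost (R : realType) (n : nat) (f : R -> R) (rhojam L : R)
    (phi psi : 'I_n -> R -> R) (ub : 'I_n -> R -> R) : \bar R :=
  (\sum_(i < n) \int[lebesgue_measure]_t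
     (cost_density f rhojam L phi psi ub i t)%:E)%E.

(* The departure costs may tend to -oo, so that the integrals in the total cost
   may have the undefined form +oo - oo, to which the library integral gives a
   junk value.  Only rates with integrable cost are therefore compared. *)
Definition has_cost (R : realType) (n : nat) (f : R -> R) (rhojam L : R)
    (phi psi : 'I_n -> R -> R) (ub : 'I_n -> R -> R) : Prop :=
  forall i, lebesgue_measure.-integrable setT
    (fun t : R => (cost_density f rhojam L phi psi ub i t)%:E).

Definition optimal (R : realType) (n : nat) (f : R -> R) (rhojam L : R)
    (phi psi : 'I_n -> R -> R) (G : 'I_n -> R) (ub : 'I_n -> R -> R) : Prop :=
  [/\ admissible f rhojam G ub, has_cost f rhojam L phi psi ub &
      forall vb, admissible f rhojam G vb -> has_cost f rhojam L phi psi vb ->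
        (total_cost f rhojam L phi psi ub
           <= total_cost f rhojam L phi psi vb)%E].

(* Closure of {w > 0}, insensitive to modifications of [w] on null sets. *)
Definition ess_supp (R : realType) (w : R -> R) : set R :=
  [set t | forall V, nbhs t V ->
     ~ lebesgue_measure.-negligible (V `&` [set s | 0 < w s])].

Definition shifted_min (R : realType) (n : nat) (psi : 'I_n.+1 -> R -> R)
    (C : 'I_n.+1 -> R) (t : R) : R :=
  \big[Num.min/(psi ord0 t - C ord0)]_(k < n.+1) (psi k t - C k).

(* Value carried by a segment of slope [p] in the (x, t) plane. *)
Definition segment_value (R : realType) (f : R -> R) (rhojam p : R) : R :=
  if dflux_inv f rhojam 0 <= p then gamma f rhojam p else 0.

(* Main.v *)
(* Relax the problem to a total departure rate and group arrival rates, of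
   bounded support, tied only by the inequality A(s) <= L g^*((s-t)/L) + W(t)
   between their cumulative functions. Letting the groups depart in the order in
   which they arrive turns such a relaxed plan into admissible departures of no
   larger cost, and relaxed plans form a convex set, so that a supporting
   functional yields C_1, ..., C_N for which the optimum minimizes the cost minus
   sum_i C_i mass_i over relaxed plans of arbitrary masses. Put q = -phi and
   psi = min_k (psi_k - C_k). By the layer cake formula the cost is, up to
   boundary terms, the integral over the levels y of W(t) - A(s), where
   q(t) = y = psi(s), and W(t) - A(s) >= -L g^*((s-t)/L). The flow joining equal
   levels at constant slope attains equality, hence so must the optimum:
   U(s,L) - W(t) = L g^*((s-t)/L) whenever phi(t) + psi(s) = 0. The segments
   joining such t and s, together with the free-flow ones, are therefore
   characteristics filling the strip, and the uniqueness of the Lax minimizer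
   inside a characteristic segment excludes shocks. *)
Require Import Defs.
From HB Require Import structures.
From mathcomp Require Import all_boot all_order all_algebra.
From mathcomp Require Import all_classical all_reals all_analysis.
From mathcomp Require Import measurable_realfun.
From mathcomp Require Import ring lra.

Set Implicit Arguments.
Unset Strict Implicit.
Unset Printing Implicit Defensive.

Import Order.TTheory GRing.Theory Num.Theory.
Import numFieldNormedType.Exports.
Local Open Scope classical_set_scope.
Local Open Scope ring_scope.

(** * Flux and Legendre transform *)

(** Arrivals and the mixing of the groups depend nonlinearly on the departures, so the cost itself
    shows no convexity; the relaxation is what makes duality available. Plans have bounded support
    so that their integrals are finite. The optimum may fail this, so it is never treated as a plan
    and enters the duality only through its value. The multipliers are needed because the flow
    joining equal levels has whatever group masses it happens to have: once the C_i pay for them, it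
    is a legitimate rival. Since q may be unbounded, the layer cake identity is applied on
    half-lines []-oo, X]]. It leaves a term proportional to the number of drivers on the road at X;
    taking X where this number is at a record low absorbs that term up to a part that vanishes as X
    grows. The Lax potential is never differentiated: f'' is bounded away from 0, so gamma is
    Lipschitz, increments are known up to errors quadratic in the step, and such errors disappear
    under subdivision. *)

Definition has_rel_deriv (R : realType) (A : set R) (h : R -> R) (x d : R) : Prop :=
  forall e, 0 < e -> exists2 del, 0 < del &
    forall y, A y -> y != x -> `|y - x| < del -> `|rel_quotient h x y - d| < e.

Lemma near_within_dnbhs (R : realType) (A : set R) (x : R) (P : set R) :
  (\forall y \near within A x^', P y) <->
  exists2 del, 0 < del & forall y, A y -> y != x -> `|y - x| < del -> P y.
Proof.
split.
  rewrite near_withinE => /nbhs_ballP[e /= e0 H]; exists e => // y Ay yx yxe.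
  by apply: (H y) => //=; rewrite /ball/= distrC.
move=> [del del0 H]; rewrite near_withinE; apply/nbhs_ballP.
exists del => //= y; rewrite /ball/= distrC => yd yx Ay; exact: H.
Qed.

Lemma derivable_on_rel (R : realType) (A : set R) (h : R -> R) (x : R) :
  derivable_on A h x -> has_rel_deriv A h x (deriv_on A h x).
Proof.
move=> dh e e0; apply/near_within_dnbhs.
have /cvgrPdist_lt/(_ e e0) : rel_quotient h x y @[y --> within A x^'] -->
  deriv_on A h x by exact: dh.
by apply: filterS => y /=; rewrite distrC.
Qed.

Lemma has_rel_deriv_eq (R : realType) (A : set R) (h : R -> R) (x d : R) :
  (forall del, 0 < del -> exists2 y, A y & y != x /\ `|y - x| < del) ->
  has_rel_deriv A h x d -> deriv_on A h x = d.
Proof.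
move=> lim_pt dh; apply: cvg_lim => //.
  apply: Build_ProperFilter => //= /near_within_dnbhs[del del0 H].
  by have [y Ay [yx yd]] := lim_pt _ del0; exact: (H y).
apply/cvgrPdist_lt => e e0; have := dh e e0.
move/near_within_dnbhs; by apply: filterS => y /=; rewrite distrC.
Qed.

(** The bound [d / 2] keeps [q] above [d / 2], hence [q * d] above [d ^+ 2 / 2], in the denominator
    of the difference. *)
Lemma invr_close (R : realType) (d q e : R) : 0 < d -> 0 < e ->
  `|q - d| < Num.min (d / 2) (e * d ^+ 2 / 2) -> `|q^-1 - d^-1| < e.
Proof.
move=> d0 e0; rewrite lt_min => /andP[q1 q2].
have q0 : d / 2 < q by move: q1; rewrite ltr_norml => /andP[q1 _]; lra.
have q00 : 0 < q by lra.
have -> : q^-1 - d^-1 = (d - q) / (q * d) by field; rewrite !gt_eqF.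
rewrite normrM normfV ltr_pdivrMr ?normr_gt0 ?mulf_neq0 ?gt_eqF//.
rewrite distrC; apply: lt_le_trans q2 _; rewrite gtr0_norm ?mulr_gt0//.
by rewrite -mulrA ler_pM2l// expr2 mulrAC ler_pM2r// ltW.
Qed.

(** * Mean value theorem for derivatives relative to an interval *)

Section RelativeDerivative.
Context (R : realType) (a b : R) (h dh : R -> R).
Hypothesis hdh : forall x, a <= x <= b -> has_rel_deriv `[a, b] h x (dh x).

Lemma rel_deriv_is_derive (x : R) : a < x < b -> is_derive x 1 h (dh x).
Proof.
move=> /andP[ax xb]; apply/is_derive1_caratheodory.
exists (fun y => if y == x then dh x else rel_quotient h x y); split; last by rewrite eqxx.
  move=> z; case: eqVneq => [->|zx]; first by rewrite !subrr mulr0.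
  by rewrite /rel_quotient divfK // subr_eq0.
apply/cvgrPdist_lt => e e0; rewrite eqxx.
have /hdh/(_ e e0)[del del0 H] : a <= x <= b by rewrite !ltW.
have m0 : 0 < Num.min del (Num.min (x - a) (b - x)) by rewrite !lt_min del0 !subr_gt0 ax.
near=> y; case: eqVneq => [_|yx]; first by rewrite subrr normr0.
have : `|y - x| < Num.min del (Num.min (x - a) (b - x)).
  by rewrite distrC; near: y; exact: cvgr_dist_lt.
rewrite !lt_min => /and3P[yd ya yb].
rewrite distrC; apply: H => //=; rewrite in_itv/=.
move: ya yb; rewrite !ltr_norml => /andP[y1 _] /andP[_ y2].
by apply/andP; split; lra.
Unshelve. all: by end_near. Qed.

Lemma rel_deriv_continuous : {within `[a, b], continuous h}.
Proof.
apply/subspace_continuousP => x xab; apply/cvgrPdist_lt => e e0.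
have /hdh/(_ 1 ltr01)[del del0 H] : a <= x <= b by move: xab; rewrite /= in_itv.
have K0 : 0 < `|dh x| + 1 by rewrite ltr_wpDl.
rewrite near_withinE; apply/nbhs_ballP.
exists (Num.min del (e / (`|dh x| + 1))) => /=; first by rewrite lt_min del0 divr_gt0.
move=> y; rewrite /ball/= lt_min => /andP[yd ye] yab.
have [->|yx] := eqVneq y x; first by rewrite subrr normr0.
have := H y yab yx; rewrite distrC => /(_ yd) q1.
have -> : h x - h y = rel_quotient h x y * (x - y).
  by rewrite /rel_quotient -[x - y]opprB mulrN divfK ?subr_eq0// opprB.
rewrite normrM.
have q2 : `|rel_quotient h x y| <= `|dh x| + 1.
  have -> : rel_quotient h x y = dh x + (rel_quotient h x y - dh x) by rewrite addrC subrK.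
  by rewrite (le_trans (ler_normD _ _))// lerD2l ltW.
by rewrite (le_lt_trans (ler_wpM2r (normr_ge0 _) q2))// mulrC -ltr_pdivlMr.
Qed.

Lemma rel_deriv_MVT (x y : R) : a <= x -> x < y -> y <= b ->
  exists2 c, x < c < y & h y - h x = dh c * (y - x).
Proof.
move=> ax xy yb.
have der c : c \in `]x, y[ -> is_derive c 1 h (dh c).
  rewrite in_itv/= => /andP[xc cy]; apply: rel_deriv_is_derive.
  by rewrite (le_lt_trans ax)//= (lt_le_trans cy).
have cont : {within `[x, y], continuous h}.
  apply: continuous_subspaceW rel_deriv_continuous => z /=; rewrite !in_itv/= => /andP[xz zy].
  by rewrite (le_trans ax)//= (le_trans zy).
by have [c] := MVT xy der cont; rewrite in_itv/= => xcy E; exists c.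
Qed.

End RelativeDerivative.

(** * Concave flux, its inverse branch and their closed forms *)

Section Flux.
Context (R : realType) (rhojam : R) (f : R -> R).
Hypothesis rhojam_gt0 : 0 < rhojam.
Hypothesis f_C2 : C2_on `[0, rhojam] f.
Hypothesis f_concave : forall r, 0 <= r <= rhojam ->
  deriv_on `[0, rhojam] (deriv_on `[0, rhojam] f) r < 0.
Hypothesis f0 : f 0 = 0.
Hypothesis f_jam : f rhojam = 0.

Let df := deriv_on `[0, rhojam] f.
Let ddf := deriv_on `[0, rhojam] df.

Let in0j (r : R) : (r \in `[0, rhojam]) = (0 <= r <= rhojam).
Proof. by rewrite in_itv. Qed.

Let f_rel (x : R) : 0 <= x <= rhojam -> has_rel_deriv `[0, rhojam] f x (df x).
Proof. by move=> xr; case: f_C2 => + _ _; move=> /(_ x); rewrite /= in0j => /(_ xr)/derivable_on_rel. Qed.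

Let df_rel (x : R) : 0 <= x <= rhojam -> has_rel_deriv `[0, rhojam] df x (ddf x).
Proof. by move=> xr; case: f_C2 => _ + _; move=> /(_ x); rewrite /= in0j => /(_ xr)/derivable_on_rel. Qed.

(** The continuous f'' attains a negative maximum on the compact interval. This quantitative
    concavity is what later makes gamma Lipschitz. *)
Lemma flux_second_deriv_bound : exists2 c, 0 < c & forall x y : R, 0 <= x -> x <= y -> y <= rhojam ->
  c * (y - x) <= df x - df y.
Proof.
have [c cI cmax] : exists2 c, c \in `[0, rhojam] & forall t, t \in `[0, rhojam] -> ddf t <= ddf c.
  by apply: EVT_max; [exact: ltW|case: f_C2].
exists (- ddf c); first by rewrite oppr_gt0 f_concave// -in0j.
move=> x y x0; rewrite le_eqVlt => /predU1P[->|xy] yj; first by rewrite !subrr mulr0.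
have [z /andP[xz zy] E] := rel_deriv_MVT df_rel x0 xy yj.
rewrite mulNr lerNl opprB E; apply: ler_wpM2r; first by rewrite subr_ge0 ltW.
by apply: cmax; rewrite in0j (le_trans x0 (ltW xz)) (le_trans (ltW zy)).
Qed.

Lemma flux_deriv_decr (x y : R) : 0 <= x -> x < y -> y <= rhojam -> df y < df x.
Proof.
move=> x0 xy yj; have [c c0 /(_ x y x0 (ltW xy) yj)] := flux_second_deriv_bound.
by rewrite -subr_gt0; apply: lt_le_trans; rewrite mulr_gt0// subr_gt0.
Qed.

Lemma flux_deriv_decrW (x y : R) : 0 <= x -> x <= y -> y <= rhojam -> df y <= df x.
Proof. by move=> x0; rewrite le_eqVlt => /predU1P[->//|xy] yj; apply/ltW/flux_deriv_decr. Qed.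

Lemma flux_critical : exists2 r, 0 < r < rhojam & df r = 0.
Proof.
have [r rI E] := rel_deriv_MVT f_rel (lexx 0) rhojam_gt0 (lexx _).
exists r => //; move: E; rewrite f0 f_jam !subr0 => /esym/eqP.
by rewrite mulf_eq0 (gt_eqF rhojam_gt0) orbF => /eqP.
Qed.

Lemma flux_lt_tangent (x y : R) : 0 <= x <= rhojam -> 0 <= y <= rhojam -> x != y ->
  f y < f x + df x * (y - x).
Proof.
move=> /andP[x0 xj] /andP[y0 yj]; rewrite neq_lt => /orP[xy|yx].
- have [z /andP[xz zy] E] := rel_deriv_MVT f_rel x0 xy yj.
  rewrite -ltrBlDl E ltr_pM2r ?subr_gt0//; apply: flux_deriv_decr => //.
  exact: ltW (lt_le_trans zy yj).
- have [z /andP[yz zx] E] := rel_deriv_MVT f_rel y0 yx xj.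
  have -> : f y = f x - df z * (x - y) by rewrite -E; ring.
  rewrite -[y - x]opprB mulrN ltrD2l ltrN2 ltr_pM2r ?subr_gt0//.
  by apply: flux_deriv_decr => //; exact: ltW (le_lt_trans y0 yz).
Qed.

Lemma flux_incr (r x y : R) : 0 < r < rhojam -> df r = 0 -> 0 <= x -> x < y -> y <= r -> f x < f y.
Proof.
move=> /andP[r0 rj] dr x0 xy yr.
have yj : y <= rhojam := le_trans yr (ltW rj).
have [z /andP[xz zy] E] := rel_deriv_MVT f_rel x0 xy yj.
rewrite -subr_gt0 E mulr_gt0 ?subr_gt0// -dr; apply: flux_deriv_decr => //.
- exact: ltW (le_lt_trans x0 xz).
- exact: lt_le_trans zy yr.
- exact: ltW.
Qed.

Lemma flux_max (r : R) : 0 < r < rhojam -> df r = 0 ->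
  max_flux f rhojam = f r /\ rho_max f rhojam = r.
Proof.
move=> rI dr; have rI' : 0 <= r <= rhojam by case/andP: rI => *; rewrite !ltW.
have fr x : 0 <= x <= rhojam -> x != r -> f x < f r.
  by move=> xI xr; have := flux_lt_tangent rI' xI; rewrite dr mul0r addr0 eq_sym; exact.
have fr' x : 0 <= x <= rhojam -> f x <= f r.
  by move=> xI; have [->//|/(fr _ xI)/ltW] := eqVneq x r.
have M : max_flux f rhojam = f r.
  apply/eqP; rewrite eq_le; apply/andP; split.
    apply: ge_sup; first by exists (f r), r => //=; rewrite in0j.
    by move=> _ [x /= xI <-]; rewrite fr'// -in0j.
  apply: ub_le_sup; last by exists r => //=; rewrite in0j.
  by exists (f r) => _ [x /= xI <-]; rewrite fr'// -in0j.
split => //; apply: xget_unique; first by split => //; rewrite M.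
move=> y [yI]; rewrite M => fy; apply/eqP/negPn/negP => yr.
by have := fr _ yI yr; rewrite fy ltxx.
Qed.

Lemma flux_invE (r x : R) : 0 < r < rhojam -> df r = 0 -> 0 <= x <= r -> flux_inv f rhojam (f x) = x.
Proof.
move=> rI dr /andP[x0 xr]; have [_ rm] := flux_max rI dr.
apply: xget_unique; first by split => //; rewrite rm x0 xr.
move=> y [/andP[y0]]; rewrite rm => yr fxy; apply/eqP; rewrite eq_le !leNgt.
apply/andP; split; apply/negP => xy.
  by have := flux_incr rI dr x0 xy yr; rewrite fxy ltxx.
by have := flux_incr rI dr y0 xy xr; rewrite fxy ltxx.
Qed.

Let rs := rho_max f rhojam.
Let M := max_flux f rhojam.

Lemma rho_max_facts : [/\ 0 < rs, rs < rhojam, df rs = 0 & M = f rs].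
Proof.
have [r rI dr] := flux_critical; have [ME rE] := flux_max rI dr.
by rewrite /rs rE; case/andP: rI.
Qed.

Let rs_bnd : 0 < rs < rhojam. Proof. by have [-> ->] := rho_max_facts. Qed.
Let df_rs : df rs = 0. Proof. by have [] := rho_max_facts. Qed.

Lemma flux_deriv_gt0 (x : R) : 0 <= x < rs -> 0 < df x.
Proof.
case/andP: rs_bnd => _ rj /andP[x0 xr]; rewrite -df_rs; apply: flux_deriv_decr => //.
exact: ltW.
Qed.

Lemma flux_surj (u : R) : 0 <= u < M -> exists2 x, 0 <= x < rs & f x = u.
Proof.
have [r0 rj _ ME] := rho_max_facts; rewrite ME => /andP[u0 ur].
have cont : {within `[0, rs], continuous f}.
  apply: continuous_subspaceW (rel_deriv_continuous f_rel) => z /=; rewrite !in_itv/=.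
  by move=> /andP[-> zy]; rewrite (le_trans zy) ?ltW.
have fr0 : 0 <= f rs := ltW (le_lt_trans u0 ur).
have [|c] := IVT (ltW r0) cont (v := u).
  by rewrite f0 (min_idPl _)// (max_idPr _)// u0 ltW.
rewrite in_itv/= => /andP[c0 cr] fc; exists c => //; rewrite c0 lt_neqAle cr andbT.
by apply/eqP => E; move: ur; rewrite -fc E ltxx.
Qed.

Lemma flux_lt_max (x : R) : 0 <= x < rs -> 0 <= f x < M.
Proof.
have [r0 rj dr ->] := rho_max_facts => /andP[x0 xr].
rewrite (flux_incr rs_bnd dr x0 xr (lexx _)) andbT.
move: x0; rewrite le_eqVlt => /predU1P[<-|x0]; first by rewrite f0.
by rewrite -f0 ltW// (flux_incr rs_bnd dr _ x0 (ltW xr)).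
Qed.

Lemma dflux_invE (x : R) : 0 <= x < rs -> dflux_inv f rhojam (f x) = (df x)^-1.
Proof.
move=> xI; have /andP[u0 uM] := flux_lt_max xI; have d0 := flux_deriv_gt0 xI.
have [r0 rj dr ME] := rho_max_facts; case/andP: (xI) => x0 xr.
have xj : 0 <= x <= rhojam by rewrite x0 (le_trans (ltW xr) (ltW rj)).
apply: has_rel_deriv_eq => [del del0|e e0].
  pose m := Num.min (del / 2) ((M - f x) / 2).
  have m0 : 0 < m by rewrite lt_min !divr_gt0// subr_gt0.
  have m1 : m <= del / 2 by rewrite /m ge_min lexx.
  have m2 : m <= (M - f x) / 2 by rewrite /m ge_min lexx orbT.
  exists (f x + m); first by rewrite /= in_itv/= addr_ge0//= 1?ltW// -/M; lra.
  split; first by rewrite gt_eqF// ltrDl.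
  by rewrite addrC addKr gtr0_norm//; lra.
(* Between 0 and [x1 < rs] the slope of f is at least [df x1 > 0], so closeness of flux values
   forces closeness of densities. *)
pose x1 := (x + rs) / 2.
have [xx1 x1r] : x < x1 /\ x1 < rs by rewrite /x1; lra.
have x1I : 0 <= x1 < rs by rewrite x1r (le_trans x0 (ltW xx1)).
have d1 := flux_deriv_gt0 x1I.
pose e' := Num.min (df x / 2) (e * df x ^+ 2 / 2).
have e'0 : 0 < e' by rewrite lt_min !divr_gt0// mulr_gt0// exprn_gt0.
have [del del0 H] := f_rel xj e'0.
have fx1 : f x < f x1 := flux_incr rs_bnd dr x0 xx1 (ltW x1r).
exists (Num.min (del * df x1) (f x1 - f x)); first by rewrite lt_min mulr_gt0//= subr_gt0.
move=> y yI yx; rewrite lt_min => /andP[yd y1].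
have /flux_surj[x' x'I yE] : 0 <= y < M by move: yI; rewrite /= in_itv.
rewrite /rel_quotient -yE !(flux_invE rs_bnd dr); last 2 first.
- by rewrite x0 ltW.
- by case/andP: x'I => -> /ltW ->.
case/andP: (x'I) => x'0 x'r.
have x'j : 0 <= x' <= rhojam by rewrite x'0 (le_trans (ltW x'r) (ltW rj)).
have x'x1 : x' <= x1.
  rewrite leNgt; apply/negP => /(flux_incr rs_bnd dr (ltW (le_lt_trans x0 xx1)))/(_ (ltW x'r)).
  by move: y1; rewrite -yE ltr_norml => /andP[_]; rewrite ltrD2r => h1 h2; have := lt_trans h1 h2; rewrite ltxx.
have xx' : x' != x by apply: contra_neq yx => <-.
have xd : `|x' - x| < del.
  rewrite -(ltr_pM2r d1); apply: le_lt_trans yd; rewrite -yE.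
  case/orP: (lt_total xx') => lt.
    have [z /andP[z1 z2] E] := rel_deriv_MVT f_rel x'0 lt (proj2 (andP xj)).
    rewrite -[x' - x]opprB -[f x' - f x]opprB !normrN E normrM mulrC.
    apply: ler_wpM2r => //; rewrite ger0_norm.
      by apply: flux_deriv_decrW; [exact: le_trans x'0 (ltW z1)|exact: ltW (lt_trans z2 xx1)|exact: ltW (lt_trans x1r rj)].
    by apply/ltW/flux_deriv_gt0; rewrite (le_trans x'0 (ltW z1)) (lt_trans z2).
  have [z /andP[z1 z2] E] := rel_deriv_MVT f_rel x0 lt (proj2 (andP x'j)).
  rewrite E normrM mulrC; apply: ler_wpM2r => //; rewrite ger0_norm.
    by apply: flux_deriv_decrW; [exact: le_trans x0 (ltW z1)|exact: le_trans (ltW z2) x'x1|exact: ltW (lt_trans x1r rj)].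
  by apply/ltW/flux_deriv_gt0; rewrite (le_trans x0 (ltW z1)) (lt_trans z2).
have := H x' _ xx' xd; rewrite /= in0j => /(_ x'j); rewrite /rel_quotient.
have -> : (x' - x) / (f x' - f x) = ((f x' - f x) / (x' - x))^-1 by rewrite invf_div.
exact: invr_close.
Qed.

Lemma dflux_inv0 : dflux_inv f rhojam 0 = (df 0)^-1.
Proof. by rewrite -[in LHS]f0 dflux_invE// lexx; have [->] := rho_max_facts. Qed.

Let p0 := dflux_inv f rhojam 0.

Lemma dflux_inv0_gt0 : 0 < p0.
Proof.
by rewrite /p0 dflux_inv0 invr_gt0 flux_deriv_gt0// lexx; have [->] := rho_max_facts.
Qed.

(** Slopes are parametrized by densities through p = 1 / f'(x). In this parameter gamma is f(x) and
    the Legendre transform is f(x) / f'(x) - x, which avoids any manipulation of the inverse of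
    g'. *)
Lemma slope_param (p : R) : p0 <= p -> exists2 x, 0 <= x < rs & p = (df x)^-1.
Proof.
move=> pp; have [r0 rj dr _] := rho_max_facts.
have pgt0 : 0 < p := lt_le_trans dflux_inv0_gt0 pp.
have d00 : 0 < df 0 by apply: flux_deriv_gt0; rewrite lexx.
have cont : {within `[0, rs], continuous df}.
  apply: continuous_subspaceW (rel_deriv_continuous df_rel) => z /=; rewrite !in_itv/=.
  by move=> /andP[-> zy]; rewrite (le_trans zy) ?ltW.
have [|c] := IVT (ltW r0) cont (v := p^-1).
  rewrite dr (min_idPr (ltW d00)) (max_idPl (ltW d00)) invr_ge0 (ltW pgt0)/=.
  by rewrite -[df 0]invrK lef_pV2 ?posrE ?invr_gt0// -dflux_inv0.
rewrite in_itv/= => /andP[c0 cr] fc; exists c; last by rewrite fc invrK.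
rewrite c0 lt_neqAle cr andbT; apply/eqP => E.
by have := pgt0; rewrite -invr_gt0 -fc E dr ltxx.
Qed.

Lemma gammaE (x : R) : 0 <= x < rs -> gamma f rhojam (df x)^-1 = f x.
Proof.
move=> xI; apply: xget_unique; first by split; [exact: flux_lt_max|exact: dflux_invE].
move=> y [/flux_surj[x' x'I <-]]; rewrite dflux_invE// => /invr_inj E.
have [r0 rj _ _] := rho_max_facts.
case/andP: xI => x0 xr; case/andP: x'I => x'0 x'r.
congr f; apply/eqP; rewrite eq_le !leNgt; apply/andP; split; apply/negP => xy.
  by have := flux_deriv_decr x0 xy (ltW (lt_trans x'r rj)); rewrite E ltxx.
by have := flux_deriv_decr x'0 xy (ltW (lt_trans xr rj)); rewrite E ltxx.
Qed.

(** The linear extension of g to negative fluxes makes the supremum infinite; [u] is chosen so that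
    its contribution is [|A| + 1]. *)
Lemma legendre_lt (p : R) : p < p0 -> legendre f rhojam p = +oo%E.
Proof.
move=> pp; apply/eq_infty => A.
pose u := - ((`|A| + 1) / (p0 - p)).
have u0 : u < 0 by rewrite /u oppr_lt0 divr_gt0 ?subr_gt0// ltr_wpDl.
apply: le_ereal_sup_tmp; exists ((p * u)%:E - flux_inv_ext f rhojam u)%E; first by exists u.
rewrite /flux_inv_ext u0 -/p0 -EFinB lee_fin.
have -> : p * u - p0 * u = `|A| + 1 by rewrite /u; field; rewrite subr_eq0 gt_eqF.
by rewrite (le_trans (ler_norm _))// lerDl.
Qed.

(** The tangent inequality for the concave f, divided by f'(x) > 0, says that the flux f(x)
    maximizes; negative fluxes do no better than 0 because the slope is at least [p0]. *)
Lemma legendreE (x : R) : 0 <= x < rs ->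
  legendre f rhojam (df x)^-1 = ((df x)^-1 * f x - x)%:E.
Proof.
move=> xI; have [r0 rj dr ME] := rho_max_facts; case/andP: (xI) => x0 xr.
have xj : 0 <= x <= rhojam by rewrite x0 (le_trans (ltW xr) (ltW rj)).
have d0 := flux_deriv_gt0 xI; have /andP[u0 uM] := flux_lt_max xI.
have key y : 0 <= y <= rs -> (df x)^-1 * f y - y <= (df x)^-1 * f x - x.
  move=> /andP[y0 yr]; have [->//|xy] := eqVneq x y.
  have yj : 0 <= y <= rhojam by rewrite y0 (le_trans yr (ltW rj)).
  have /ltW := flux_lt_tangent xj yj xy.
  have d0' : 0 <= (df x)^-1 by rewrite invr_ge0 ltW.
  move=> /(ler_wpM2l d0'); rewrite mulrDr mulrA mulVf ?gt_eqF// mul1r; lra.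
apply/eqP; rewrite eq_le; apply/andP; split; last first.
  apply: le_ereal_sup_tmp; exists (((df x)^-1 * f x)%:E - flux_inv_ext f rhojam (f x))%E.
    by exists (f x).
  rewrite /flux_inv_ext ltNge u0/= -/M (ltW uM) (flux_invE rs_bnd dr) ?x0 ?(ltW xr)//.
apply: ge_ereal_sup => _ [u _ <-]; rewrite /flux_inv_ext; case: ifPn => [un|].
  rewrite -EFinB lee_fin -/p0 -mulrBl.
  apply: (@le_trans _ _ 0).
    rewrite nmulr_lle0// subr_ge0 /p0 dflux_inv0 lef_pV2 ?posrE//.
      by apply: flux_deriv_decrW => //; case/andP: xj.
    by rewrite flux_deriv_gt0// lexx.
  by have := key 0; rewrite f0 mulr0 subr0 lexx ltW//; exact.
rewrite -leNgt => up; case: ifPn => [uM'|_]; last by rewrite leNye.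
have [y yI <-] : exists2 y, 0 <= y <= rs & f y = u.
  move: uM'; rewrite le_eqVlt => /predU1P[->|uM'].
    by exists rs; [rewrite lexx ltW|rewrite -ME].
  have [|y /andP[y0 yr] <-] := @flux_surj u; first by rewrite up.
  by exists y => //; rewrite y0 ltW.
by rewrite (flux_invE rs_bnd dr)// -EFinB lee_fin key.
Qed.

End Flux.

(* [h] is the Legendre transform of g restricted to [0, M]; it agrees with
   [g^*] where the latter is finite and vanishes elsewhere. [gam] is [h']. *)
Record legendre_pair (R : realType) (p0 M kappa : R) (gam h : R -> R) : Prop := {
  lp_p0 : 0 < p0;
  lp_kappa : 0 < kappa;
  lp_subgrad : forall p q, h p + gam p * (q - p) <= h q;
  lp_gam_nd : forall p q, p <= q -> gam p <= gam q;
  lp_gam_lip : forall p q, p <= q -> gam q - gam p <= kappa * (q - p);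
  lp_gam_incr : forall p q, p0 <= p -> p < q -> gam p < gam q;
  lp_gam0 : forall p, p <= p0 -> gam p = 0;
  lp_gam_bnd : forall p, 0 <= gam p < M;
  lp_h0 : forall p, p <= p0 -> h p = 0 }.

Definition flux_conj (R : realType) (f : R -> R) (rhojam p : R) : R :=
  if dflux_inv f rhojam 0 <= p then fine (legendre f rhojam p) else 0.

Lemma flux_legendre_pair (R : realType) (rhojam : R) (f : R -> R) :
  0 < rhojam -> C2_on `[0, rhojam] f ->
  (forall r, 0 <= r <= rhojam -> deriv_on `[0, rhojam] (deriv_on `[0, rhojam] f) r < 0) ->
  f 0 = 0 -> f rhojam = 0 ->
  exists kappa, legendre_pair (dflux_inv f rhojam 0) (max_flux f rhojam) kappa
    (segment_value f rhojam) (flux_conj f rhojam) /\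
  forall p, legendre f rhojam p =
    if dflux_inv f rhojam 0 <= p then (flux_conj f rhojam p)%:E else +oo%E.
Proof.
move=> j0 C2 cc f0 fj.
pose df := deriv_on `[0, rhojam] f; pose p0 := dflux_inv f rhojam 0.
pose rs := rho_max f rhojam.
have [r0 rj dr ME] := rho_max_facts j0 C2 cc f0 fj.
have [c c0 Hc] := flux_second_deriv_bound j0 C2 cc.
have p00 : 0 < p0 := dflux_inv0_gt0 j0 C2 cc f0 fj.
have par p : p0 <= p -> exists2 x, 0 <= x < rs & p = (df x)^-1.
  exact: slope_param.
have dgt0 x : 0 <= x < rs -> 0 < df x by exact: flux_deriv_gt0.
have gE x : 0 <= x < rs -> p0 <= (df x)^-1.
  move=> xI; rewrite /p0 dflux_inv0// lef_pV2 ?posrE ?dgt0 ?lexx//.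
  case/andP: xI => x0 xr; apply: flux_deriv_decrW => //; exact: ltW (lt_trans xr rj).
have sE x : 0 <= x < rs -> segment_value f rhojam (df x)^-1 = f x.
  by move=> xI; rewrite /segment_value gE// gammaE.
have hE x : 0 <= x < rs -> flux_conj f rhojam (df x)^-1 = (df x)^-1 * f x - x.
  by move=> xI; rewrite /flux_conj gE// legendreE.
have legE p : legendre f rhojam p = if p0 <= p then (flux_conj f rhojam p)%:E else +oo%E.
  case: ifPn => [/par[x xI ->]|]; first by rewrite hE// legendreE.
  by rewrite -ltNge => /legendre_lt ->.
have E0 : p0 = (df 0)^-1 by apply: dflux_inv0.
have I0 : (0 : R) <= 0 < rs by apply/andP; split.
have incr x y : 0 <= x < rs -> 0 <= y < rs -> x < y -> f x < f y.
  move=> /andP[x0 xr] /andP[y0 yr] xy; apply: (flux_incr j0 C2 cc (r := rs)) => //.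
    by rewrite r0.
  exact: ltW.
have incrp x y : 0 <= x < rs -> 0 <= y < rs -> (df x)^-1 < (df y)^-1 -> x < y.
  move=> xI yI; rewrite ltf_pV2 ?posrE ?dgt0//; rewrite ltNge => dd; rewrite ltNge.
  apply: contra dd => yx; case/andP: xI => x0 xr; case/andP: yI => y0 yr.
  by apply: flux_deriv_decrW => //; exact: ltW (lt_trans xr rj).
have g0 p : p <= p0 -> segment_value f rhojam p = 0.
  rewrite le_eqVlt => /predU1P[->|]; first by rewrite E0 sE.
  by rewrite /segment_value leNgt => ->.
have h0 p : p <= p0 -> flux_conj f rhojam p = 0.
  rewrite le_eqVlt => /predU1P[->|]; first by rewrite E0 hE// f0 mulr0 subr0.
  by rewrite /flux_conj leNgt => ->.
have gb p : 0 <= segment_value f rhojam p < max_flux f rhojam.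
  have [pp|/ltW pp] := leP p0 p; last first.
    by rewrite g0// lexx; have := flux_lt_max j0 C2 cc f0 fj I0; rewrite f0 => /andP[].
  by have [x xI ->] := par _ pp; rewrite sE//; exact: flux_lt_max.
have gnd p q : p < q -> p0 <= p -> segment_value f rhojam p < segment_value f rhojam q.
  move=> pq pp; have [x xI px] := par _ pp; have [y yI qy] := par _ (le_trans pp (ltW pq)).
  by rewrite px qy !sE//; apply: incr => //; apply: incrp; rewrite -?px -?qy.
(* The maximizing flux for [p] is a competitor in the supremum for [q]. *)
have sub1 p q : p0 <= p -> p0 <= q ->
    flux_conj f rhojam p + segment_value f rhojam p * (q - p) <= flux_conj f rhojam q.
  move=> pp pq; have [x xI px] := par _ pp.
  rewrite [in X in X <= _]px hE// sE// -px -lee_fin.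
  have := legE q; rewrite pq => <-; apply: le_ereal_sup_tmp.
  exists ((q * f x)%:E - flux_inv_ext f rhojam (f x))%E; first by exists (f x).
  have /andP[u0 uM] := flux_lt_max j0 C2 cc f0 fj xI.
  rewrite /flux_inv_ext ltNge u0/= (ltW uM) (flux_invE j0 C2 cc (r := rs))//; last 2 first.
  - by rewrite r0.
  - by case/andP: xI => -> /ltW ->.
  by rewrite -EFinB lee_fin le_eqVlt; apply/orP; left; apply/eqP; ring.
(* Three Lipschitz constants: [df 0] of flux against density, [1 / c] of density against f', and
   [1 / p0 ^+ 2] of 1/p against p. *)
pose kappa := df 0 / c / p0 ^+ 2.
have k0 : 0 < kappa by rewrite /kappa !divr_gt0 ?exprn_gt0 ?dgt0.
exists kappa; split; last exact: legE.
have gl p q : p0 <= p -> p < q -> segment_value f rhojam q - segment_value f rhojam p <= kappa * (q - p).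
  move=> pp pq; have [x xI px] := par _ pp; have [y yI qy] := par _ (le_trans pp (ltW pq)).
  have xy : x < y by apply: incrp; rewrite -?px -?qy.
  rewrite [in X in X - _]qy [in X in _ - X]px !sE//.
  case/andP: (xI) => x0 xr; case/andP: (yI) => y0 yr.
  have xj : 0 <= x <= rhojam by rewrite x0 (le_trans (ltW xr) (ltW rj)).
  have yj : 0 <= y <= rhojam by rewrite y0 (le_trans (ltW yr) (ltW rj)).
  have tan : f y - f x <= df 0 * (y - x).
    rewrite lerBlDl (le_trans (ltW (flux_lt_tangent j0 C2 cc xj yj _)))// ?lt_eqF//.
    rewrite lerD2l ler_wpM2r ?subr_ge0 ?(ltW xy)//; apply: flux_deriv_decrW => //.
    by case/andP: xj.
  have pgt : 0 < p := lt_le_trans p00 pp; have qgt : 0 < q := lt_trans pgt pq.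
  have s1 : y - x <= (p^-1 - q^-1) / c.
    rewrite ler_pdivlMr// mulrC px qy !invrK.
    by apply: (Hc x y x0 (ltW xy)); case/andP: yj.
  have s2 : p^-1 - q^-1 <= (q - p) / p0 ^+ 2.
    have -> : p^-1 - q^-1 = (q - p) / (p * q) by field; rewrite !gt_eqF.
    rewrite ler_pM2l ?subr_gt0// lef_pV2 ?posrE ?mulr_gt0 ?exprn_gt0// expr2.
    by rewrite ler_pM ?(ltW p00)// (le_trans pp (ltW pq)).
  have -> : kappa * (q - p) = df 0 * ((q - p) / p0 ^+ 2 / c) by rewrite /kappa; ring.
  apply: le_trans tan _; rewrite ler_pM2l ?dgt0//; apply: le_trans s1 _.
  by rewrite ler_pM2r ?invr_gt0.
split => //.
- move=> p q; have [pp|/ltW pp] := leP p0 p; have [pq|/ltW pq] := leP p0 q.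
  + exact: sub1.
  + rewrite (h0 q)//; have := sub1 _ _ pp (lexx p0); rewrite (h0 p0)//; apply: le_trans.
    by rewrite lerD2l ler_wpM2l ?lerD2r//; have /andP[] := gb p.
  + rewrite h0// g0// mul0r addr0; have := sub1 _ _ (lexx p0) pq.
    by rewrite h0// g0// mul0r addr0.
  + by rewrite !h0// g0// mul0r addr0.
- move=> p q; rewrite le_eqVlt => /predU1P[->//|pq].
  have [pp|/ltW pp] := leP p0 p; first exact/ltW/gnd.
  by rewrite g0//; have /andP[] := gb q.
- move=> p q; rewrite le_eqVlt => /predU1P[->|pq]; first by rewrite !subrr mulr0.
  have [pp|/ltW pp] := leP p0 p; first exact: gl.
  rewrite (g0 p)//; have [pq0|pq0] := leP q p0.
    by rewrite g0// subrr mulr_ge0 ?(ltW k0)// subr_ge0 ltW.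
  rewrite -[X in _ - X](g0 p0)//; apply: le_trans (gl _ _ (lexx _) pq0) _.
  by rewrite ler_pM2l// lerD2l lerN2.
- by move=> p q pp pq; exact: gnd.
Qed.

(** * Cumulative functions of rates *)

(** Both sides are the length of the intersection of []a, b]] and []0, G]]. *)
Lemma clamp_diff (R : realType) (a b G : R) : 0 <= G -> a < b ->
  (if Num.max a 0 < Num.min b G then Num.min b G - Num.max a 0 else 0) =
  Num.min (Num.max b 0) G - Num.min (Num.max a 0) G.
Proof.
move=> G0 ab; case: (leP a 0) => a0; case: (leP b 0) => b0; case: (leP b G) => bG;
  case: (leP a G) => aG; rewrite ?(min_idPl G0)//; case: ltP => //; lra.
Qed.

Section Rates.
Context (R : realType).
Notation mu := (@lebesgue_measure R).
Implicit Types (w : R -> R) (M : R).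

Lemma null_subset (A B : set R) : B `<=` A -> mu.-negligible A -> mu.-negligible B.
Proof. by move=> BA A0; have := @negligibleS _ _ _ mu _ _ BA A0. Qed.

Definition rate M w := [/\ measurable_fun setT w, forall t, 0 <= w t <= M &
  mu.-integrable setT (EFin \o w)].

Definition mass w := \int[mu]_t w t.

Lemma mass_split (F : R -> R) (X : R) : mu.-integrable setT (EFin \o F) ->
  mass F = cum_departures F X + \int[mu]_(s in `]X, +oo[) F s.
Proof.
move=> iF; rewrite /cum_departures -Rintegral_setU//.
- by congr Rintegral; rewrite -itv_bndbnd_setU// set_itvE.
- by rewrite -itv_bndbnd_setU// set_itvE.
- by apply/disj_setPS => s /= []; rewrite !in_itv/= andbT => /le_lt_trans h /h; rewrite ltxx.
Qed.

(** Monotone convergence along the intervals []- n, n]]. *)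
Lemma mass_concentrated (F : R -> R) (e : R) : mu.-integrable setT (EFin \o F) ->
  (forall t, 0 <= F t) -> 0 < e ->
  exists2 B : R, 0 < B & mass F - e < \int[mu]_(x in `]- B, B]) F x.
Proof.
move=> iF F0 e0; pose D (n : nat) : set R := `]- n%:R, n%:R]%classic.
have UD : \bigcup_n D n = setT.
  apply/seteqP; split => // x _; exists (Num.truncn `|x|).+1 => //=.
  have xn : `|x| < (Num.truncn `|x|).+1%:R by rewrite truncnS_gt.
  by rewrite /D/= in_itv/= (ltW (le_lt_trans (ler_norm _) xn)) andbT ltrNl
    (le_lt_trans _ xn)// -normrN ler_norm.
have /integrableP[mF _] := iF.
have cv : (\int[mu]_(x in D i) (F x)%:E)%E @[i --> \oo] --> (\int[mu]_(x in setT) (F x)%:E)%E.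
  rewrite -UD; apply: ge0_nondecreasing_set_cvg_integral => //.
  - apply/nondecreasing_seqP => n; rewrite subsetEset => x; rewrite /D/= !in_itv/=.
    move=> /andP[h1 h2]; rewrite (le_trans h2) ?ler_nat// andbT.
    by rewrite (le_lt_trans _ h1)// lerN2 ler_nat.
  - by move=> i; exact: measurable_itv.
  - by move=> i; exact: measurable_funTS.
  - by move=> i x _; rewrite lee_fin.
have cvR : \int[mu]_(x in D i) F x @[i --> \oo] --> mass F.
  by apply: fine_cvg; rewrite fineK; [exact: cv|exact: integrable_fin_num].
have [N _ HN] := (cvgrPdist_lt _ _).1 cvR e e0.
have {}HN := HN (maxn N 1) (leq_maxl _ _).
exists (maxn N 1)%:R; first by rewrite ltr0n leq_max orbT.
by rewrite ltrBlDr -ltrBlDl; apply: le_lt_trans HN; exact: ler_norm.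
Qed.

Section OneRate.
Variables (M : R) (w : R -> R).
Hypothesis rw : rate M w.

Let w0 t : 0 <= w t. Proof. by case: rw => _ /(_ t)/andP[]. Qed.
Let wM t : w t <= M. Proof. by case: rw => _ /(_ t)/andP[]. Qed.

Lemma rate_int (D : set R) : measurable D -> mu.-integrable D (EFin \o w).
Proof. by move=> mD; case: rw => _ _; exact: integrableS. Qed.

Lemma rate_bound_ge0 : 0 <= M. Proof. exact: le_trans (w0 0) (wM 0). Qed.

Lemma cumB (s t : R) : s <= t -> cum_departures w t - cum_departures w s = \int[mu]_(x in `]s, t]) w x.
Proof. by move=> st; rewrite /cum_departures Rintegral_itvB//; exact: rate_int. Qed.

Lemma cum_nd (s t : R) : s <= t -> cum_departures w s <= cum_departures w t.
Proof. by move=> st; rewrite -subr_ge0 cumB//; exact: Rintegral_ge0. Qed.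

Lemma cum_lip (s t : R) : s <= t -> cum_departures w t - cum_departures w s <= M * (t - s).
Proof.
move=> st; rewrite cumB//.
have -> : M * (t - s) = \int[mu]_(x in `]s, t]) cst M x.
  rewrite Rintegral_cst//= lebesgue_measure_itv/= lte_fin; case: ltP => //= ts.
  by congr (M * _); apply/eqP; rewrite subr_eq0 eq_le ts.
apply: le_Rintegral => //; first exact: rate_int.
apply: measurable_bounded_integrable => //; last exact: bounded_cst.
by rewrite /= lebesgue_measure_itv/=; case: ifP => // _; rewrite -EFinB ltry.
Qed.

Lemma cum_ge0 t : 0 <= cum_departures w t.
Proof. exact: Rintegral_ge0. Qed.

Lemma cum_le_mass t : cum_departures w t <= mass w.
Proof.
have mf : measurable_fun setT w by case: rw.
rewrite fine_le//.
- by apply: integrable_fin_num => //; exact: rate_int.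
- by apply: integrable_fin_num => //; exact: rate_int.
- apply: ge0_subset_integral => //; first exact/measurable_EFinP.
  by move=> x _; rewrite lee_fin.
Qed.

Lemma cum_continuous : continuous (cum_departures w).
Proof.
move=> x; apply/cvgrPdist_le => e e0.
have M1 : 0 < M + 1 by rewrite ltr_wpDl// rate_bound_ge0.
near=> y.
have : `|x - y| <= e / (M + 1) by near: y; apply: cvgr_dist_le; rewrite ?divr_gt0.
rewrite ler_pdivlMr// => xy; apply: le_trans xy.
have lip a b : a <= b -> `|cum_departures w a - cum_departures w b| <= `|a - b| * (M + 1).
  move=> ab; rewrite distrC ger0_norm ?subr_ge0 ?cum_nd// distrC ger0_norm ?subr_ge0//.
  by rewrite (le_trans (cum_lip ab))// mulrC ler_wpM2l ?subr_ge0// lerDl.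
have [xy|/ltW yx] := leP x y; first exact: lip.
by rewrite distrC [leRHS](_ : _ = `|y - x| * (M + 1)) ?lip// distrC.
Unshelve. all: by end_near. Qed.

Lemma cum_tails (e : R) : 0 < e -> exists2 B : R, 0 < B & forall t : R,
  (t <= - B -> cum_departures w t < e) /\ (B <= t -> mass w - e < cum_departures w t).
Proof.
move=> e0; have [_ _ iw] := rw; have [B B0 HB] := mass_concentrated iw w0 e0.
exists B => // t; rewrite -cumB in HB; last by lra.
have := cum_le_mass B; have := cum_ge0 (- B) => h1 h2.
by split => h; [have := cum_nd h|have := cum_nd h]; lra.
Qed.

Lemma cum_surj (r : R) : 0 < r < mass w -> exists s, cum_departures w s = r.
Proof.
move=> /andP[r0 rG]; have [B1 B10 H1] := cum_tails r0.
have e0 : 0 < mass w - r by rewrite subr_gt0.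
have [B2 B20 H2] := cum_tails e0.
have ab : - B1 <= B2 by lra.
have cont : {within `[- B1, B2], continuous (cum_departures w)}.
  exact/continuous_subspaceT/cum_continuous.
have h1 := (H1 (- B1)).1 (lexx _); have h2 := (H2 B2).2 (lexx _).
have [|c _ cE] := IVT ab cont (v := r); last by exists c.
rewrite (min_idPl (cum_nd ab)) (max_idPr (cum_nd ab)) (ltW h1)/= ltW//; lra.
Qed.

End OneRate.

(** * Measures with density, and integration by rank *)

Section Density.
Variables (w : R -> R) (mw : measurable_fun setT w) (w0 : forall t, 0 <= w t)
  (iw : mu.-integrable setT (EFin \o w)).

(** The dummy [let] makes the three proofs arguments of [density], so that the measure structure
    declared below can be attached to it. *)
Definition density (A : set (measurableTypeR R)) : \bar R :=
  let _ := (mw, w0, iw) in \int[mu]_(x in A) (w x)%:E.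

Let d0 : density set0 = 0%E. Proof. by rewrite /density integral_set0. Qed.
Let dge0 A : (0 <= density A)%E.
Proof. by apply: integral_ge0 => x _; rewrite lee_fin. Qed.
Let dsa : semi_sigma_additive density.
Proof.
apply: semi_sigma_additive_nng_induced.
- exact: measurable_int iw.
- by move=> x; rewrite lee_fin.
Qed.

HB.instance Definition _ := isMeasure.Build _ _ _ density d0 dge0 dsa.

Let dfin : fin_num_fun density.
Proof.
by move=> A mA; apply: integrable_fin_num => //; exact: integrableS iw.
Qed.

HB.instance Definition _ := @Measure_isFinite.Build _ _ _ density dfin.

(** The Radon-Nikodym derivative of this measure has the same integrals as [w] on all measurable
    sets, hence equals [w] almost everywhere. *)
Lemma integral_density (F : R -> \bar R) (D : set R) : measurable D ->
  measurable_fun D F -> (forall r, 0 <= F r)%E ->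
  (\int[density]_(x in D) F x = \int[mu]_(x in D) (F x * (w x)%:E))%E.
Proof.
move=> mD mF F0.
have dom : density `<< mu.
  apply/null_content_dominatesP => A mA A0; rewrite /density.
  by rewrite null_set_integral//; apply: measurable_funTS; exact: measurable_int iw.
rewrite -(Radon_Nikodym_SigmaFinite.change_of_variables dom F0 mD mF).
apply: ae_eq_integral => //.
- apply: emeasurable_funM => //; apply: measurable_funTS.
  exact: measurable_int (Radon_Nikodym_SigmaFinite.f_integrable dom).
- by apply: emeasurable_funM => //; apply/measurable_EFinP; exact: measurable_funTS.
have : ae_eq mu setT (Radon_Nikodym_SigmaFinite.f density mu) (fun x => (w x)%:E).
  apply: integral_ae_eq => //.
  - exact: Radon_Nikodym_SigmaFinite.f_integrable.
  - exact: measurable_int iw.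
  - by move=> E _ mE; rewrite -Radon_Nikodym_SigmaFinite.f_integral.
by apply: filterS => x /= h Dx; rewrite h.
Qed.

End Density.

Lemma itv_nondecreasing_measurable (D : set R) (f : R -> R) : is_interval D ->
  (forall x y, D x -> D y -> x <= y -> f x <= f y) -> measurable_fun D f.
Proof.
move=> iD f_nd; have mD := is_interval_measurable iD.
apply: (measurability (@RGenCInfty.G R)) => [|/= _ [_] [r] -> <-].
  exact: RGenCInfty.measurableE.
apply: is_interval_measurable => s t /= [Ds +] [Dt _] u /andP[su ut].
have Du : D u by apply: (iD s t) => //; rewrite su.
by rewrite !in_itv/= !andbT => fs; split => //; rewrite (le_trans fs)// f_nd.
Qed.

Definition quantile w (r : R) := inf [set t | r <= cum_departures w t].

Section Pushforward.
Variables (M : R) (w : R -> R).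
Hypothesis rw : rate M w.
Local Notation A := (cum_departures w).

Let mw : measurable_fun setT w. Proof. by case: rw. Qed.
Let w0 t : 0 <= w t. Proof. by case: rw => _ /(_ t)/andP[]. Qed.
Let iw : mu.-integrable setT (EFin \o w). Proof. by case: rw. Qed.
Let EmwD (D : set R) : measurable_fun D (fun x => (w x)%:E).
Proof. by apply/measurable_funTS/measurable_EFinP. Qed.

Lemma cum_measurable : measurable_fun setT A.
Proof. by apply: nondecreasing_measurable => // x y; exact: cum_nd rw _ _. Qed.

Lemma measurable_cum_le r : measurable [set s | A s <= r].
Proof.
have := cum_measurable measurableT (measurable_itv `]-oo, r]).
by rewrite setTI; congr measurable; apply/seteqP; split => x /=; rewrite in_itv.
Qed.

Lemma cum_quantile_le (r s : R) : 0 < r -> r <= A s -> quantile w r <= s.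
Proof.
move=> r0 rs; apply: ge_inf => //=.
have [B _ HB] := cum_tails rw r0; exists (- B) => t /= rt.
rewrite leNgt; apply/negP => tB.
by have := (HB t).1 (ltW tB); rewrite ltNge rt.
Qed.

(** Monotonicity holds only on []0, mass w[]. Elsewhere the set under the infimum is everything or
    empty and [inf] returns a constant, except at the single rank [mass w], where either kind of set
    may occur. *)
Lemma quantile_measurable : measurable_fun setT (quantile w).
Proof.
have wm := cum_le_mass rw; have m0 : 0 <= mass w := le_trans (cum_ge0 rw 0) (wm 0).
have -> : setT = (`]-oo, 0%R] `|` `]0%R, mass w[) `|` ([set mass w] `|` `]mass w, +oo[) :> set R.
  apply/seteqP; split => // x _ /=; rewrite !in_itv/= andbT.
  have [x0|x0] := leP x 0; first by left; left.
  have [xm|xm|xm] := ltgtP x (mass w).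
  - by left; right.
  - by right; right.
  - by right; left.
apply/measurable_funU; [exact: measurableU|exact: measurableU|].
split; apply/measurable_funU => //; split.
- apply: (eq_measurable_fun (cst (inf setT))); last exact: measurable_cst.
  move=> r /[!inE]/= /[!in_itv]/= r0.
  congr inf; apply/seteqP; split => // t _ /=; exact: le_trans r0 (cum_ge0 rw t).
- apply: itv_nondecreasing_measurable; first exact: interval_is_interval.
  move=> r1 r2 /=; rewrite !in_itv/= => /andP[r10 r1m] /andP[r20 r2m] r12.
  apply: lb_le_inf; first by have [|s sE] := cum_surj rw (r := r2); [rewrite r20|exists s; rewrite /= sE].
  by move=> s /= r2s; apply: cum_quantile_le => //; exact: le_trans r2s.
- exact: measurable_fun_set1.
- apply: (eq_measurable_fun (cst (inf set0))); last exact: measurable_cst.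
  move=> r /[!inE]/= /[!in_itv]/= /[!andbT] r0.
  congr inf; apply/seteqP; split => // t /= rt; have := wm t; rewrite leNgt.
  by rewrite (lt_le_trans r0 rt).
Qed.

Let intE (D : set R) : measurable D -> (\int[mu]_(x in D) (w x)%:E = (\int[mu]_(x in D) w x)%:E)%E.
Proof. by move=> mD; rewrite fineK//; apply: integrable_fin_num => //; exact: rate_int rw _ mD. Qed.

Lemma density_cum_le r :
  (\int[mu]_(s in [set s | (A s <= r)%R]) (w s)%:E = (Num.min (Num.max r 0) (mass w))%:E)%E.
Proof.
have wm := cum_le_mass rw; have m0 : 0 <= mass w := le_trans (cum_ge0 rw 0) (wm 0).
have mS := measurable_cum_le r.
have [r0|r0] := ltP r 0.
  rewrite (min_idPl m0) (_ : [set _ | _] = set0) ?integral_set0//.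
  by apply/seteqP; split => // s /=; rewrite leNgt (lt_le_trans r0)// (cum_ge0 rw).
have [rm|rm] := leP (mass w) r.
  rewrite (_ : [set _ | _] = setT) ?intE//.
  by apply/seteqP; split => // s _ /=; exact: le_trans rm.
apply/eqP; rewrite eq_le; apply/andP; split.
  apply/lee_addgt0Pr => e e0; rewrite -EFinD.
  (* A rank slightly above [r] that is still attained, say at [s]: then [A <= r] confines the times
     to []-oo, s]], even when [A] is flat at height [r]. *)
  pose r' := Num.min (r + e) ((r + mass w) / 2).
  have h1 : r < r' by rewrite lt_min; apply/andP; split; lra.
  have h2 : r' <= r + e by rewrite ge_min lexx.
  have h3 : r' < mass w by rewrite gt_min; apply/orP; right; lra.
  have [|s sE] := cum_surj rw (r := r'); first by rewrite (le_lt_trans r0 h1) h3.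
  apply: (@le_trans _ _ (r'%:E)); last by rewrite lee_fin.
  rewrite -sE /cum_departures -intE//; apply: ge0_subset_integral => //.
  - by apply: EmwD.
  - by move=> x _; rewrite lee_fin.
  move=> x /= xr; rewrite in_itv/= leNgt; apply/negP => sx.
  by have := cum_nd rw (ltW sx); rewrite sE leNgt (le_lt_trans xr h1).
have [rneg|{}r0|->] := ltgtP r 0; first by move: r0; rewrite leNgt rneg.
  2: by apply: integral_ge0 => x _; rewrite lee_fin.
have [|s sE] := cum_surj rw (r := r); first by rewrite r0.
rewrite -[in X in (X <= _)%E]sE /cum_departures -intE//; apply: ge0_subset_integral => //.
- by apply: EmwD.
- by move=> x _; rewrite lee_fin.
by move=> x /=; rewrite in_itv/= => xs; rewrite -sE (cum_nd rw).
Qed.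

Lemma rate_null_set (D : set R) : measurable D -> (\int[mu]_(s in D) (w s)%:E = 0)%E ->
  mu.-negligible [set s | D s /\ 0 < w s].
Proof.
move=> mD H.
have : ae_eq mu D (fun s => (w s)%:E) (cst 0%E).
  apply/ae_eq_integral_abs => //; first by apply: EmwD.
  by under eq_integral do rewrite gee0_abs ?lee_fin//.
apply: null_subset => s [Ds ws] /= /(_ Ds) [] E; by rewrite E ltxx in ws.
Qed.

(** The times where [A <= A S] and the times up to [S] carry the same mass, so their difference
    carries none. *)
Lemma cum_flat_null (S : R) : mu.-negligible [set s | S < s /\ A s <= A S /\ 0 < w s].
Proof.
have mS := measurable_cum_le (A S).
apply: (@null_subset [set s | ([set s | A s <= A S] `\` `]-oo, S]) s /\ 0 < w s]).
  move=> s /= [Ss [As ws]]; split => //; split => //.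
  by rewrite in_itv/= leNgt Ss.
apply: rate_null_set; first exact: measurableD.
have SE : [set s | A s <= A S] = `]-oo, S] `|` ([set s | A s <= A S] `\` `]-oo, S]).
  rewrite setDE setUIr setUv setIT; apply/seteqP; split => s /=; first by right.
  by rewrite in_itv/= => -[sS|//]; exact: cum_nd rw _ _ sS.
have mD : measurable ([set s | A s <= A S] `\` `]-oo, S]) by exact: measurableD.
have := density_cum_le (A S); rewrite (max_idPl (cum_ge0 rw S)) (min_idPl (cum_le_mass rw S)).
rewrite {1}SE ge0_integral_setU//=; last 3 first.
- by apply: EmwD.
- by move=> x _; rewrite lee_fin.
- by apply/disj_setPS => s [? []].
rewrite intE// (intE mD).
by rewrite -EFinD => -[]; rewrite /cum_departures -[RHS]addr0 => /addrI ->.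
Qed.

Lemma cum0_null : mu.-negligible [set s | A s <= 0 /\ 0 < w s].
Proof.
apply: rate_null_set; first exact: measurable_cum_le.
have m0 : 0 <= mass w := le_trans (cum_ge0 rw 0) (cum_le_mass rw 0).
by rewrite density_cum_le maxxx (min_idPl m0).
Qed.

(** If the quantile of [A s] is smaller than [s], then [A] is flat between some rational time and
    [s]; the union of the flat null sets over all rationals is still null. *)
Lemma quantile_cum : mu.-negligible [set s | 0 < w s /\ quantile w (A s) != s].
Proof.
apply: (@null_subset ([set s | A s <= 0 /\ 0 < w s] `|`
   (* [unpickle] enumerates the rationals; codes of nothing are sent to 0. *)
   \bigcup_n [set s | ratr (odflt 0 (unpickle n)) < s /\ A s <= A (ratr (odflt 0 (unpickle n))) /\ 0 < w s])).
  move=> s /= [ws qs]; have [A0|A0] := leP (A s) 0; [by left|right].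
  have : quantile w (A s) < s by rewrite lt_neqAle qs cum_quantile_le.
  move=> qs'; have [t At ts] : exists2 t, A s <= A t & t < s.
    have [|t /= tA ts] := inf_lt _ qs'.
      by exists s => /=.
    by exists t.
  have [q] := rat_in_itvoo ts; rewrite in_itv/= => /andP[tq qs2].
  exists (pickle q); first by []; rewrite pickleK; split; first exact: qs2.
  by split; [exact: le_trans At (cum_nd rw (ltW tq))|exact: ws].
apply: negligibleU; first exact: cum0_null.
by apply: negligible_bigcup => n; exact: cum_flat_null.
Qed.

(** The substitution r = A(s). The image under [A] of the measure with density [w], completed by
    Lebesgue measure off []0, mass w]], gives every half-open interval its length, so it is Lebesgue
    measure. *)
Lemma change_of_rank (F : R -> \bar R) : measurable_fun setT F -> (forall r, 0 <= F r)%E ->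
  (\int[mu]_s (F (A s) * (w s)%:E) = \int[mu]_(r in `]0%R, mass w]) F r)%E.
Proof.
move=> mF F0; have m0 : 0 <= mass w := le_trans (cum_ge0 rw 0) (cum_le_mass rw 0).
pose I : set R := `]0%R, mass w]%classic.
have mI : measurable I by exact: measurable_itv.
have mCI : measurable (~` I) by exact: measurableC.
have mA : @measurable_fun _ _ (measurableTypeR R) (measurableTypeR R) setT A := cum_measurable.
have mpre (D : set R) : measurable D -> measurable (A @^-1` D).
  by move=> mD; rewrite -[X in measurable X]setTI; exact: mA.
pose dm : {measure set (measurableTypeR R) -> \bar R} := density mw w0 iw.
pose nuM : {measure set (measurableTypeR R) -> \bar R} :=
  measure_function_pushforward__canonical__measure_function_Measure dm mA.
pose m := measure_add nuM (mrestr mu mCI).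
have mv X : m X = (nuM X + mrestr mu mCI X)%E by exact: measure_addE.
have mE X : measurable X -> mu X = m X.
  apply: lebesgue_measure_unique => _ [[a b] _ <-]; rewrite /fst /snd; apply/esym/(etrans (mv _))/esym.
  have [ba|ab] := leP b a; first by rewrite set_itv_ge ?bnd_simp -?leNgt// !measure0 adde0.
  pose D r := Num.min (Num.max r 0) (mass w).
  have nuE : nuM `]a, b]%classic = (D b - D a)%:E.
    have mle r := measurable_cum_le r.
    have UE : [set s | A s <= b] = [set s | A s <= a] `|` (A @^-1` `]a, b]).
      apply/seteqP; split => s /=; rewrite in_itv/=.
        by move=> ->; rewrite andbT; have [|] := leP (A s) a; [left|right].
      by case=> [/le_trans|/andP[]//]; apply; exact: ltW.
    have := density_cum_le b; rewrite UE ge0_integral_setU//=; last 5 first.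
    - exact: mle.
    - exact: mpre.
    - by apply: EmwD.
    - by move=> x _; rewrite lee_fin.
    - by apply/disj_setPS => s /= []; rewrite in_itv/= leNgt => /negbTE ->.
    rewrite density_cum_le -/(D a) -/(D b) EFinB => <-.
    by rewrite addeAC subee// add0e.
  have -> : mu `]a, b]%classic = (mu (`]a, b]%classic `\` I) + mu (`]a, b]%classic `&` I))%E.
    exact: measureDI.
  rewrite nuE addeC /mrestr -setDE; congr (_ + _)%E.
  have -> : `]a, b]%classic `&` I = `]Num.max a 0, Num.min b (mass w)]%classic.
    by apply/seteqP; split => x; rewrite /I /= !in_itv/= gt_max le_min;
      [move=> [/andP[-> ->] /andP[-> ->]]|move=> /andP[/andP[-> ->] /andP[-> ->]]].
  by rewrite lebesgue_measure_itv/= lte_fin -EFinB -clamp_diff//; case: ifP.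
have -> : (\int[mu]_(r in `]0%R, mass w]) F r = \int[m]_(r in `]0%R, mass w]) F r)%E.
  by apply: eq_measure_integral => X mX _; exact: mE.
rewrite ge0_integral_measure_add//; last exact: measurable_funTS.
rewrite [X in (_ + X)%E](_ : _ = 0%E); last first.
  rewrite null_set_integral//; first exact: measurable_funTS.
  have : mrestr mu mCI I = 0%E by rewrite /mrestr setICr measure0.
  exact.
rewrite adde0 ge0_integral_pushforward//; last exact: measurable_funTS.
rewrite integral_density; last 3 first.
- exact: mpre.
- by apply: measurable_funTS; apply: measurableT_comp.
- by move=> r /=.
rewrite [RHS]integral_mkcond; apply: ae_eq_integral => //.
- apply: emeasurable_funM; last by apply: EmwD.
  exact: measurableT_comp mF mA.
- apply/(measurable_restrictT _ _).1 => //; first exact: mpre.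
  apply: measurable_funTS; apply: emeasurable_funM; last by apply: EmwD.
  exact: measurableT_comp mF mA.
apply: null_subset cum0_null => s /= /not_implyP[_]; rewrite patchE.
case: ifPn => // /negP AI ne.
have As : A s <= 0.
  by rewrite leNgt; apply/negP => As; apply: AI; rewrite inE/= in_itv/= As (cum_le_mass rw).
split => //; rewrite lt_neqAle w0 andbT; apply/eqP => ws; apply: ne.
by rewrite -ws mule0.
Qed.

End Pushforward.

End Rates.

(** * The Lax formula *)

(** Cutting [[a, b]] into n + 1 equal steps, the errors telescope in [m] and add up to at most
    [C / n.+1]. This replaces an argument by derivatives when only increments are controlled. *)
Lemma quadratic_increments_nd (R : realType) (D m : R -> R) (K a b : R) : a <= b ->
  (forall s t, a <= s -> s <= t -> t <= b -> - (K * (t - s) * (m t - m s)) <= D t - D s) ->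
  D a <= D b.
Proof.
move=> ab H; pose C := K * (b - a) * (m b - m a).
have Hn (n : nat) : - (C / n.+1%:R) <= D b - D a.
  pose d := (b - a) / n.+1%:R; pose x (k : nat) := a + k%:R * d.
  have d0 : 0 <= d by rewrite divr_ge0// subr_ge0.
  have n0 : (n.+1%:R : R) != 0 by rewrite pnatr_eq0.
  have x0 : x 0%N = a by rewrite /x mul0r addr0.
  have xn : x n.+1 = b by rewrite /x /d mulrCA mulfV// mulr1 addrC subrK.
  have xS k : x k.+1 - x k = d by rewrite /x -natr1; ring.
  have xle k : (k <= n.+1)%N -> a <= x k <= b.
    by move=> kn; rewrite lerDl mulr_ge0//= -xn lerD2l ler_wpM2r// ler_nat.
  suff /(_ n.+1 (leqnn _)) : forall k, (k <= n.+1)%N ->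
      - (K * d * (m (x k) - m a)) <= D (x k) - D a.
    rewrite xn; apply: le_trans; rewrite lerN2 /C /d le_eqVlt.
    by apply/orP; left; apply/eqP; field.
  elim=> [_|k IH kn]; first by rewrite x0 !subrr mulr0 oppr0.
  have := IH (ltnW kn); have /andP[ak _] := xle k (ltnW kn); have /andP[_ kb] := xle _ kn.
  have xk : x k <= x k.+1 by rewrite -subr_ge0 xS.
  have -> : D (x k.+1) - D a = (D (x k.+1) - D (x k)) + (D (x k) - D a) by ring.
  have := H _ _ ak xk kb; rewrite xS => h1 h2; apply: le_trans (lerD h1 h2).
  by rewrite -opprD -mulrDr lerN2 subrKA.
rewrite leNgt; apply/negP => D0; rewrite -subr_gt0 in D0.
pose n := Num.truncn (C / (D a - D b)).
have : C / (D a - D b) < n.+1%:R by rewrite truncnS_gt.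
rewrite ltr_pdivrMr// mulrC -ltr_pdivrMr ?ltr0n// => h.
by have := Hn n; rewrite lerNl opprB leNgt h.
Qed.

Lemma quadratic_increments_cst (R : realType) (D m : R -> R) (K a b : R) : a <= b ->
  (forall s t, a <= s -> s <= t -> t <= b -> `|D t - D s| <= K * (t - s) * (m t - m s)) ->
  D a = D b.
Proof.
move=> ab H; apply/eqP; rewrite eq_le; apply/andP; split.
  apply: (quadratic_increments_nd (m := m) (K := K) ab) => s t sa st tb.
  by have := H s t sa st tb; rewrite ler_norml => /andP[].
rewrite -lerN2.
apply: (quadratic_increments_nd (D := fun t => - D t) (m := m) (K := K) ab) => s t sa st tb.
by have := H s t sa st tb; rewrite ler_norml -opprD lerN2 => /andP[].
Qed.

(** The bound [C] on [V] gives integrability by monotone convergence, and the decay of [V] at -oo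
    fixes the constant of integration. *)
Lemma rate_of_primitive (R : realType) (M C : R) (v V : R -> R) :
  measurable_fun setT v -> (forall t, 0 <= v t <= M) ->
  (forall t, 0 <= V t <= C) -> (forall e, 0 < e -> exists B, forall t, t <= B -> V t < e) ->
  (forall s t, s <= t -> \int[lebesgue_measure]_(r in `]s, t]) v r = V t - V s) ->
  rate M v /\ cum_departures v =1 V.
Proof.
move=> mv vM VC V0 VE; set mu := @lebesgue_measure R.
have v0 t : 0 <= v t by have /andP[] := vM t.
have mvD (D : set R) : measurable_fun D (fun x => (v x)%:E).
  by apply/measurable_funTS/measurable_EFinP.
have fin (s t : R) : (\int[mu]_(r in `]s, t]) (v r)%:E)%E \is a fin_num.
  apply: integrable_fin_num => //; apply: measurable_bounded_integrable => //.
  - by rewrite /= lebesgue_measure_itv/=; case: ifP => // _; rewrite -EFinB ltry.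
  - exact: measurable_funTS.
  - exists M; split; first exact: num_real.
    by move=> x Mx r _ /=; rewrite ger0_norm// (le_trans _ (ltW Mx))//; have /andP[] := vM r.
have finE (s t : R) : s <= t -> (\int[mu]_(r in `]s, t]) (v r)%:E = (V t - V s)%:E)%E.
  by move=> st; rewrite -VE// /Rintegral fineK.
have cvF (F : nat -> set R) D : (forall i, measurable (F i)) -> nondecreasing_seq F ->
    \bigcup_n F n = D ->
    (\int[mu]_(x in F i) (v x)%:E)%E @[i --> \oo] --> (\int[mu]_(x in D) (v x)%:E)%E.
  move=> mF ndF <-; apply: ge0_nondecreasing_set_cvg_integral => //.
  - by move=> i; apply: mvD.
  - by move=> i x _; rewrite lee_fin.
have intv : mu.-integrable setT (EFin \o v).
  apply/integrableP; split; first by apply: mvD.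
  under eq_integral do rewrite /= ger0_norm//.
  apply: (@le_lt_trans _ _ C%:E); last exact: ltry.
  pose F (n : nat) : set R := `]- n%:R, n%:R]%classic.
  have UF : \bigcup_n F n = setT.
    apply/seteqP; split => // x _; exists (Num.truncn `|x|).+1 => //=.
    have xn : `|x| < (Num.truncn `|x|).+1%:R by rewrite truncnS_gt.
    by rewrite /F/= in_itv/= (ltW (le_lt_trans (ler_norm _) xn)) andbT ltrNl
      (le_lt_trans _ xn)// -normrN ler_norm.
  have ndF : nondecreasing_seq F.
    apply/nondecreasing_seqP => n; rewrite subsetEset => x; rewrite /F/= !in_itv/=.
    move=> /andP[h1 h2]; rewrite (le_trans h2) ?ler_nat// andbT.
    by rewrite (le_lt_trans _ h1)// lerN2 ler_nat.
  have cv := cvF F setT (fun i => measurable_itv _) ndF UF.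
  rewrite -(cvg_lim _ cv)//; apply: lime_le; first by apply/cvg_ex; eexists; exact: cv.
  near=> n; rewrite finE; last by rewrite (@le_trans _ _ 0)// oppr_le0.
  rewrite lee_fin; have /andP[_ h1] := VC n%:R; have /andP[h2 _] := VC (- n%:R).
  by apply: le_trans h1; rewrite gerBl.
split; first by split.
move=> t; pose F (n : nat) : set R := `]t - n%:R, t]%classic.
have UF : \bigcup_n F n = `]-oo, t]%classic.
  apply/seteqP; split => [x [n _]|x /=]; rewrite /F /= !in_itv/=; first by case/andP.
  move=> xt; exists (Num.truncn (t - x)).+1 => //=; rewrite in_itv/= xt andbT.
  by rewrite ltrBlDr -ltrBlDl truncnS_gt.
have ndF : nondecreasing_seq F.
  apply/nondecreasing_seqP => n; rewrite subsetEset => x; rewrite /F/= !in_itv/=.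
  move=> /andP[h1 ->]; rewrite andbT (le_lt_trans _ h1)// lerD2l lerN2 ler_nat//.
have cv := cvF F _ (fun i => measurable_itv _) ndF UF.
have cv' : (V t - V (t - i%:R)) @[i --> \oo] --> V t.
  rewrite -[X in _ --> X]subr0; apply: cvgB; first exact: cvg_cst.
  apply/cvgrPdist_lt => e e0; have [B HB] := V0 e e0.
  near=> i; rewrite sub0r normrN ger0_norm; last by have /andP[] := VC (t - i%:R).
  apply: HB; rewrite lerBlDr -lerBlDl; near: i; exact: nbhs_infty_ger.
apply: (etrans _ (cvg_lim _ cv')) => //; apply/esym/cvg_lim => //.
rewrite /cum_departures /Rintegral.
have -> : (fun i : nat => V t - V (t - i%:R)) = (fun i : nat => fine (\int[mu]_(r in F i) (v r)%:E)%E).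
  by apply/funext => i; rewrite finE// lerBlDr lerDl.
apply: fine_cvg; rewrite fineK; first exact: cv.
by apply: integrable_fin_num => //; exact: integrableS intv.
Unshelve. all: by end_near. Qed.

(** * Minimizers in the Lax formula and the flux as derivative of the potential *)

Section LegendrePair.
Context (R : realType) (p0 M kappa : R) (gam h : R -> R).
Hypothesis lp : legendre_pair p0 M kappa gam h.

Lemma lp_gam_ge0 p : 0 <= gam p. Proof. by have /andP[] := lp_gam_bnd lp p. Qed.

Lemma lp_h_ge0 p : 0 <= h p.
Proof. by have := lp_subgrad lp p0 p; rewrite (lp_h0 lp (lexx _)) (lp_gam0 lp (lexx _)) mul0r addr0. Qed.

Lemma lp_h_lip p q : `|h q - h p| <= M * `|q - p|.
Proof.
have H a b : h b - h a <= M * `|b - a|.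
  have := lp_subgrad lp b a; have /andP[g0 /ltW gM] := lp_gam_bnd lp b.
  rewrite -lerBrDl -lerN2 opprB -mulrN opprB => /le_trans; apply.
  apply: le_trans (ler_wpM2l g0 (ler_norm _)) _.
  exact: ler_wpM2r.
by rewrite ler_norml H andbT lerNl opprB distrC H.
Qed.

Lemma lp_M_ge0 : 0 <= M.
Proof. by have /andP[g0 /ltW gM] := lp_gam_bnd lp 0; exact: le_trans gM. Qed.

Lemma lp_h_continuous : continuous h.
Proof.
move=> x; apply/cvgrPdist_le => e e0; have M1 : 0 < M + 1 by rewrite ltr_wpDl// lp_M_ge0.
near=> y.
have xy : `|x - y| <= e / (M + 1) by near: y; apply: cvgr_dist_le; rewrite ?divr_gt0.
apply: le_trans (lp_h_lip _ _) _; apply: (@le_trans _ _ ((M + 1) * `|x - y|)).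
  by rewrite ler_wpM2r// lerDl.
by rewrite mulrC -ler_pdivlMr.
Unshelve. all: by end_near. Qed.

Lemma lp_strict p q : p0 <= p -> p0 <= q -> p != q -> h p + gam p * (q - p) < h q.
Proof.
move=> pp pq; rewrite neq_lt => /orP[lt|lt].
- pose m := (p + q) / 2; have [m1 m2] : p < m /\ m < q by rewrite /m; lra.
  have h1 := lp_subgrad lp p m; have h2 := lp_subgrad lp m q.
  have g1 := lp_gam_incr lp pp m1.
  have : gam p * (q - m) < gam m * (q - m) by rewrite ltr_pM2r// subr_gt0.
  lra.
- pose m := (p + q) / 2; have [m1 m2] : q < m /\ m < p by rewrite /m; lra.
  have h1 := lp_subgrad lp p m; have h2 := lp_subgrad lp m q.
  have g1 : gam m < gam p by apply: lp_gam_incr lp _ _ _ m2; lra.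
  have : gam m * (m - q) < gam p * (m - q) by rewrite ltr_pM2r// subr_gt0.
  lra.
Qed.

(** The supporting line at [p0 + 1], where [gam] is already positive and [h] is nonnegative. *)
Lemma lp_coercive : exists2 c, 0 < c & forall p, c * (p - (p0 + 1)) <= h p.
Proof.
have lt : p0 < p0 + 1 by lra.
exists (gam (p0 + 1)).
  by rewrite -(lp_gam0 lp (lexx p0)); exact: lp_gam_incr lp _ _ (lexx _) lt.
move=> p; apply: le_trans (lp_subgrad lp (p0 + 1) p).
by rewrite lerDr lp_h_ge0.
Qed.

(** Strict convexity: of two pairs of slopes with equal sums, the more spread one has the larger
    cost. This is the exchange inequality for crossing segments. *)
Lemma lp_cross a b c d : p0 <= a -> a < b -> a < c -> b < d -> c < d -> a + d = b + c ->
  h b + h c < h a + h d.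
Proof.
move=> pa; wlog bc : b c / b <= c.
  move=> W ab ac bd cd E; have [/W|/ltW cb] := leP b c; first exact.
  by rewrite [ltLHS]addrC; apply: W => //; rewrite E addrC.
move=> ab ac bd cd E.
have h1 : h c + gam c * (d - c) < h d by apply: lp_strict; [lra|lra|rewrite lt_eqF].
have h2 := lp_subgrad lp b a.
have : gam b * (b - a) <= gam c * (b - a).
  by apply: ler_wpM2r; [rewrite subr_ge0 ltW|exact: lp_gam_nd lp _ _ bc].
have e : d - c = b - a by lra.
rewrite e in h1; have e' : gam b * (a - b) = - (gam b * (b - a)) by ring.
rewrite e' in h2; lra.
Qed.

Section LaxFormula.
Variables (W : R -> R) (G : R).
Hypotheses (W_cont : continuous W) (W_nd : forall s t, s <= t -> W s <= W t)
  (W_ge0 : forall t, 0 <= W t) (W_le : forall t, W t <= G).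

Definition arrival_cost (y t tau : R) := y * h ((t - tau) / y) + W tau.

(** [h] stays finite below [p0], where the Legendre transform is infinite; the first conjunct
    restores the resulting constraint on the minimizer. *)
Definition optimal_departure (y t tau : R) := tau <= t - y * p0 /\
  forall tau', arrival_cost y t tau <= arrival_cost y t tau'.

Lemma slope_ge (y t tau : R) : 0 < y -> (p0 <= (t - tau) / y) = (tau <= t - y * p0).
Proof. by move=> y0; rewrite ler_pdivlMr// mulrC; apply/idP/idP => H; lra. Qed.

Lemma arrival_cost_late (y t tau : R) : 0 < y -> t - y * p0 <= tau -> arrival_cost y t tau = W tau.
Proof.
move=> y0 H; rewrite /arrival_cost (lp_h0 lp) ?mulr0 ?add0r//.
by rewrite ler_pdivrMr// mulrC; lra.
Qed.

(** Departures too late for free flow cost [W tau] under [h], so allowing them in the minimization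
    does not lower the minimum. *)
Lemma arrival_cost_slow (y t tau : R) : 0 < y -> t - y * p0 <= tau ->
  arrival_cost y t (t - y * p0) <= arrival_cost y t tau.
Proof. by move=> y0 H; rewrite !arrival_cost_late// W_nd. Qed.

Lemma arrival_cost_continuous y t : continuous (arrival_cost y t).
Proof.
move=> tau; apply: cvgD; last exact: W_cont.
apply: cvgM; first exact: cvg_cst.
apply: (@continuous_comp _ _ _ (fun tau => (t - tau) / y) h); last exact: lp_h_continuous.
apply: cvgM; last exact: cvg_cst.
by apply: cvgB; [exact: cvg_cst|exact: cvg_id].
Qed.

Lemma optimal_departure_ex y t : 0 < y -> exists tau, optimal_departure y t tau.
Proof.
move=> y0; have [c c0 hc] := lp_coercive.
have G0 : 0 <= G := le_trans (W_ge0 0) (W_le 0).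
(* To the left of [a] the coercive bound alone exceeds [G], hence the cost of departing at [b]. *)
pose b := t - y * p0; pose a := t - y * (p0 + 1) - G / c.
have ab : a <= b by rewrite /a /b; have := divr_ge0 G0 (ltW c0); lra.
have cont : {within `[a, b], continuous (arrival_cost y t)}.
  exact/continuous_subspaceT/arrival_cost_continuous.
have [tau tauI tauP] := EVT_min ab cont.
have bI : b \in `[a, b] by rewrite in_itv/= lexx andbT.
exists tau; split; first by move: tauI; rewrite in_itv/= => /andP[].
move=> tau'; have [ta|ta] := leP a tau'; last first.
  apply: le_trans (tauP _ bI) _; rewrite arrival_cost_late//.
  apply: le_trans (W_le _) _; rewrite /arrival_cost.
  have h1 : G <= y * h ((t - tau') / y).
    apply: le_trans (ler_wpM2l (ltW y0) (hc _)).
    have -> : y * (c * ((t - tau') / y - (p0 + 1))) = c * (t - tau' - y * (p0 + 1)).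
      by field; rewrite gt_eqF.
    by rewrite mulrC -ler_pdivrMr//; move: ta; rewrite /a; lra.
  by have := W_ge0 tau'; lra.
have [tb|tb] := leP tau' b; first by apply: tauP; rewrite in_itv/= ta tb.
exact: le_trans (tauP _ bI) (arrival_cost_slow y0 (ltW tb)).
Qed.

(** A rival minimizer at an intermediate point, continued by the rest of the segment, gives a broken
    line to (T, X) with slopes [p'] and [p]. The straight line with their mean slope [q] is strictly
    cheaper, and [tau] is no dearer than that. *)
Lemma optimal_departure_unique (y X T tau t : R) : 0 < y -> y < X -> optimal_departure X T tau ->
  t = tau + y / X * (T - tau) ->
  optimal_departure y t tau /\ forall tau', optimal_departure y t tau' -> tau' = tau.
Proof.
move=> y0 yX [tauT tauP] tE; have X0 : 0 < X := lt_trans y0 yX.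
have [Xn0 yn0 Xyn0] : [/\ X != 0, y != 0 & X - y != 0] by rewrite !gt_eqF// subr_gt0.
pose p := (T - tau) / X.
have pp : p0 <= p by rewrite slope_ge.
have pE : (t - tau) / y = p by rewrite tE /p; field; rewrite ?Xn0 ?yn0.
have tle : tau <= t - y * p0 by rewrite -slope_ge// pE.
have strict tau' : tau' != tau -> tau' <= t - y * p0 -> arrival_cost y t tau < arrival_cost y t tau'.
  move=> ne le'; pose p' := (t - tau') / y; pose q := (T - tau') / X.
  have pp' : p0 <= p' by rewrite slope_ge.
  have TE : T = t + (X - y) * p by rewrite tE /p; field.
  have qE : X * q = y * p' + (X - y) * p.
    by rewrite /q /p' mulrC divfK// mulrCA divff// mulr1 TE; ring.
  have p'p : p' != p.
    apply: contra_neq ne => p'p; have : t - tau' = y * p' by rewrite mulrC divfK.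
    rewrite p'p -pE mulrCA divff// mulr1; lra.
  have qp0 : p0 <= q.
    rewrite -(ler_pM2l X0) qE; have -> : X * p0 = y * p0 + (X - y) * p0 by ring.
    by apply: lerD; rewrite ler_pM2l// subr_gt0.
  have qp' : q != p'.
    apply: contra_neq p'p => qp'; move: qE; rewrite qp' => qE.
    have : (X - y) * (p' - p) = 0 by rewrite mulrBr -[X in _ - X](addKr (y * p')) -qE; ring.
    by move/eqP; rewrite mulf_eq0 (negbTE Xyn0)/= subr_eq0 => /eqP.
  have h1 := lp_strict qp0 pp' qp'; have h2 := lp_subgrad lp q p.
  have k1 : y * (h q + gam q * (p' - q)) < y * h p' by rewrite ltr_pM2l.
  have k2 : (X - y) * (h q + gam q * (p - q)) <= (X - y) * h p by rewrite ler_pM2l// subr_gt0.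
  have kk : y * (h q + gam q * (p' - q)) + (X - y) * (h q + gam q * (p - q)) = X * h q.
    transitivity (X * h q + gam q * (y * p' + (X - y) * p - X * q)); first by ring.
    by rewrite qE subrr mulr0 addr0.
  have := tauP tau'; rewrite /arrival_cost -/p -/q -/p' pE; lra.
have opt : optimal_departure y t tau.
  split => // tau'; have [le'|lt'] := leP tau' (t - y * p0).
    by have [->//|ne] := eqVneq tau' tau; exact/ltW/strict.
  apply: le_trans (arrival_cost_slow y0 (ltW lt')).
  have [->//|ne] := eqVneq (t - y * p0) tau; exact/ltW/strict.
split => // tau' [le' tauP']; apply/eqP/negPn/negP => ne.
by have := strict _ ne le'; rewrite ltNge tauP'.
Qed.

(** If two minimizing segments crossed, exchanging their departure times would lower the total cost
    by [lp_cross]. *)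
Lemma optimal_departure_nd (y t t' tau tau' : R) : 0 < y -> t < t' ->
  optimal_departure y t tau -> optimal_departure y t' tau' -> tau <= tau'.
Proof.
move=> y0 tt [le1 P1] [le2 P2]; rewrite leNgt; apply/negP => lt.
have h1 := P1 tau'; have h2 := P2 tau.
have yi : 0 < y^-1 by rewrite invr_gt0.
have : h ((t - tau') / y) + h ((t' - tau) / y) < h ((t - tau) / y) + h ((t' - tau') / y).
  apply: lp_cross.
  - by rewrite slope_ge.
  - by rewrite ltr_pM2r//; lra.
  - by rewrite ltr_pM2r//; lra.
  - by rewrite ltr_pM2r//; lra.
  - by rewrite ltr_pM2r//; lra.
  - by field; rewrite gt_eqF.
rewrite -(ltr_pM2l y0) !mulrDr; move: h1 h2; rewrite /arrival_cost; lra.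
Qed.

(** Each minimizer is used as a test departure for the other arrival time. *)
Lemma arrival_cost_incr (y t t' tau tau' : R) : 0 < y ->
  optimal_departure y t tau -> optimal_departure y t' tau' ->
  gam ((t - tau') / y) * (t' - t) <= arrival_cost y t' tau' - arrival_cost y t tau
    <= gam ((t' - tau) / y) * (t' - t).
Proof.
move=> y0 [_ P] [_ P'].
have K s s' r : y * h ((s - r) / y) + gam ((s - r) / y) * (s' - s) <= y * h ((s' - r) / y).
  have := lp_subgrad lp ((s - r) / y) ((s' - r) / y); rewrite -(ler_pM2l y0) mulrDr.
  congr (_ + _ <= _); rewrite mulrCA; congr (_ * _); field; by rewrite gt_eqF.
apply/andP; split.
  have := K t t' tau'; have := P tau'; rewrite /arrival_cost; lra.
have := K t' t tau; have := P' tau; rewrite /arrival_cost.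
have -> : gam ((t' - tau) / y) * (t - t') = - (gam ((t' - tau) / y) * (t' - t)) by ring.
lra.
Qed.

End LaxFormula.

Section LaxFlux.
Variables (W : R -> R) (G y : R).
Hypotheses (W_ge0 : forall t, 0 <= W t) (W_le : forall t, W t <= G).
Hypothesis (W_ninf : forall e, 0 < e -> exists B, forall t, t <= B -> W t < e).
Hypothesis y_gt0 : 0 < y.
Variable tau : R -> R.
Hypothesis tau_opt : forall t, optimal_departure W y t (tau t).

Let u t := gam ((t - tau t) / y).
Let U t := arrival_cost W y t (tau t).

Lemma lax_tau_nd s t : s <= t -> tau s <= tau t.
Proof.
rewrite le_eqVlt => /predU1P[->//|st].
exact: (optimal_departure_nd y_gt0 st (tau_opt s) (tau_opt t)).
Qed.

Lemma lax_flux_measurable : measurable_fun setT u.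
Proof.
apply: (measurableT_comp (f := gam)).
  by apply: nondecreasing_measurable => // p q; exact: lp_gam_nd lp p q.
apply: measurable_funM; last exact: measurable_cst.
apply: measurable_funB; first exact: measurable_id.
by apply: nondecreasing_measurable => // s t; exact: lax_tau_nd.
Qed.

Let u_bnd t : 0 <= u t <= M.
Proof. by have /andP[-> /ltW] := lp_gam_bnd lp ((t - tau t) / y). Qed.

Lemma lax_potential_ge0 t : 0 <= U t.
Proof. by rewrite /U /arrival_cost addr_ge0// mulr_ge0 ?(ltW y_gt0)// lp_h_ge0. Qed.

Lemma lax_potential_late t : U t <= W (t - y * p0).
Proof.
have [_ /(_ (t - y * p0))] := tau_opt t.
by rewrite [leRHS]arrival_cost_late.
Qed.

Lemma lax_flux_itv_integrable s t : lebesgue_measure.-integrable `]s, t] (EFin \o u).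
Proof.
apply: measurable_bounded_integrable => //.
- by rewrite /= lebesgue_measure_itv/=; case: ifP => // _; rewrite -EFinB ltry.
- exact: measurable_funTS lax_flux_measurable.
- exists M; split; first exact: num_real.
  move=> x Mx r _ /=; have /andP[u0 uM] := u_bnd r.
  by rewrite ger0_norm// (le_trans _ (ltW Mx)).
Qed.

Lemma lax_flux_itv_bounds (a b : R) : a <= b ->
  gam ((a - tau b) / y) * (b - a) <= \int[lebesgue_measure]_(z in `]a, b]) u z
    <= gam ((b - tau a) / y) * (b - a).
Proof.
move=> ab.
have mono z : a <= z -> z <= b -> gam ((a - tau b) / y) <= u z <= gam ((b - tau a) / y).
  move=> az zb; have := lax_tau_nd az; have := lax_tau_nd zb => h1 h2.
  by apply/andP; split; apply: (lp_gam_nd lp); rewrite ler_pM2r ?invr_gt0//; lra.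
have len : fine (lebesgue_measure `]a, b]%classic) = b - a.
  rewrite lebesgue_measure_itv/= lte_fin; case: ltP => //= ba.
  by apply/esym/eqP; rewrite subr_eq0 eq_le ab ba.
have ci c : lebesgue_measure.-integrable `]a, b] (EFin \o cst c).
  apply: measurable_bounded_integrable => //; last exact: bounded_cst.
  by rewrite /= lebesgue_measure_itv/=; case: ifP => // _; rewrite -EFinB ltry.
apply/andP; split; rewrite -len -Rintegral_cst//; apply: le_Rintegral => //.
- exact: ci.
- exact: lax_flux_itv_integrable.
- by move=> z /=; rewrite in_itv/= => /andP[/ltW az zb]; have /andP[] := mono _ az zb.
- exact: lax_flux_itv_integrable.
- exact: ci.
- by move=> z /=; rewrite in_itv/= => /andP[/ltW az zb]; have /andP[] := mono _ az zb.
Qed.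

(** The increment of the potential and the integral of the flux lie between the same two bounds,
    whose gap is quadratic because [gam] is Lipschitz. *)
Lemma lax_flux_quadratic (a b : R) : a <= b ->
  `|(U b - U a) - \int[lebesgue_measure]_(z in `]a, b]) u z|
    <= kappa / y * (b - a) * (b + tau b - (a + tau a)).
Proof.
move=> ab; have := arrival_cost_incr y_gt0 (tau_opt a) (tau_opt b).
have := lax_flux_itv_bounds ab; rewrite -/(U a) -/(U b).
move: (\int[_]_(_ in _) _) (U a) (U b) => J Ua Ub /andP[h3 h4] /andP[h1 h2].
have abtau : (a - tau b) / y <= (b - tau a) / y.
  by rewrite ler_pM2r ?invr_gt0//; have := lax_tau_nd ab; lra.
have g12 := lp_gam_lip lp abtau.
have : (gam ((b - tau a) / y) - gam ((a - tau b) / y)) * (b - a)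
    <= kappa / y * (b - a) * (b + tau b - (a + tau a)).
  rewrite [leRHS](_ : _ = (kappa * ((b - tau a) / y - (a - tau b) / y)) * (b - a)).
    by apply: ler_wpM2r; rewrite ?subr_ge0.
  by field; rewrite gt_eqF.
by apply: le_trans; rewrite ler_norml mulrBl; apply/andP; split; lra.
Qed.

Lemma lax_flux_primitive s t : s <= t ->
  \int[lebesgue_measure]_(r in `]s, t]) u r = U t - U s.
Proof.
move=> st; pose I r := \int[lebesgue_measure]_(z in `]s, r]) u z.
have IB a b : s <= a -> a <= b -> I b - I a = \int[lebesgue_measure]_(z in `]a, b]) u z.
  by move=> sa ab; rewrite /I Rintegral_itvB//; exact: lax_flux_itv_integrable.
pose D r := U r - I r.
suff : D s = D t.
  rewrite /D {1}/I set_itv_ge ?bnd_simp ?ltxx// Rintegral_set0 subr0 => ->.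
  by rewrite opprB addrCA subrr addr0.
have K0 : 0 <= kappa / y by rewrite ltW// divr_gt0// (lp_kappa lp).
(* The error is measured by the monotone function [r + tau r], so jumps of the minimizer do no
   harm. *)
apply: (@quadratic_increments_cst _ D (fun r => r + tau r) (kappa / y)) => // a b sa ab bt.
have -> : D b - D a = (U b - U a) - \int[lebesgue_measure]_(z in `]a, b]) u z.
  by rewrite -IB// /D; ring.
exact: lax_flux_quadratic.
Qed.

Lemma lax_flux_rate : rate M u /\ cum_departures u =1 U.
Proof.
apply: (@rate_of_primitive _ M G) => //.
- exact: lax_flux_measurable.
- move=> t; rewrite lax_potential_ge0/= (le_trans (lax_potential_late t))//.
- move=> e e0; have [B HB] := W_ninf e0; exists (B + y * p0) => t tB.
  by apply: le_lt_trans (lax_potential_late t) _; apply: HB; lra.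
- exact: lax_flux_primitive.
Qed.

End LaxFlux.
End LegendrePair.

(** * Arrival rates of the groups *)

Lemma measurable_invr (R : realType) : measurable_fun setT (fun x : R => x^-1).
Proof.
have H (D : set R) : is_interval D -> (forall x y, D x -> D y -> x <= y -> y^-1 <= x^-1) ->
    measurable_fun D (fun x : R => x^-1).
  move=> iD dec; rewrite (_ : (fun x : R => x^-1) = (fun x => - (- x^-1))).
    apply: measurableT_comp => //; apply: itv_nondecreasing_measurable => // x y Dx Dy xy.
    by rewrite lerN2; exact: dec.
  by apply/funext => x; rewrite opprK.
have -> : setT = `]-oo, 0%R[ `|` ([set 0%R] `|` `]0%R, +oo[) :> set R.
  apply/seteqP; split => // x _ /=; rewrite !in_itv/= andbT.
  by have [x0|x0|x0] := ltgtP x 0; [left|right; right|right; left].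
apply/measurable_funU => //; first exact: measurableU.
split; last (apply/measurable_funU => //; split; last first).
- apply: H; first exact: interval_is_interval.
  move=> x y /=; rewrite !in_itv/= => x0 y0 xy.
  by rewrite -[leLHS]opprK -[leRHS]opprK lerN2 -!invrN lef_pV2 ?lerN2// posrE oppr_gt0.
- apply: H; first exact: interval_is_interval.
  move=> x y /=; rewrite !in_itv/= !andbT => x0 y0 xy.
  by rewrite lef_pV2 ?posrE.
- exact: measurable_fun_set1.
Qed.

Section RankIntegrals.
Context (R : realType).
Notation mu := (@lebesgue_measure R).
Implicit Types (w F : R -> R) (M : R).

Definition rank_integral F (r : R) := \int[mu]_(s in `]0, r]) F s.

Lemma eq_cum_ae (w1 w2 : R -> R) t : measurable_fun setT w1 -> measurable_fun setT w2 ->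
  mu.-negligible [set s | w1 s != w2 s] -> cum_departures w1 t = cum_departures w2 t.
Proof.
move=> m1 m2 ne; congr fine; apply: ae_eq_integral => //.
- by apply/measurable_funTS/measurable_EFinP.
- by apply/measurable_funTS/measurable_EFinP.
by apply: null_subset ne => s /= /not_implyP[_] E; apply/eqP => w12; apply: E; rewrite w12.
Qed.

Lemma eq_mass_ae (w1 w2 : R -> R) : measurable_fun setT w1 -> measurable_fun setT w2 ->
  mu.-negligible [set s | w1 s != w2 s] -> mass w1 = mass w2.
Proof.
move=> m1 m2 ne; congr fine; apply: ae_eq_integral => //.
- by apply/measurable_EFinP.
- by apply/measurable_EFinP.
by apply: null_subset ne => s /= /not_implyP[_] E; apply/eqP => w12; apply: E; rewrite w12.
Qed.

Lemma rate_comp M w F : rate M w -> measurable_fun setT F -> (forall r, 0 <= F r <= 1) ->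
  rate M (fun s => F (cum_departures w s) * w s).
Proof.
move=> rw mF F01; case: (rw) => mw wM iw.
have mFA : measurable_fun setT (fun s => F (cum_departures w s) * w s).
  by apply: measurable_funM => //; apply: measurableT_comp => //; exact: cum_measurable rw.
have bnd s : 0 <= F (cum_departures w s) * w s <= w s.
  have /andP[F0 F1] := F01 (cum_departures w s); have /andP[w0 _] := wM s.
  by rewrite mulr_ge0//= ler_piMl.
split => //.
  by move=> t; have /andP[-> /le_trans] := bnd t; apply; have /andP[] := wM t.
apply: le_integrable iw => //; first exact/measurable_EFinP.
move=> s _ /=; rewrite lee_fin; have /andP[h1 h2] := bnd s.
by rewrite !ger0_norm//; exact: le_trans h2.
Qed.

Lemma mass_comp M w F : rate M w -> measurable_fun setT F -> (forall r, 0 <= F r) ->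
  mass (fun s => F (cum_departures w s) * w s) = rank_integral F (mass w).
Proof.
move=> rw mF F0; rewrite /mass /rank_integral /Rintegral.
rewrite -(change_of_rank rw (F := EFin \o F)).
- by congr fine; apply: eq_integral => s _; rewrite EFinM.
- exact/measurable_EFinP.
- by move=> r; rewrite lee_fin.
Qed.

(** Stopping at time [S] and stopping at rank [A S] differ only on a flat stretch of [A], where
    nobody travels; [F'] is [F] stopped at that rank. *)
Lemma cum_comp M w F S : rate M w -> measurable_fun setT F -> (forall r, 0 <= F r) ->
  cum_departures (fun s => F (cum_departures w s) * w s) S = rank_integral F (cum_departures w S).
Proof.
move=> rw mF F0; case: (rw) => mw wM iw; set A := cum_departures w.
pose F' r := F r * \1_(`]-oo, A S]) r.
have mF' : measurable_fun setT F' by apply: measurable_funM.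
have mA := cum_measurable rw.
transitivity (mass (fun s => F' (A s) * w s)).
  rewrite /mass /cum_departures Rintegral_mkcond; apply: eq_mass_ae.
  - apply/(measurable_restrictT _ _).1 => //; apply: measurable_funTS.
    by apply: measurable_funM => //; apply: measurableT_comp.
  - by apply: measurable_funM => //; apply: measurableT_comp.
  apply: null_subset (cum_flat_null rw S) => s /=.
  rewrite patchE /F' indicE !mem_setE !in_itv/=.
  have [sS|Ss] := leP s S; first by rewrite (cum_nd rw sS) mulr1 eqxx.
  have [AS|AS] := leP (A s) (A S); last by rewrite mulr0 mul0r eqxx.
  rewrite mulr1 => ne; split => //; split => //; rewrite lt_neqAle; have /andP[-> _] := wM s.
  by rewrite andbT; apply: contra_neq ne => <-; rewrite mulr0.
rewrite (mass_comp rw)//; last by move=> r; rewrite mulr_ge0// indicE.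
rewrite /rank_integral Rintegral_mkcond [RHS]Rintegral_mkcond.
congr (Rintegral _ _ _); apply/funext => r; rewrite !patchE /F' indicE !mem_setE !in_itv/=.
have := cum_le_mass rw S; rewrite -/A => AM.
have [r0|r0] := ltP 0 r => //=.
have [rS|rS] := leP r (A S) => /=; last by rewrite mulr0; case: ifP.
by rewrite (le_trans rS AM) mulr1.
Qed.

Section Groups.
Variables (n : nat) (M : R) (a : 'I_n.+1 -> R -> R).
Hypothesis ma : forall i, measurable_fun setT (a i).
Hypothesis a0 : forall i t, 0 <= a i t.
Hypothesis ra : rate M (total_rate a).

Let w := total_rate a.

(** The function Theta_i of the statement, on ranks: group shares become independent of position on
    the road. *)
Definition rank_fraction i (r : R) := dep_fraction a i (dep_time a r).

Lemma group_le_total i t : a i t <= w t.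
Proof. by rewrite /w /total_rate (bigD1 i)//= lerDl sumr_ge0. Qed.

Lemma dep_fraction01 i t : 0 <= dep_fraction a i t <= 1.
Proof.
have /andP[w0 _] : 0 <= total_rate a t <= M by case: ra => _ /(_ t).
rewrite /dep_fraction; case: eqVneq => [_|wn0].
  by rewrite invr_ge0 ler0n/= invf_le1 ?ler1n// ltr0n.
have w1 : 0 < total_rate a t by rewrite lt_neqAle eq_sym wn0.
by rewrite divr_ge0//= ler_pdivrMr// mul1r group_le_total.
Qed.

Lemma dep_fraction_sum t : \sum_i dep_fraction a i t = 1.
Proof.
rewrite /dep_fraction; case: eqVneq => [_|wn0].
  by rewrite sumr_const card_ord -(mulr_natr n.+1%:R^-1) mulVf// pnatr_eq0.
by rewrite -mulr_suml divff.
Qed.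

Lemma dep_fraction_measurable i : measurable_fun setT (dep_fraction a i).
Proof.
have mw : measurable_fun setT (total_rate a) by case: ra.
rewrite /dep_fraction; apply: measurable_fun_ifT.
- by apply: measurable_fun_eqr.
- exact: measurable_cst.
- by apply: measurable_funM => //; apply: measurableT_comp => //; exact: measurable_invr.
Qed.

Lemma rank_fraction01 i r : 0 <= rank_fraction i r <= 1.
Proof. exact: dep_fraction01. Qed.

Lemma rank_fraction_sum r : \sum_i rank_fraction i r = 1.
Proof. exact: dep_fraction_sum. Qed.

Lemma rank_fraction_measurable i : measurable_fun setT (rank_fraction i).
Proof.
apply: measurableT_comp; first exact: dep_fraction_measurable.
exact: quantile_measurable ra.
Qed.

Lemma group_rate i : rate M (a i).
Proof.
case: ra => mw wM iw; split => //.
  by move=> t; rewrite a0/= (le_trans (group_le_total i t))//; have /andP[] := wM t.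
apply: le_integrable iw => //; first by apply/measurable_EFinP; exact: ma.
by move=> s _ /=; rewrite lee_fin !ger0_norm ?group_le_total//; have /andP[] := wM s.
Qed.

(** At almost every departing time the quantile inverts the cumulative function, so the share at
    rank [W t] is the share at time [t]. *)
Lemma group_rank_fraction i :
  mu.-negligible [set t | a i t != rank_fraction i (cum_departures w t) * w t].
Proof.
apply: null_subset (quantile_cum ra) => t /= ne.
have /andP[w0 _] : 0 <= total_rate a t <= M by case: ra => _ /(_ t).
have ai : a i t = dep_fraction a i t * w t.
  rewrite /dep_fraction; case: eqVneq => [w00|wn0]; last by rewrite divfK.
  by apply/eqP; rewrite /w w00 mulr0 eq_le a0 andbT -w00 group_le_total.
split.
  rewrite lt_neqAle w0 andbT; apply: contra_neq ne => w00.
  by rewrite ai /w -w00 !mulr0.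
by apply: contra_neq ne => q; rewrite ai /rank_fraction /dep_time -/(quantile w _) q.
Qed.

Let m_rank i : measurable_fun setT (fun t => rank_fraction i (cum_departures w t) * w t).
Proof. by have [] := rate_comp ra (rank_fraction_measurable i) (rank_fraction01 i). Qed.

Let rf0 i r : 0 <= rank_fraction i r. Proof. by have /andP[] := rank_fraction01 i r. Qed.

Lemma cum_group i t :
  cum_departures (a i) t = rank_integral (rank_fraction i) (cum_departures w t).
Proof.
rewrite -(cum_comp _ ra (rank_fraction_measurable i) (rf0 i)).
by apply: eq_cum_ae => //; exact: group_rank_fraction.
Qed.

Lemma mass_group i : mass (a i) = rank_integral (rank_fraction i) (mass w).
Proof.
rewrite -(mass_comp ra (rank_fraction_measurable i) (rf0 i)).
by apply: eq_mass_ae => //; exact: group_rank_fraction.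
Qed.

End Groups.

End RankIntegrals.

(** * Arrival rates at the end of the road *)

Section Arrivals.
Context (R : realType) (f : R -> R) (rhojam L kappa : R).
Notation mu := (@lebesgue_measure R).
Notation p0 := (dflux_inv f rhojam 0).
Notation M := (max_flux f rhojam).
Notation gam := (segment_value f rhojam).
Notation h := (flux_conj f rhojam).
Hypothesis lp : legendre_pair p0 M kappa gam h.
Hypothesis legE : forall p, legendre f rhojam p = if p0 <= p then (h p)%:E else +oo%E.

Section OneRate.
Variable w : R -> R.
Hypothesis rw : rate M w.
Notation W := (cum_departures w).

Lemma lax_costE (t x tau : R) : 0 < x -> lax_cost f rhojam w t x tau =
  if tau <= t - x * p0 then (arrival_cost h W x t tau)%:E else +oo%E.
Proof.
move=> x0; rewrite /lax_cost legE (slope_ge _ _ _ x0).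
by case: ifP => _; rewrite -?EFinM -?EFinD// gt0_muley ?addye.
Qed.

Let late (t x tau : R) : 0 < x -> t - x * p0 < tau ->
  arrival_cost h W x t (t - x * p0) <= arrival_cost h W x t tau.
Proof. by move=> x0 /ltW; apply: (arrival_cost_slow lp (cum_nd rw)). Qed.

(** The extended-valued Lax cost is infinite exactly where the departure is too late for free
    flow. *)
Lemma lax_minimizerP (t x tau : R) : 0 < x ->
  lax_minimizer f rhojam w t x tau <-> optimal_departure p0 h W x t tau.
Proof.
move=> x0; split=> [H|[le H] tau'].
  have le : tau <= t - x * p0.
    by have := H (t - x * p0); rewrite !lax_costE// lexx; case: ifP.
  split => // tau'; have [le'|lt'] := leP tau' (t - x * p0).
    by have := H tau'; rewrite !lax_costE// le le' lee_fin.
  apply: le_trans (late x0 lt').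
  by have := H (t - x * p0); rewrite !lax_costE// lexx le lee_fin.
by rewrite !lax_costE// le; case: ifP => _; rewrite ?leey// lee_fin.
Qed.

Lemma lax_tauP (t x : R) : 0 < x -> optimal_departure p0 h W x t (lax_tau f rhojam w t x).
Proof.
move=> x0; apply/lax_minimizerP => //.
have [tau /lax_minimizerP] := optimal_departure_ex lp (cum_continuous rw) (cum_nd rw)
  (cum_ge0 rw) (cum_le_mass rw) t x0.
by move=> /(_ x0) H; apply: (xgetPex 0); exists tau.
Qed.

Lemma lax_potentialE (t x : R) : 0 < x ->
  lax_potential f rhojam w t x = arrival_cost h W x t (lax_tau f rhojam w t x).
Proof.
move=> x0; have opt := lax_tauP t x0; have /(lax_minimizerP _ _ x0) lm := opt.
rewrite /lax_potential gt_eqF//.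
have -> : ereal_inf (range (lax_cost f rhojam w t x)) =
    lax_cost f rhojam w t x (lax_tau f rhojam w t x).
  apply/eqP; rewrite eq_le; apply/andP; split; first by apply: ereal_inf_lbound; eexists.
  by apply: le_ereal_inf_tmp => _ [tau' _ <-]; exact: lm.
by rewrite lax_costE// (proj1 opt).
Qed.

Lemma lax_solutionE (t x : R) : 0 < x ->
  lax_solution f rhojam w t x = gam ((t - lax_tau f rhojam w t x) / x).
Proof.
move=> x0; have [le _] := lax_tauP t x0.
by rewrite /lax_solution gt_eqF// /segment_value slope_ge// le.
Qed.

Hypothesis L_gt0 : 0 < L.
Notation u := (fun t => lax_solution f rhojam w t L).

Let W_ninf e : 0 < e -> exists B, forall t, t <= B -> W t < e.
Proof. by move=> /(cum_tails rw)[B _ HB]; exists (- B) => t tB; have [+ _] := HB t; exact. Qed.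

Lemma arrival_rate : rate M u /\ cum_departures u =1 (fun t => lax_potential f rhojam w t L).
Proof.
have uE : u = (fun t => gam ((t - lax_tau f rhojam w t L) / L)).
  by apply/funext => t; rewrite lax_solutionE.
have := lax_flux_rate lp (cum_ge0 rw) (cum_le_mass rw) W_ninf L_gt0
  (fun t => lax_tauP t L_gt0).
by rewrite -uE => -[ru cu]; split => // t; rewrite cu lax_potentialE.
Qed.

Lemma cum_arrival_le (s t : R) :
  cum_departures u s <= L * h ((s - t) / L) + W t.
Proof.
have [_ ->] := arrival_rate; rewrite lax_potentialE//.
by have [_] := lax_tauP s L_gt0; apply.
Qed.

Lemma cum_arrival_late (s : R) : cum_departures u s <= W (s - L * p0).
Proof.
apply: le_trans (cum_arrival_le s (s - L * p0)) _.
have -> : (s - (s - L * p0)) / L = p0 by field; rewrite gt_eqF.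
by rewrite (lp_h0 lp)// mulr0 add0r.
Qed.

Lemma cum_arrivalE (s : R) : exists tau,
  cum_departures u s = L * h ((s - tau) / L) + W tau.
Proof.
by have [_ ->] := arrival_rate; rewrite lax_potentialE//; eexists.
Qed.

Lemma mass_arrival : mass u = mass w.
Proof.
have [ru _] := arrival_rate; apply/eqP; rewrite eq_le; apply/andP; split.
  apply/ler_addgt0Pr => e e0; have [B _ HB] := cum_tails ru e0.
  have [_ /(_ (lexx _)) h1] := HB B.
  have := cum_arrival_late B; have := cum_le_mass rw (B - L * p0); lra.
apply/ler_addgt0Pr => e e0; have [B B0 HB] := cum_tails rw e0.
have [_ /(_ (lexx _)) h1] := HB B.
have [c c0 hc] := lp_coercive lp.
(* So late that a minimizer before [B] would already pay [mass w] in the coercive term; a minimizer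
   after [B] has nearly all departures behind it. *)
pose s := B + L * (p0 + 1) + mass w / c.
have [tau E] := cum_arrivalE s; have := cum_le_mass ru s; rewrite E.
have [Bt|tB] := leP B tau.
  have := cum_nd rw Bt; have := lp_h_ge0 lp ((s - tau) / L).
  by rewrite -(pmulr_rge0 _ L_gt0); lra.
have Wt := cum_ge0 rw tau.
have h2 : mass w <= L * h ((s - tau) / L).
  apply: le_trans (ler_wpM2l (ltW L_gt0) (hc _)).
  have -> : L * (c * ((s - tau) / L - (p0 + 1))) = c * (B - tau) + mass w.
    by rewrite /s; field; rewrite !gt_eqF.
  by rewrite lerDr mulr_ge0 ?(ltW c0)// subr_ge0 ltW.
lra.
Qed.

End OneRate.

Section Groups.
Variables (n : nat) (ub : 'I_n.+1 -> R -> R).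
Hypothesis mub : forall i, measurable_fun setT (ub i).
Hypothesis ub0 : forall i t, 0 <= ub i t.
Hypothesis rw : rate M (total_rate ub).
Hypothesis L_gt0 : 0 < L.
Notation w := (total_rate ub).
Notation u := (fun t => lax_solution f rhojam w t L).

Lemma group_fluxE i : (fun s => group_flux f rhojam ub i s L) =
  (fun s => rank_fraction ub i (cum_departures u s) * u s).
Proof.
by apply/funext => s; rewrite /group_flux /fraction; have [_ ->] := arrival_rate rw L_gt0.
Qed.

Lemma group_flux_sum s : \sum_i group_flux f rhojam ub i s L = u s.
Proof.
by rewrite /group_flux /fraction -mulr_suml dep_fraction_sum mul1r.
Qed.

Let rf0 i r : 0 <= rank_fraction ub i r.
Proof. by have /andP[] := rank_fraction01 ub0 rw i r. Qed.

Lemma group_flux_rate i : rate M (fun s => group_flux f rhojam ub i s L).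
Proof.
have [ru _] := arrival_rate rw L_gt0.
by rewrite group_fluxE; apply: rate_comp ru (rank_fraction_measurable mub rw i) (rank_fraction01 ub0 rw i).
Qed.

Lemma mass_group_flux i : mass (fun s => group_flux f rhojam ub i s L) = mass (ub i).
Proof.
have [ru _] := arrival_rate rw L_gt0.
rewrite group_fluxE (mass_comp ru (rank_fraction_measurable mub rw i) (rf0 i)).
by rewrite (mass_group mub ub0 rw) (mass_arrival rw L_gt0).
Qed.

(* First in, first out. *)
Lemma cum_group_flux i s t : cum_departures w t = cum_departures u s ->
  cum_departures (fun s => group_flux f rhojam ub i s L) s = cum_departures (ub i) t.
Proof.
have [ru _] := arrival_rate rw L_gt0 => E.
rewrite group_fluxE (cum_comp _ ru (rank_fraction_measurable mub rw i) (rf0 i)).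
by rewrite (cum_group mub ub0 rw) E.
Qed.

End Groups.

End Arrivals.

Section Realignment.
Context (R : realType) (n : nat) (M : R) (w : R -> R) (a : 'I_n.+1 -> R -> R).
Hypothesis rw : rate M w.
Hypothesis ma : forall i, measurable_fun setT (a i).
Hypothesis a0 : forall i t, 0 <= a i t.
Hypothesis ra : rate M (total_rate a).
Hypothesis mass_eq : mass (total_rate a) = mass w.

(* Departures with total rate [w], in the order in which the groups arrive
   in the plan [a]. *)
Definition realigned i t := rank_fraction a i (cum_departures w t) * w t.

Lemma realigned_total : total_rate realigned = w.
Proof.
apply/funext => t; rewrite /total_rate /realigned -mulr_suml rank_fraction_sum mul1r //.
Qed.

Lemma realigned_rate i : rate M (realigned i).
Proof. exact: rate_comp rw (rank_fraction_measurable ma ra i) (rank_fraction01 a0 ra i). Qed.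

Let rf0 i r : 0 <= rank_fraction a i r.
Proof. by have /andP[] := rank_fraction01 a0 ra i r. Qed.

Lemma realigned_mass i : mass (realigned i) = mass (a i).
Proof.
rewrite /realigned (mass_comp rw (rank_fraction_measurable ma ra i) (rf0 i)).
by rewrite (mass_group ma a0 ra) mass_eq.
Qed.

Lemma realigned_cum i s t : cum_departures w t = cum_departures (total_rate a) s ->
  cum_departures (realigned i) t = cum_departures (a i) s.
Proof.
move=> E; rewrite /realigned (cum_comp _ rw (rank_fraction_measurable ma ra i) (rf0 i)).
by rewrite (cum_group ma a0 ra) E.
Qed.

End Realignment.

(** * Travel cost by levels *)

Section LayerCake.
Context (R : realType).
Notation mu := (@lebesgue_measure R).

Definition sublevel_mass (z v : R -> R) (y : R) := \int[mu]_(s in [set s | z s <= y]) v s.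

Lemma fubini_tonelli_lebesgue (F : R * R -> \bar R) : measurable_fun setT F ->
  (forall p, 0 <= F p)%E ->
  (\int[mu]_s \int[mu]_y F (s, y) = \int[mu]_y \int[mu]_s F (s, y))%E.
Proof. by move=> mF F0; have := @fubini_tonelli _ _ (measurableTypeR R) (measurableTypeR R) R mu mu F mF F0. Qed.

Variables (z v : R -> R) (M X : R).
Hypothesis z_nd : forall s t, s <= t -> z s <= z t.
Hypothesis rv : rate M v.

Let v0 t : 0 <= v t. Proof. by case: rv => _ /(_ t)/andP[]. Qed.
Let mv : measurable_fun setT v. Proof. by case: rv. Qed.
Let mz : measurable_fun setT z. Proof. exact: nondecreasing_measurable. Qed.

Lemma measurable_sublevel y : measurable [set s | z s <= y].
Proof.
have := mz measurableT (measurable_itv `]-oo, y]).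
by rewrite setTI; congr measurable; apply/seteqP; split => x /=; rewrite in_itv.
Qed.

Let F (p : R * R) : \bar R :=
  (if [&& p.1 <= X, z p.1 <= p.2 & p.2 < z X] then v p.1 else 0)%:E.

Let mF : measurable_fun setT F.
Proof.
apply/measurable_EFinP; apply: measurable_fun_ifT.
- apply: measurable_and; first by apply: measurable_fun_ler.
  apply: measurable_and; last by apply: measurable_fun_ltr.
  by apply: measurable_fun_ler => //; apply: measurableT_comp.
- exact: measurableT_comp.
- exact: measurable_cst.
Qed.

(** Tonelli's theorem on the region [z s <= y < z X], where [s <= X] is automatic by
    monotonicity. *)
Lemma layer_cake :
  (\int[mu]_(s in `]-oo, X]) ((z X - z s) * v s)%:E =
   \int[mu]_(y in `]-oo, z X[) (sublevel_mass z v y)%:E)%E.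
Proof.
have F0 p : (0 <= F p)%E by rewrite /F lee_fin; case: ifP.
transitivity (\int[mu]_s \int[mu]_y F (s, y))%E.
  rewrite integral_mkcond; apply: eq_integral => s _; rewrite patchE mem_setE in_itv/=.
  rewrite /F/=; have [sX|Xs] := leP s X => /=; last by rewrite integral0.
  transitivity (\int[mu]_(y in `[z s, z X[) (v s)%:E)%E.
    rewrite integral_cst//= lebesgue_measure_itv/= lte_fin.
    have := z_nd sX; rewrite le_eqVlt => /predU1P[->|zsX].
      by rewrite ltxx subrr mul0r mule0.
    by rewrite zsX -EFinB -EFinM mulrC.
  rewrite integral_mkcond; apply: eq_integral => y _; rewrite patchE mem_setE in_itv/=.
  by case: ifP.
rewrite fubini_tonelli_lebesgue// [RHS]integral_mkcond; apply: eq_integral => y _.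
rewrite patchE mem_setE in_itv/= /F/=; have [yX|Xy] := ltP y (z X); last first.
  by under eq_integral do rewrite !andbF; rewrite integral0.
rewrite /sublevel_mass fineK; last first.
  apply: integrable_fin_num; first exact: measurable_sublevel.
  exact: rate_int rv _ (measurable_sublevel y).
rewrite [RHS]integral_mkcond; apply: eq_integral => s _; rewrite patchE andbT.
have [zs|zs] := leP (z s) y; last by rewrite memNset ?andbF//= leNgt zs.
rewrite mem_set// andbT; have [//|Xs] := leP s X.
by have := le_trans (z_nd (ltW Xs)) zs; rewrite leNgt yX.
Qed.

End LayerCake.

Section RealIntegrable.
Context d (T : measurableType d) (R : realType) (mu : {measure set T -> \bar R}).
Variables (D : set T) (f g : T -> R).
Hypothesis mD : measurable D.

Lemma integrableZ_real c : mu.-integrable D (EFin \o f) -> mu.-integrable D (EFin \o (fun x => c * f x)).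
Proof. by move=> i; have := integrableZl mD c i; apply: eq_integrable. Qed.

Lemma integrableD_real : mu.-integrable D (EFin \o f) -> mu.-integrable D (EFin \o g) ->
  mu.-integrable D (EFin \o (fun x => f x + g x)).
Proof. by move=> i j; have := integrableD mD i j; apply: eq_integrable. Qed.

Lemma integrableB_real : mu.-integrable D (EFin \o f) -> mu.-integrable D (EFin \o g) ->
  mu.-integrable D (EFin \o (fun x => f x - g x)).
Proof. by move=> i j; have := integrableB mD i j; apply: eq_integrable. Qed.

End RealIntegrable.

Section SublevelMass.
Context (R : realType).
Notation mu := (@lebesgue_measure R).

Lemma lebesgue_integrableS (D E : set R) (F : R -> R) : measurable D -> measurable E -> D `<=` E ->
  mu.-integrable E (EFin \o F) -> mu.-integrable D (EFin \o F).
Proof. by move=> mD mE DE; exact: integrableS. Qed.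

Lemma fine_itv_oc (a b : R) : a <= b -> fine (mu `]a, b]%classic) = b - a.
Proof.
rewrite lebesgue_measure_itv/= lte_fin; case: ltP => //= ba ab.
by apply/esym/eqP; rewrite subr_eq0 eq_le ab ba.
Qed.

Lemma integrable_itv_cst (a b c : R) : mu.-integrable `]a, b] (EFin \o cst c).
Proof.
apply: measurable_bounded_integrable => //; last exact: bounded_cst.
by rewrite /= lebesgue_measure_itv/=; case: ifP => // _; rewrite -EFinB ltry.
Qed.

Lemma Rintegral_ge_cst (F : R -> R) (a b c : R) : a <= b -> mu.-integrable `]a, b] (EFin \o F) ->
  (forall y, a < y <= b -> c <= F y) -> c * (b - a) <= \int[mu]_(y in `]a, b]) F y.
Proof.
move=> ab iF cF; rewrite -fine_itv_oc// -Rintegral_cst//; apply: le_Rintegral => //.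
exact: integrable_itv_cst.
Qed.

Lemma Rintegral_le_cst (F : R -> R) (a b c : R) : a <= b -> mu.-integrable `]a, b] (EFin \o F) ->
  (forall y, a < y <= b -> F y <= c) -> \int[mu]_(y in `]a, b]) F y <= c * (b - a).
Proof.
move=> ab iF cF; rewrite -fine_itv_oc// -Rintegral_cst//; apply: le_Rintegral => //.
exact: integrable_itv_cst.
Qed.

Lemma le_Rintegral_subset (F : R -> R) (D E : set R) : measurable D -> measurable E -> D `<=` E ->
  mu.-integrable E (EFin \o F) -> (forall y, E y -> 0 <= F y) ->
  \int[mu]_(y in D) F y <= \int[mu]_(y in E) F y.
Proof.
move=> mD mE DE iF F0; have iD : mu.-integrable D (EFin \o F) by exact: integrableS iF.
rewrite fine_le//; try exact: integrable_fin_num.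
apply: ge0_subset_integral => //; exact: measurable_int iF.
Qed.

Variables (z v : R -> R) (M : R).
Hypothesis z_incr : forall s t, s < t -> z s < z t.
Hypothesis rv : rate M v.
Notation V := (cum_departures v).
Notation sm := (sublevel_mass z v).

Let v0 t : 0 <= v t. Proof. by case: rv => _ /(_ t)/andP[]. Qed.
Let mv : measurable_fun setT v. Proof. by case: rv. Qed.

Lemma strict_nd s t : s <= t -> z s <= z t.
Proof. by rewrite le_eqVlt => /predU1P[->//|/z_incr/ltW]. Qed.

Lemma strict_le s t : (z s <= z t) = (s <= t).
Proof. by apply/idP/idP => [|/strict_nd//]; apply: contraTT; rewrite -!ltNge => /z_incr. Qed.

Let z_nd := strict_nd.

Lemma sublevel_mass_cum t : sm (z t) = V t.
Proof.
rewrite /sublevel_mass /cum_departures; congr (Rintegral _ _ _).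
by apply/seteqP; split => s /=; rewrite in_itv/= strict_le.
Qed.

Lemma sublevel_mass_nd y1 y2 : y1 <= y2 -> sm y1 <= sm y2.
Proof.
move=> y12; apply: le_Rintegral_subset => //; try exact: measurable_sublevel.
- by move=> s /= /le_trans; exact.
- by apply: rate_int rv _ _; exact: measurable_sublevel.
Qed.

Lemma sublevel_mass_below y : (forall s, y < z s) -> sm y = 0.
Proof.
move=> H; rewrite /sublevel_mass (_ : [set _ | _] = set0) ?Rintegral_set0//.
by apply/seteqP; split => // s /=; rewrite leNgt H.
Qed.

Lemma sublevel_mass_ge0 y : 0 <= sm y.
Proof. exact: Rintegral_ge0. Qed.

Lemma layer_cake_R X : mu.-integrable `]-oo, X] (EFin \o (fun s => z s * v s)) ->
  mu.-integrable `]-oo, z X] (EFin \o sm) /\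
  \int[mu]_(s in `]-oo, X]) (z s * v s) = z X * V X - \int[mu]_(y in `]-oo, z X]) sm y.
Proof.
move=> izv.
have iv : mu.-integrable `]-oo, X] (EFin \o v) by exact: rate_int rv _ _.
have izXv : mu.-integrable `]-oo, X] (EFin \o (fun s => z X * v s)).
  exact: integrableZ_real.
have iB : mu.-integrable `]-oo, X] (EFin \o (fun s => (z X - z s) * v s)).
  have : mu.-integrable `]-oo, X] (EFin \o (fun s => z X * v s - z s * v s)).
    exact: integrableB_real.
  apply: eq_integrable => //.
  by move=> s _ /=; rewrite mulrBl.
have := layer_cake X z_nd rv; set J := (\int[mu]_(s in `]-oo, X]) _)%E => JE.
have Jfin : J \is a fin_num by exact: integrable_fin_num iB.
have mS : measurable_fun setT sm by apply: nondecreasing_measurable => // y1 y2; exact: sublevel_mass_nd.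
have JE' : J = (\int[mu]_(y in `]-oo, z X]) (sm y)%:E)%E.
  by rewrite JE integral_itv_bndo_bndc//; apply/measurable_funTS/measurable_EFinP.
have iS : mu.-integrable `]-oo, z X] (EFin \o sm).
  apply/integrableP; split; first by apply/measurable_funTS/measurable_EFinP.
  under eq_integral do rewrite /= ger0_norm ?sublevel_mass_ge0//.
  by rewrite -JE' ltey_eq Jfin.
split => //.
have -> : \int[mu]_(y in `]-oo, z X]) sm y = \int[mu]_(s in `]-oo, X]) ((z X - z s) * v s).
  by rewrite /Rintegral -JE'.
transitivity (\int[mu]_(s in `]-oo, X]) (z X * v s - (z X - z s) * v s)).
  by apply: eq_Rintegral => s _; ring.
by rewrite RintegralB// RintegralZl.
Qed.

End SublevelMass.

(** [J3], [J4], [J5], [J6] stand for the integrals of the sublevel masses of [ac], [wc], [a], [w] up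
    to level [q X]; [J1] and [J2] for those of [ac] and [a] from [q X] to [psi X]. *)
Lemma travel_cost_algebra (R : realFieldType) (Gc d J1 J2 J3 J4 J5 J6 Wx Ax px qx qb : R) :
  d + (Wx - Ax) * (qx - qb) <= J6 - J5 - (J4 - J3) ->
  J2 <= Ax * (px - qx) -> Gc * (px - qx) <= J1 ->
  px * Gc - (J3 + J1) - (qx * Gc - J4) + d - (Wx - Ax) * qb <=
  px * Ax - (J5 + J2) - (qx * Wx - J6).
Proof.
move=> h1 h2 h3; rewrite -subr_ge0.
rewrite (_ : _ - _ = (J6 - J5 - (J4 - J3) - (d + (Wx - Ax) * (qx - qb)))
  + (Ax * (px - qx) - J2) + (J1 - Gc * (px - qx))); last by ring.
by apply: addr_ge0; [apply: addr_ge0|]; rewrite subr_ge0.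
Qed.

Section CostComparison.
Context (R : realType).
Notation mu := (@lebesgue_measure R).
Variables (q psi w a wc ac : R -> R) (M X B Gc y1 y2 delta : R).
Hypotheses (q_incr : forall s t, s < t -> q s < q t) (psi_incr : forall s t, s < t -> psi s < psi t).
Hypotheses (rw : rate M w) (ra : rate M a) (rwc : rate M wc) (rac : rate M ac).
Let int_le (z v : R -> R) := mu.-integrable `]-oo, X] (EFin \o (fun s => z s * v s)).
Hypotheses (iw : int_le q w) (ia : int_le psi a) (iwc : int_le q wc) (iac : int_le psi ac).
Hypotheses (BX : B <= X) (qpsi : q X <= psi X).
Hypotheses (WcX : cum_departures wc X = Gc) (AcX : cum_departures ac X = Gc).
Let gain y := (sublevel_mass q w y - sublevel_mass psi a y)
  - (sublevel_mass q wc y - sublevel_mass psi ac y).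
Let transit := cum_departures w X - cum_departures a X.
Hypothesis ac_late : forall y, q X < y -> y <= psi X -> sublevel_mass psi ac y = Gc.
Hypothesis gain_ge0 : forall y, y <= q B -> 0 <= gain y.
Hypothesis gain_delta : forall y, y1 < y -> y <= y2 -> delta <= gain y.
Hypotheses (y12 : y1 <= y2) (y2B : y2 <= q B).
Hypothesis gain_transit : forall y, q B < y -> y <= q X -> transit <= gain y.

Definition travel_cost (w a : R -> R) : R :=
  \int[mu]_(s in `]-oo, X]) (psi s * a s) - \int[mu]_(s in `]-oo, X]) (q s * w s).

(** Levels between [q B] and [q X] gain at least [transit] each, hence [transit * (q X - q B)]. The
    boundary terms at [X] cost [transit * q X], so only [transit * q B], with [B] independent of
    [X], survives. *)
Lemma travel_cost_lower_bound :
  travel_cost wc ac + delta * (y2 - y1) - transit * q B <= travel_cost w a.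
Proof.
have [iW EW] := layer_cake_R q_incr rw iw; have [iA EA] := layer_cake_R psi_incr ra ia.
have [iWc EWc] := layer_cake_R q_incr rwc iwc; have [iAc EAc] := layer_cake_R psi_incr rac iac.
rewrite /travel_cost EW EA EWc EAc WcX AcX.
have qBX : q B <= q X by exact: strict_nd.
have sub1 : (`]-oo, q X]%classic : set R) `<=` `]-oo, psi X]%classic.
  by move=> y /=; rewrite !in_itv/= => /le_trans; exact.
have sub2 : (`]q X, psi X]%classic : set R) `<=` `]-oo, psi X]%classic.
  by move=> y /=; rewrite !in_itv/= => /andP[].
have sub3 : (`]q B, q X]%classic : set R) `<=` `]-oo, q X]%classic.
  by move=> y /=; rewrite !in_itv/= => /andP[].
have sub4 : (`]-oo, q B]%classic : set R) `<=` `]-oo, q X]%classic.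
  by move=> y /=; rewrite !in_itv/= => /le_trans; exact.
have sub5 : (`]y1, y2]%classic : set R) `<=` `]-oo, q B]%classic.
  by move=> y /=; rewrite !in_itv/= => /andP[_ /le_trans]; exact.
have mi (i : interval R) : measurable [set` i] by exact: measurable_itv.
have iA1 := lebesgue_integrableS (mi _) (mi _) sub1 iA.
have iAc1 := lebesgue_integrableS (mi _) (mi _) sub1 iAc.
have iA2 := lebesgue_integrableS (mi _) (mi _) sub2 iA.
have iAc2 := lebesgue_integrableS (mi _) (mi _) sub2 iAc.
have split_psi F : mu.-integrable `]-oo, psi X] (EFin \o F) ->
  \int[mu]_(y in `]-oo, psi X]) F y = \int[mu]_(y in `]-oo, q X]) F y + \int[mu]_(y in `]q X, psi X]) F y.
  by move=> iF; rewrite -(Rintegral_itvB iF (x := q X))// ?bnd_simp// addrC subrK.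
rewrite (split_psi _ iA) (split_psi _ iAc).
have ig : mu.-integrable `]-oo, q X] (EFin \o gain).
  by apply: integrableB_real => //; apply: integrableB_real.
have g1 : \int[mu]_(y in `]-oo, q X]) gain y =
    (\int[mu]_(y in `]-oo, q X]) sublevel_mass q w y - \int[mu]_(y in `]-oo, q X]) sublevel_mass psi a y)
    - (\int[mu]_(y in `]-oo, q X]) sublevel_mass q wc y - \int[mu]_(y in `]-oo, q X]) sublevel_mass psi ac y).
  by rewrite /gain !RintegralB//; apply: integrableB_real.
have g2 : delta * (y2 - y1) + transit * (q X - q B) <= \int[mu]_(y in `]-oo, q X]) gain y.
  have -> : \int[mu]_(y in `]-oo, q X]) gain y =
      \int[mu]_(y in `]-oo, q B]) gain y + \int[mu]_(y in `]q B, q X]) gain y.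
    by rewrite -(Rintegral_itvB ig (x := q B))// ?bnd_simp// addrC subrK.
  apply: lerD.
    apply: (@le_trans _ _ (\int[mu]_(y in `]y1, y2]) gain y)).
      apply: Rintegral_ge_cst => //.
        by apply: integrableS ig => // y /sub5/sub4.
      by move=> y /andP[]; exact: gain_delta.
    apply: le_Rintegral_subset => //; first by apply: integrableS ig.
  apply: Rintegral_ge_cst => //; first by apply: integrableS ig.
  by move=> y /andP[]; exact: gain_transit.
have g3 : \int[mu]_(y in `]q X, psi X]) sublevel_mass psi a y <= cum_departures a X * (psi X - q X).
  apply: Rintegral_le_cst => // y /andP[_ yX]; rewrite -(sublevel_mass_cum a psi_incr).
  exact: (sublevel_mass_nd psi_incr ra).
have g4 : Gc * (psi X - q X) <= \int[mu]_(y in `]q X, psi X]) sublevel_mass psi ac y.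
  by apply: Rintegral_ge_cst => // y /andP[qy yX]; rewrite ac_late.
rewrite g1 in g2; move: g2 g3 g4; rewrite /transit.
move: (\int[_]_(_ in _) _) (\int[_]_(_ in _) _) (\int[_]_(_ in _) _) (\int[_]_(_ in _) _) (\int[_]_(_ in _) _) (\int[_]_(_ in _) _).
move=> J1 J2 J3 J4 J5 J6; move: (cum_departures w X) (cum_departures a X) (psi X) (q X) (q B).
exact: travel_cost_algebra.
Qed.

End CostComparison.

(** * Relaxed plans and multipliers *)

Lemma clamp_length (R : realType) (s t b e : R) : s <= t -> b <= e ->
  fine (if Num.max s b < Num.min t e then ((Num.min t e)%:E + (- Num.max s b)%:E)%E else 0%E) =
  Num.min (Num.max t b) e - b - (Num.min (Num.max s b) e - b).
Proof.
move=> st be; case: (leP s b) => sb; case: (leP t b) => tb; case: (leP t e) => te;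
  case: (leP s e) => se; rewrite ?(min_idPl be)//; case: ltP => //=; lra.
Qed.

Lemma shifted_clamp (R : realType) (s c D : R) :
  Num.min (Num.max s c) (c + D) - c = Num.min (Num.max (s - c) 0) (0 + D) - 0.
Proof.
rewrite add0r subr0; case: (leP s c) => sc; case: (leP (s - c) 0) => sc'; case: leP => ?; case: leP => ?; lra.
Qed.

Section Carried.
Context (R : realType).
Notation mu := (@lebesgue_measure R).

(** Bounded support stated by cumulative values, hence insensitive to null sets. *)
Definition carried (B : R) (v : R -> R) := cum_departures v (- B) = 0 /\ cum_departures v B = mass v.

Section OneRate.
Variables (M : R) (v : R -> R).
Hypothesis rv : rate M v.

Lemma carried_widen (B B' : R) : B <= B' -> carried B v -> carried B' v.
Proof.
move=> BB [h1 h2]; split; apply/eqP; rewrite eq_le.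
- by rewrite (cum_ge0 rv) andbT -h1 (cum_nd rv)// lerN2.
- by rewrite (cum_le_mass rv)/= -h2 (cum_nd rv).
Qed.

Lemma null_after (X : R) : cum_departures v X = mass v -> mu.-negligible [set s | X < s /\ 0 < v s].
Proof.
move=> vX; have mI : measurable (`]X, +oo[ : set R) by exact: measurable_itv.
have E : \int[mu]_(s in `]X, +oo[) v s = 0.
  by have [_ _ iv] := rv; have := mass_split X iv; rewrite vX -[LHS]addr0 => /addrI.
apply: null_subset (rate_null_set rv mI _); first by move=> s /= [Xs ->]; rewrite in_itv/= Xs.
by rewrite -[LHS]fineK ?[fine _]E//; apply: integrable_fin_num => //; exact: rate_int rv _ mI.
Qed.

Lemma null_before (X : R) : cum_departures v X = 0 -> mu.-negligible [set s | s <= X /\ 0 < v s].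
Proof.
move=> vX; have mI : measurable (`]-oo, X] : set R) by exact: measurable_itv.
apply: null_subset (rate_null_set rv mI _); first by move=> s /= [Xs ->]; rewrite in_itv/= Xs.
by rewrite -[LHS]fineK ?[fine _]vX//; apply: integrable_fin_num => //; exact: rate_int rv _ mI.
Qed.

Let v0 t : 0 <= v t. Proof. by case: rv => _ /(_ t)/andP[]. Qed.
Let mv : measurable_fun setT v. Proof. by case: rv. Qed.

Variables (z : R -> R) (B : R).
Hypothesis z_nd : forall s t, s <= t -> z s <= z t.
Hypothesis cv : carried B v.

Lemma carried_integrable : mu.-integrable setT (EFin \o (fun s => z s * v s)).
Proof.
have mz : measurable_fun setT z by exact: nondecreasing_measurable.
have mzv : measurable_fun setT (fun s => z s * v s) by exact: measurable_funM.
pose K := `|z B| + `|z (- B)|.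
have K0 : 0 <= K by rewrite addr_ge0.
apply/integrableP; split; first exact/measurable_EFinP.
have iKv : mu.-integrable setT (EFin \o (fun s => K * v s)).
  by apply: integrableZ_real => //; case: rv.
apply: (@le_lt_trans _ _ (\int[mu]_s (K * v s)%:E)%E); last first.
  by rewrite ltey_eq; apply/orP; left; exact: integrable_fin_num iKv.
apply: ae_ge0_le_integral => //.
- by apply: measurableT_comp => //; exact/measurable_EFinP.
- by move=> s _; rewrite lee_fin mulr_ge0.
- by have /integrableP[] := iKv.
have [c1 c2] := cv; have := null_before c1; have := null_after c2 => n1 n2.
have := @negligibleU _ _ _ mu _ _ n2 n1; apply: null_subset => s /= /not_implyP[_].
rewrite lee_fin => /negP; rewrite -ltNge normrM (ger0_norm (v0 s)) => lt.
have vs : 0 < v s.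
  by rewrite lt_neqAle v0 andbT; apply/eqP => vs; move: lt; rewrite -vs !mulr0 ltxx.
have [sB|Bs] := leP s (- B); first by left.
have [sB|] := leP s B; last by right.
move: lt; rewrite ltr_pM2r// ltNge /K => /negP[]; have := z_nd sB; have := z_nd (ltW Bs) => h1 h2.
rewrite ler_norml; have := ler_norm (z B); have := ler_norm (- z (- B)); rewrite normrN.
have := normr_ge0 (z B); have := normr_ge0 (z (- B)).
move: `|z B| `|z (- B)| => k1 k2 *; apply/andP; split; lra.
Qed.

Lemma carried_Rintegral : mass (fun s => z s * v s) = \int[mu]_(s in `]-oo, B]) (z s * v s).
Proof.
have izv := carried_integrable.
have mz : measurable_fun setT z by exact: nondecreasing_measurable.
have mzv : measurable_fun setT (fun s => z s * v s) by exact: measurable_funM.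
rewrite Rintegral_mkcond; apply: eq_mass_ae => //.
  by apply/(measurable_restrictT _ _).1 => //; exact: measurable_funTS.
have [c1 c2] := cv; apply: null_subset (null_after c2) => s /=.
rewrite patchE mem_setE in_itv/=; case: leP => [_|Bs]; first by rewrite eqxx.
move=> ne; split => //; rewrite lt_neqAle v0 andbT; apply: contra_neq ne => <-.
by rewrite mulr0.
Qed.

End OneRate.

(** Costs may be bounded below, so a level can lie under the whole range; every argument by levels
    has to treat this case. *)
Lemma level_cases (z : R -> R) (X y : R) : continuous z -> y <= z X ->
  (exists2 s, s <= X & z s = y) \/ (forall s, s <= X -> y < z s).
Proof.
move=> zc yX; have [[s [sX zs]]|H] := pselect (exists s, s <= X /\ z s <= y); last first.
  by right => s sX; rewrite ltNge; apply/negP => zs; apply: H; exists s.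
left; have [|c cI zcE] := IVT sX (continuous_subspaceT zc) (v := y).
  have zsX := le_trans zs yX.
  by rewrite (min_idPl zsX) (max_idPr zsX) zs.
by exists c => //; move: cI; rewrite in_itv/= => /andP[].
Qed.

Lemma sublevel_mass_le (z v1 v2 : R -> R) (M X y : R) : continuous z ->
  (forall s t, s < t -> z s < z t) -> rate M v1 -> rate M v2 ->
  (forall s, cum_departures v2 s <= cum_departures v1 s) -> y <= z X ->
  sublevel_mass z v2 y <= sublevel_mass z v1 y.
Proof.
move=> zc zi r1 r2 le yX; have [[s _ <-]|H] := level_cases zc yX.
  by rewrite !sublevel_mass_cum.
have H' s : y < z s.
  have [/H//|Xs] := leP s X; exact: lt_trans (H X (lexx _)) (zi _ _ Xs).
by rewrite !sublevel_mass_below.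
Qed.

(** Stochastic dominance: with an increasing cost, the rate that accumulates earlier is cheaper. By
    the layer cake it suffices to compare cumulative values. *)
Lemma carried_cost_le (z v1 v2 : R -> R) (M B : R) : continuous z ->
  (forall s t, s < t -> z s < z t) -> rate M v1 -> rate M v2 ->
  carried B v1 -> carried B v2 -> mass v1 = mass v2 ->
  (forall s, cum_departures v2 s <= cum_departures v1 s) ->
  mass (fun s => z s * v1 s) <= mass (fun s => z s * v2 s).
Proof.
move=> zc zi r1 r2 c1 c2 m12 le; have znd := strict_nd zi.
rewrite (carried_Rintegral r1 znd c1) (carried_Rintegral r2 znd c2).
have iT v : rate M v -> carried B v -> mu.-integrable `]-oo, B] (EFin \o (fun s => z s * v s)).
  move=> rv cv; apply: lebesgue_integrableS (carried_integrable rv znd cv) => //.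
have [i1 ->] := layer_cake_R zi r1 (iT _ r1 c1).
have [i2 ->] := layer_cake_R zi r2 (iT _ r2 c2).
case: c1 c2 => [_ ->] [_ ->]; rewrite m12 lerD2l lerN2; apply: le_Rintegral => //.
by move=> y /=; rewrite in_itv/= => yB; exact: (@sublevel_mass_le _ _ _ M B).
Qed.

End Carried.

(** * Supporting functional at the origin of a convex set *)

Section SupportingFunctional.
Context (R : realType) (m : nat) (E : ('I_m -> R) -> R -> Prop).
Hypothesis E_convex : forall v1 c1 v2 c2 l, E v1 c1 -> E v2 c2 -> 0 < l < 1 ->
  E (fun i => (1 - l) * v1 i + l * v2 i) ((1 - l) * c1 + l * c2).
Hypothesis E0 : forall c, E (fun=> 0) c -> 0 <= c.
Hypothesis E_absorbing : forall v, exists2 l, 0 < l & exists c, E (fun i => l * v i) c.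

(* The coordinates are treated one at a time: when the inequality holds on the
   vectors supported on the first k coordinates, mixing two of them with
   opposite signs at coordinate k cancels that coordinate. *)
Lemma supporting_functional : exists C : 'I_m -> R, forall v c, E v c -> \sum_i C i * v i <= c.
Proof.
suff H k : (k <= m)%N -> exists C : 'I_m -> R, forall v c, E v c ->
    (forall i : 'I_m, (k <= i)%N -> v i = 0) -> \sum_i C i * v i <= c.
  have [C HC] := H m (leqnn _); exists C => v c Evc; apply: HC => // i.
  by rewrite leqNgt ltn_ord.
elim: k => [_|k IH km].
  exists (fun=> 0) => v c Evc v0; rewrite big1; last by move=> i _; rewrite mul0r.
  by apply: E0; have <- : v = fun=> 0 by apply/funext => i; exact: v0.
have [C HC] := IH (ltnW km); pose ik := Ordinal km.
pose S v := \sum_i C i * v i.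
have S_lin v1 v2 (x y : R) : S (fun i => x * v1 i + y * v2 i) = x * S v1 + y * S v2.
  by rewrite /S !mulr_sumr -big_split/=; apply: eq_bigr => i _; ring.
pose P v c := E v c /\ forall i : 'I_m, (k < i)%N -> v i = 0.
have key v1 c1 v2 c2 : P v1 c1 -> P v2 c2 -> v1 ik < 0 -> 0 < v2 ik ->
    (c1 - S v1) / v1 ik <= (c2 - S v2) / v2 ik.
  move=> [E1 Z1] [E2 Z2] n1 p2; pose d := v2 ik - v1 ik; pose l := - v1 ik / d.
  have d0 : 0 < d by rewrite /d; lra.
  have l0 : 0 < l by rewrite divr_gt0// oppr_gt0.
  have l1 : 1 - l = v2 ik / d by rewrite /l /d; field; rewrite gt_eqF.
  have l2 : l < 1 by rewrite -subr_gt0 l1 divr_gt0.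
  have l01 : 0 < l < 1 by rewrite l0.
  have := HC _ _ (E_convex E1 E2 l01); rewrite -/(S _) S_lin => /(_ _)/wrap[].
    move=> i; rewrite leq_eqVlt => /predU1P[ki|ki]; last by rewrite Z1// Z2// !mulr0 addr0.
    have <- : ik = i by apply: val_inj.
    by rewrite l1 /l; field; rewrite gt_eqF.
  rewrite -subr_ge0 l1 /l => H; rewrite ler_pdivlMr// mulrAC ler_ndivrMr//.
  have : 0 <= d * (v2 ik / d * c1 + - v1 ik / d * c2 - (v2 ik / d * S v1 + - v1 ik / d * S v2)).
    by rewrite mulr_ge0// ltW.
  have -> : d * (v2 ik / d * c1 + - v1 ik / d * c2 - (v2 ik / d * S v1 + - v1 ik / d * S v2)) =
      v2 ik * (c1 - S v1) - v1 ik * (c2 - S v2) by field; rewrite gt_eqF.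
  lra.
have ex x : x != 0 -> exists v c, P v c /\ 0 < v ik * x.
  move=> x0; have [l l0 [c Ec]] := E_absorbing (fun i => if i == ik then x else 0).
  exists (fun i => l * (if i == ik then x else 0)), c; split; last first.
    by rewrite eqxx -mulrA mulr_gt0// -expr2 exprn_even_gt0.
  by split => // i ki; rewrite ifN ?mulr0//; apply: contraTneq ki => ->; rewrite /= ltnn.
have [vp [cp [Pp]]] := ex 1 (oner_neq0 _); rewrite mulr1 => vp0.
have m10 : (-1 : R) != 0 by rewrite oppr_eq0 oner_neq0.
have [vn [cn [Pn]]] := ex (-1) m10; rewrite mulrN1 oppr_gt0 => vn0.
(* Vectors with negative coordinate [ik] bound the new coefficient from below, those with positive
   one from above; [key] makes the bounds compatible. *)
pose A := [set x | exists v c, [/\ P v c, v ik < 0 & x = (c - S v) / v ik]].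
have Aub : ubound A ((cp - S vp) / vp ik) by move=> _ [v [c [Pv v0 ->]]]; exact: key.
have A0 : A !=set0 by exists ((cn - S vn) / vn ik), vn, cn.
pose D := sup A; exists (fun i => C i + (if i == ik then D else 0)) => v c Evc Zv.
have -> : \sum_i (C i + (if i == ik then D else 0)) * v i = S v + D * v ik.
  rewrite /S (bigD1 ik)//= eqxx [in RHS](bigD1 ik)//=.
  rewrite (eq_bigr (fun i => C i * v i)); first by ring.
  by move=> i /negbTE ->; rewrite addr0.
have Pv : P v c by [].
have [v0|v0|v0] := ltgtP (v ik) 0.
- have : (c - S v) / v ik <= D by apply: ub_le_sup; [eexists; exact: Aub|exists v, c].
  by rewrite ler_ndivrMr//; lra.
- have : D <= (c - S v) / v ik by apply: ge_sup => // _ [v' [c' [Pv' n' ->]]]; exact: key.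
  by rewrite ler_pdivlMr//; lra.
- rewrite v0 mulr0 addr0; apply: HC => // i; rewrite leq_eqVlt => /predU1P[ki|]; last exact: Zv.
  by have <- : ik = i by apply: val_inj.
Qed.

End SupportingFunctional.

(** * Relaxed plans: convexity, realization by departures, duality *)

Section Plans.
Context (R : realType) (f : R -> R) (rhojam L kappa : R).
Notation mu := (@lebesgue_measure R).
Notation p0 := (dflux_inv f rhojam 0).
Notation M := (max_flux f rhojam).
Notation gam := (segment_value f rhojam).
Notation h := (flux_conj f rhojam).
Hypothesis lp : legendre_pair p0 M kappa gam h.
Hypothesis legE : forall p, legendre f rhojam p = if p0 <= p then (h p)%:E else +oo%E.
Hypothesis L_gt0 : 0 < L.
Variables (n : nat) (q : R -> R) (psi : 'I_n.+1 -> R -> R).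
Hypothesis q_incr : forall s t, s < t -> q s < q t.
Hypotheses (psi_cont : forall i, continuous (psi i))
  (psi_incr : forall i s t, s < t -> psi i s < psi i t).

(* Relaxed solutions: the arrival rates [a] only have to obey the inequality
   of the Lax formula, and the groups need not preserve their order. *)
Record plan (B : R) (w : R -> R) (a : 'I_n.+1 -> R -> R) : Prop := {
  plan_w : rate M w;
  plan_am : forall i, measurable_fun setT (a i);
  plan_a0 : forall i t, 0 <= a i t;
  plan_ra : rate M (total_rate a);
  plan_mass : mass (total_rate a) = mass w;
  plan_lax : forall s t, cum_departures (total_rate a) s <= L * h ((s - t) / L) + cum_departures w t;
  plan_carried : carried B w;
  plan_acarried : forall i, carried B (a i) }.

Definition plan_cost (w : R -> R) (a : 'I_n.+1 -> R -> R) : R :=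
  \sum_i mass (fun s => psi i s * a i s) - mass (fun s => q s * w s).

Lemma plan_a_rate B w a i : plan B w a -> rate M (a i).
Proof. by move=> P; exact: group_rate (plan_am P) (plan_a0 P) (plan_ra P) i. Qed.

Lemma plan_widen B B' w a : B <= B' -> plan B w a -> plan B' w a.
Proof.
move=> BB P; case: (P) => rw am a0 ra me la cw ca; split => //.
  exact: (carried_widen rw BB).
by move=> i; apply: (carried_widen _ BB (ca i)); exact: plan_a_rate P.
Qed.

Section Mix.
Variable l : R.
Hypothesis l01 : 0 < l < 1.
Definition mix (v1 v2 : R -> R) t := (1 - l) * v1 t + l * v2 t.

Lemma mix_integrable (D : set R) v1 v2 : measurable D ->
  mu.-integrable D (EFin \o v1) -> mu.-integrable D (EFin \o v2) ->
  mu.-integrable D (EFin \o mix v1 v2) /\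
  \int[mu]_(s in D) mix v1 v2 s = (1 - l) * (\int[mu]_(s in D) v1 s) + l * (\int[mu]_(s in D) v2 s).
Proof.
move=> mD i1 i2.
have j1 : mu.-integrable D (EFin \o (fun s => (1 - l) * v1 s)) by exact: integrableZ_real.
have j2 : mu.-integrable D (EFin \o (fun s => l * v2 s)) by exact: integrableZ_real.
split; first exact: integrableD_real.
by rewrite RintegralD// !RintegralZl.
Qed.

Lemma mix_rate v1 v2 : rate M v1 -> rate M v2 -> rate M (mix v1 v2).
Proof.
move=> [m1 b1 i1] [m2 b2 i2]; split.
- by apply: measurable_funD; apply: measurable_funM.
- move=> t; have /andP[x1 x2] := b1 t; have /andP[y1 y2] := b2 t; case/andP: l01 => l0 l1.
  rewrite addr_ge0 ?mulr_ge0 ?subr_ge0 ?(ltW l0) ?(ltW l1)//=.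
  have -> : M = (1 - l) * M + l * M by ring.
  by apply: lerD; rewrite ler_wpM2l// ?subr_ge0 ltW.
- by have [] := mix_integrable measurableT i1 i2.
Qed.

Lemma mix_cum v1 v2 t : rate M v1 -> rate M v2 ->
  cum_departures (mix v1 v2) t = (1 - l) * cum_departures v1 t + l * cum_departures v2 t.
Proof.
move=> r1 r2; rewrite /cum_departures.
by have [] := mix_integrable (measurable_itv `]-oo, t]) (rate_int r1 (measurable_itv _)) (rate_int r2 (measurable_itv _)).
Qed.

Lemma mix_mass v1 v2 : rate M v1 -> rate M v2 ->
  mass (mix v1 v2) = (1 - l) * mass v1 + l * mass v2.
Proof. by move=> [_ _ i1] [_ _ i2]; have [] := mix_integrable measurableT i1 i2. Qed.

Lemma mix_carried B v1 v2 : rate M v1 -> rate M v2 -> carried B v1 -> carried B v2 ->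
  carried B (mix v1 v2).
Proof.
by move=> r1 r2 [a1 b1] [a2 b2]; split; rewrite ?mix_cum// ?mix_mass// ?a1 ?a2 ?b1 ?b2// !mulr0 addr0.
Qed.

Lemma mix_cost B (z v1 v2 : R -> R) : (forall s t, s < t -> z s < z t) ->
  rate M v1 -> rate M v2 -> carried B v1 -> carried B v2 ->
  mass (fun s => z s * mix v1 v2 s) = (1 - l) * mass (fun s => z s * v1 s) + l * mass (fun s => z s * v2 s).
Proof.
move=> zi r1 r2 c1 c2; have znd := strict_nd zi.
have i1 := carried_integrable r1 znd c1; have i2 := carried_integrable r2 znd c2.
have [_ <-] := mix_integrable measurableT i1 i2.
by apply: eq_Rintegral => s _; rewrite /mix; ring.
Qed.

Lemma mix_total (a1 a2 : 'I_n.+1 -> R -> R) :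
  total_rate (fun i => mix (a1 i) (a2 i)) = mix (total_rate a1) (total_rate a2).
Proof.
by apply/funext => t; rewrite /total_rate /mix big_split/= !mulr_sumr.
Qed.

Lemma mix_plan B w1 w2 a1 a2 : plan B w1 a1 -> plan B w2 a2 ->
  plan B (mix w1 w2) (fun i => mix (a1 i) (a2 i)) /\
  plan_cost (mix w1 w2) (fun i => mix (a1 i) (a2 i)) =
    (1 - l) * plan_cost w1 a1 + l * plan_cost w2 a2.
Proof.
move=> P1 P2; have [rw1 rw2] := (plan_w P1, plan_w P2).
have ra1 i := plan_a_rate i P1; have ra2 i := plan_a_rate i P2.
have [rt1 rt2] := (plan_ra P1, plan_ra P2).
case/andP: (l01) => l0 l1.
split; last first.
  rewrite /plan_cost (mix_cost (B := B) q_incr rw1 rw2 (plan_carried P1) (plan_carried P2)).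
  rewrite (eq_bigr (fun i => (1 - l) * mass (fun s => psi i s * a1 i s) + l * mass (fun s => psi i s * a2 i s))).
    by rewrite big_split/= -!mulr_sumr; ring.
  move=> i _; apply: (mix_cost (B := B) (psi_incr i)) => //; [exact: plan_acarried P1 i|exact: plan_acarried P2 i].
split.
- exact: mix_rate.
- by move=> i; case: (mix_rate (ra1 i) (ra2 i)).
- move=> i t; rewrite addr_ge0// mulr_ge0 ?(ltW l0) ?subr_ge0 ?(ltW l1)//.
    exact: plan_a0 P1 i t.
  exact: plan_a0 P2 i t.
- by rewrite mix_total; exact: mix_rate.
- by rewrite mix_total !mix_mass// (plan_mass P1) (plan_mass P2).
- move=> s t; rewrite mix_total !mix_cum//.
  have h1 := plan_lax P1 s t; have h2 := plan_lax P2 s t.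
  have -> : L * h ((s - t) / L) + ((1 - l) * cum_departures w1 t + l * cum_departures w2 t) =
    (1 - l) * (L * h ((s - t) / L) + cum_departures w1 t) + l * (L * h ((s - t) / L) + cum_departures w2 t).
    by ring.
  by apply: lerD; rewrite ler_wpM2l// ?subr_ge0 ltW.
- by apply: mix_carried => //; [exact: plan_carried P1|exact: plan_carried P2].
- by move=> i; apply: mix_carried => //; [exact: plan_acarried P1 i|exact: plan_acarried P2 i].
Qed.

End Mix.

Lemma Rintegral_sum_ord (D : set R) m (F : 'I_m -> R -> R) : measurable D ->
  (forall i, mu.-integrable D (EFin \o F i)) ->
  mu.-integrable D (EFin \o (fun x => \sum_i F i x)) /\
  \int[mu]_(x in D) (\sum_i F i x) = \sum_i \int[mu]_(x in D) F i x.
Proof.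
move=> mD; elim: m F => [|m IH] F iF.
  have -> : (fun x => \sum_(i < 0) F i x) = (fun=> 0) by apply/funext => x; rewrite big_ord0.
  by rewrite big_ord0 /Rintegral integral0; split => //; exact: integrable0.
have [i1 E1] := IH (fun i => F (widen_ord (leqnSn m) i)) (fun i => iF _).
have E : (fun x => \sum_i F i x) =
    (fun x => \sum_(i < m) F (widen_ord (leqnSn m) i) x + F ord_max x).
  by apply/funext => x; rewrite big_ord_recr.
split; first by rewrite E; exact: integrableD_real.
by rewrite E RintegralD// E1 big_ord_recr.
Qed.

Lemma cum_total (a : 'I_n.+1 -> R -> R) t : (forall i, rate M (a i)) ->
  cum_departures (total_rate a) t = \sum_i cum_departures (a i) t.
Proof.
move=> ra; have mI : measurable (`]-oo, t] : set R) by exact: measurable_itv.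
by have [_] := Rintegral_sum_ord mI (fun i => rate_int (ra i) mI).
Qed.

Lemma mass_total (a : 'I_n.+1 -> R -> R) : (forall i, rate M (a i)) ->
  mass (total_rate a) = \sum_i mass (a i).
Proof.
by move=> ra; have [_] := Rintegral_sum_ord measurableT (fun i => rate_int (ra i) measurableT).
Qed.

Lemma plan_total_carried B w a : plan B w a -> carried B (total_rate a).
Proof.
move=> P; have ra i := plan_a_rate i P; have ca i := plan_acarried P i.
split; first by rewrite cum_total// big1// => i _; have [] := ca i.
by rewrite cum_total// mass_total//; apply: eq_bigr => i _; have [] := ca i.
Qed.

Lemma carried_surj B w r : rate M w -> carried B w -> - B <= B -> 0 <= r <= mass w ->
  exists t, cum_departures w t = r.
Proof.
move=> rw [c1 c2] BB r01.
have [|c _ cE] := IVT BB (continuous_subspaceT (cum_continuous rw)) (v := r); last by exists c.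
by rewrite (min_idPl (cum_nd rw BB)) (max_idPr (cum_nd rw BB)) c1 c2.
Qed.

Notation flux w := (fun t => lax_solution f rhojam w t L).
Notation phis := (fun (_ : 'I_n.+1) (t : R) => (- q t)%R).

(** Among cumulative arrivals satisfying the Lax inequality for [w], the Lax solution has the
    largest. With departures in the order of [a], each group then arrives no later than in the plan,
    and arrival costs increase. *)
Lemma realign_cost (G : 'I_n.+1 -> R) B w a : 0 < B -> plan B w a -> (forall i, mass (a i) = G i) ->
  exists vb, [/\ admissible f rhojam G vb,
    has_cost f rhojam L phis psi vb &
    (total_cost f rhojam L phis psi vb <= (plan_cost w a)%R%:E)%E].
Proof.
move=> B0 P aG; have BB : - B <= B by lra.
have [[[rw am] a0] ra] := (plan_w P, plan_am P, plan_a0 P, plan_ra P).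
have ma := plan_mass P; have rai i := plan_a_rate i P.
set vb := realigned w a; exists vb.
have tvb : total_rate vb = w by apply: realigned_total.
have rvb i : rate M (vb i) by apply: realigned_rate rw am a0 ra i.
have mvb i : mass (vb i) = mass (a i) by apply: (realigned_mass rw am a0 ra ma).
have vb0 i t : 0 <= vb i t by have [_ /(_ t)/andP[]] := rvb i.
have vbm i : measurable_fun setT (vb i) by have [] := rvb i.
have rw' : rate M (total_rate vb) by rewrite tvb.
have [ru _] := arrival_rate lp legE rw L_gt0.
have rgf i : rate M (fun s => group_flux f rhojam vb i s L).
  exact: (group_flux_rate lp legE vbm vb0 rw' L_gt0).
have mgf i : mass (fun s => group_flux f rhojam vb i s L) = mass (a i).
  by rewrite (mass_group_flux lp legE vbm vb0 rw' L_gt0) mvb.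
have fifo i s t : cum_departures w t = cum_departures (flux w) s ->
    cum_departures (fun s => group_flux f rhojam vb i s L) s = cum_departures (vb i) t.
  by move=> E; apply: (cum_group_flux lp legE vbm vb0 rw' L_gt0); rewrite tvb.
have algn i s t : cum_departures w t = cum_departures (total_rate a) s ->
    cum_departures (vb i) t = cum_departures (a i) s.
  exact: (realigned_cum rw am a0 ra).
have AU s : cum_departures (total_rate a) s <= cum_departures (flux w) s.
  by have [tau ->] := cum_arrivalE lp legE rw L_gt0 s; exact: plan_lax P s tau.
have [w1 w2] := plan_carried P; have [A1 A2] := plan_total_carried P.
have U1 : cum_departures (flux w) (- B) = 0.
  apply/eqP; rewrite eq_le (cum_ge0 ru) andbT.
  apply: le_trans (cum_arrival_late lp legE rw L_gt0 _) _; rewrite -[X in _ <= X]w1; apply: (cum_nd rw).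
  by rewrite gerBl mulr_ge0// ltW// (lp_p0 lp).
have U2 : cum_departures (flux w) B = mass w.
  apply/eqP; rewrite eq_le -[in X in X && _](mass_arrival lp legE rw L_gt0) (cum_le_mass ru)/=.
  by rewrite -ma -A2.
have c1 i : cum_departures (vb i) (- B) = 0.
  by rewrite (algn i (- B)) ?w1 ?A1//; have [] := plan_acarried P i.
have c2 i : cum_departures (vb i) B = mass (a i).
  by rewrite (algn i B) ?w2 ?A2//; have [] := plan_acarried P i.
have cvb i : carried B (vb i) by split; [exact: c1|rewrite c2 mvb].
have cgf i : carried B (fun s => group_flux f rhojam vb i s L).
  by split; rewrite ?mgf; [rewrite (fifo i _ (- B)) ?w1 ?U1|rewrite (fifo i _ B) ?w2 ?U2].
(* [t] and [t'] are departure times of the ranks reached at time [s] by the Lax solution and by the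
   plan; the former rank is the larger one. *)
have dom i s : cum_departures (a i) s <= cum_departures (fun s => group_flux f rhojam vb i s L) s.
  have [|t tE] := @carried_surj B w (cum_departures (flux w) s) rw (plan_carried P) BB.
    by rewrite (cum_ge0 ru) -(mass_arrival lp legE rw L_gt0) (cum_le_mass ru).
  have [|t' t'E] := @carried_surj B w (cum_departures (total_rate a) s) rw (plan_carried P) BB.
    by rewrite (cum_ge0 ra) -ma (cum_le_mass ra).
  rewrite (fifo i s t tE) -(algn i s t' t'E).
  have [tt|/ltW tt] := leP t' t; first exact: cum_nd (rvb i) _ _ tt.
  (* Departure times of a rank are not unique: here the times come in the wrong order, which forces
     the ranks to be equal. *)
  have E : cum_departures w t = cum_departures w t'.
    by apply/eqP; rewrite eq_le (cum_nd rw tt)/= tE t'E AU.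
  by rewrite (algn i s t') // (algn i s t)// E.
have qnd := strict_nd q_incr.
have iq i := carried_integrable (rvb i) qnd (cvb i).
have ip i := carried_integrable (rgf i) (strict_nd (psi_incr i)) (cgf i).
have cdE i : EFin \o cost_density f rhojam L phis psi vb i =
    EFin \o (fun t => psi i t * group_flux f rhojam vb i t L - q t * vb i t).
  by apply/funext => t; rewrite /cost_density/=; congr EFin; ring.
have icd i : mu.-integrable setT (EFin \o (fun t => psi i t * group_flux f rhojam vb i t L - q t * vb i t)).
  exact: integrableB_real.
split.
- split => //.
  + by move=> i; rewrite -aG -mvb /mass fineK//; apply: integrable_fin_num => //; case: (rvb i).
  + by move=> t; rewrite tvb; have [_ /(_ t)/andP[]] := rw.
- by move=> i; have := icd i; rewrite -(cdE i).
- rewrite /total_cost.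
  have -> : (\sum_(i < n.+1) \int[mu]_t (cost_density f rhojam L phis psi vb i t)%:E =
     (\sum_(i < n.+1) (mass (fun s => (psi i s * group_flux f rhojam vb i s L)%R) - mass (fun s => (q s * vb i s)%R)))%:E)%E.
    rewrite -sumEFin; apply: eq_bigr => i _.
    rewrite -[LHS]fineK; last by apply: integrable_fin_num => //; have := icd i; rewrite -cdE.
    have := cdE i => /(congr1 (fun F => fine (integral mu setT F))) ->.
    by rewrite -RintegralB.
  rewrite lee_fin sumrB /plan_cost; apply: lerB.
    apply: ler_sum => i _.
    exact: (carried_cost_le (@psi_cont i) (psi_incr i) (rgf i) (rai i) (cgf i) (plan_acarried P i) (mgf i) (dom i)).
  have [_ <-] := Rintegral_sum_ord measurableT iq.
  rewrite le_eqVlt; apply/orP; left; apply/eqP; apply: eq_Rintegral => s _.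
  by rewrite -mulr_sumr -[in LHS]tvb.
Qed.

Lemma block_rate (K b D : R) : 0 <= K -> 0 <= D ->
  exists2 v, rate K v & forall t, cum_departures v t = K * (Num.min (Num.max t b) (b + D) - b).
Proof.
move=> K0 D0; pose v := (cst K : R -> R) \_ (`]b, b + D]).
have v01 t : 0 <= v t <= K by rewrite /v patchE; case: ifP; rewrite ?lexx ?K0.
have mv : measurable_fun setT v by apply/(measurable_restrictT _ _).1.
pose V t := K * (Num.min (Num.max t b) (b + D) - b).
have Vb t : t <= b -> V t = 0.
  by move=> tb; rewrite /V (max_idPr tb) min_l ?lerDl// subrr mulr0.
have [|||rv vV] := @rate_of_primitive _ K (K * D) v V mv v01; last by exists v.
- move=> t; rewrite /V; apply/andP; split.
    by rewrite mulr_ge0// subr_ge0 le_min le_max lexx orbT lerDl.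
  by rewrite ler_wpM2l// lerBlDl ge_min lexx orbT.
- by move=> e e0; exists b => t /Vb ->.
move=> s t st; rewrite /v -Rintegral_mkcondr.
have -> : `]s, t] `&` `]b, b + D] = [set` `]Num.max s b, Num.min t (b + D)]].
  apply/seteqP; split => x /=; rewrite !in_itv/= gt_max le_min.
    by case=> /andP[-> ->] /andP[-> ->].
  by move=> /andP[/andP[-> ->] /andP[-> ->]].
rewrite Rintegral_cst//= lebesgue_measure_itv/= lte_fin /V -mulrBr; congr (_ * _).
by apply: clamp_length; rewrite ?lerDl.
Qed.

(** All drivers leave at the constant rate [K] carried by slope [p0 + 1] and arrive [c], the travel
    time at that slope, later. The supporting line of [h] at [p0 + 1] yields the Lax inequality.
    This provides plans of arbitrary positive masses. *)
Lemma block_plan (g : 'I_n.+1 -> R) : (forall i, 0 < g i) ->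
  exists B w a, [/\ 0 < B, plan B w a & forall i, mass (a i) = g i].
Proof.
move=> g0; pose S := \sum_i g i; pose K := gam (p0 + 1).
have S0 : 0 < S by rewrite /S (bigD1 ord0)//= ltr_pwDl// sumr_ge0// => i _; exact: ltW.
have K0 : 0 < K by rewrite -(lp_gam0 lp (lexx p0)) (lp_gam_incr lp)// ltrDl.
have KM : K <= M by have /andP[_ /ltW] := lp_gam_bnd lp (p0 + 1).
pose D := S / K; have D0 : 0 < D by rewrite divr_gt0.
have KD : K * D = S by rewrite /D mulrC divfK// gt_eqF.
pose c := L * (p0 + 1).
have c0 : 0 < c by rewrite mulr_gt0// addr_gt0// (lp_p0 lp).
have [w rw wE] := block_rate 0 (ltW K0) (ltW D0).
have [a ra aE] := block_rate c (ltW K0) (ltW D0).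
have rateM v : rate K v -> rate M v.
  by case=> mv bv iv; split => // t; have /andP[-> /le_trans->] := bv t.
have massS v b : rate K v -> (forall t, cum_departures v t = K * (Num.min (Num.max t b) (b + D) - b)) ->
    mass v = S.
  move=> rv vE.
  have late t : b + D <= t -> cum_departures v t = S.
    by move=> t_ge; rewrite vE max_l ?min_r//; [rewrite addrC addKr|lra].
  apply/eqP; rewrite eq_le -[X in _ && (X <= _)](late (b + D))// (cum_le_mass rv) andbT.
  apply/ler_addgt0Pr => e e0; have [B _ /(_ (Num.max B (b + D)))[_]] := cum_tails rv e0.
  by rewrite late ?le_max ?lexx ?orbT// => /(_ isT); lra.
pose B := c + D; have B0 : 0 < B by rewrite addr_gt0.
have gS i : 0 <= g i / S by rewrite divr_ge0// ltW.
have car v b : 0 <= b <= c -> rate K v ->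
    (forall t, cum_departures v t = K * (Num.min (Num.max t b) (b + D) - b)) ->
    carried B v.
  move=> /andP[b0 bc] rv vE; split; rewrite ?(massS v b)// vE.
    by rewrite max_r ?min_l ?subrr ?mulr0//; rewrite ?lerDl ?ltW// /B; lra.
  by rewrite max_l ?min_r; [rewrite addrC addKr| |]; rewrite /B; lra.
have cumZ i t : cum_departures (fun s => g i / S * a s) t = g i / S * cum_departures a t.
  by rewrite /cum_departures RintegralZl//; exact: rate_int ra _ _.
have massZ i : mass (fun s => g i / S * a s) = g i.
  rewrite /mass RintegralZl//; last by case: ra.
  by rewrite [X in _ * X](massS a c)// divfK// gt_eqF.
have tot : total_rate (fun i s => g i / S * a s) = a.
  by apply/funext => t; rewrite /total_rate -mulr_suml -mulr_suml mulfV ?gt_eqF// mul1r.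
exists B, w, (fun i s => g i / S * a s); split => //; split => //.
- exact: rateM.
- by move=> i; apply: measurable_funM => //; case: ra.
- by move=> i t; rewrite mulr_ge0//; have [_ /(_ t)/andP[]] := ra.
- by rewrite tot; exact: rateM.
- by rewrite tot (massS a c)// (massS w 0).
- move=> s t; rewrite tot.
  have -> : cum_departures a s = cum_departures w (s - c).
    by rewrite aE wE shifted_clamp.
  have := lp_subgrad lp (p0 + 1) ((s - t) / L); rewrite -/K => sg.
  have h0 := lp_h_ge0 lp (p0 + 1); have hs0 := lp_h_ge0 lp ((s - t) / L).
  have sg' : K * (s - c - t) <= L * h ((s - t) / L).
    apply: (@le_trans _ _ (L * (K * ((s - t) / L - (p0 + 1))))).
      rewrite le_eqVlt; apply/orP; left; apply/eqP; rewrite /c; field; rewrite gt_eqF//.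
    by rewrite ler_pM2l//; lra.
  have [st|/ltW st] := leP t (s - c).
    by have := cum_lip rw st; lra.
  by apply: le_trans (cum_nd rw st) _; rewrite lerDr mulr_ge0// ltW.
- by apply: (car w 0) => //; rewrite lexx ltW.
- move=> i; have [a1 a2] : carried B a by apply: (car a c) => //; rewrite lexx ltW.
  by split; rewrite cumZ ?massZ ?a1 ?a2 ?mulr0// (massS a c)// divfK// gt_eqF.
Qed.

(** [E] collects the pairs of a perturbation of the masses [G] and an excess of cost over [J]. It is
    convex because plans can be mixed, and the assumption says that zero perturbation has
    nonnegative excess. *)
Lemma dual_multipliers (G : 'I_n.+1 -> R) (J : R) : (forall i, 0 < G i) ->
  (forall B w a, 0 < B -> plan B w a -> (forall i, mass (a i) = G i) -> J <= plan_cost w a) ->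
  exists C : 'I_n.+1 -> R, forall B w a, 0 < B -> plan B w a ->
    J - \sum_i C i * G i <= plan_cost w a - \sum_i C i * mass (a i).
Proof.
move=> G0 HJ.
pose E (v : 'I_n.+1 -> R) (c : R) := exists B w a, [/\ 0 < B, plan B w a,
  forall i, mass (a i) = G i + v i & c = plan_cost w a - J].
have [|||C HC] := @supporting_functional _ _ E.
- move=> v1 c1 v2 c2 l [B1 [w1 [a1 [B10 P1 m1 ->]]]] [B2 [w2 [a2 [B20 P2 m2 ->]]]] l01.
  pose B := Num.max B1 B2.
  have BB1 : B1 <= B by rewrite le_max lexx.
  have BB2 : B2 <= B by rewrite le_max lexx orbT.
  have [P pc] := mix_plan l01 (plan_widen BB1 P1) (plan_widen BB2 P2).
  exists B, (mix l w1 w2), (fun i => mix l (a1 i) (a2 i)); split => //.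
  + exact: lt_le_trans BB1.
  + move=> i; rewrite mix_mass; [|exact: plan_a_rate P1|exact: plan_a_rate P2].
    by rewrite m1 m2; ring.
  + by rewrite pc; ring.
- move=> c [B [w [a [B0 P m ->]]]]; rewrite subr_ge0; apply: HJ P _ => // i.
  by rewrite m addr0.
- move=> v.
  pose i0 := [arg min_(i < ord0) G i]%O.
  have Gmin i : G i0 <= G i by rewrite /i0; case: arg_minP => // j _; exact.
  (* Small enough for every perturbed mass to remain positive. *)
  pose l := G i0 / (1 + \sum_i `|v i|).
  have S0 : 0 < 1 + \sum_i `|v i| by rewrite ltr_pwDl// sumr_ge0.
  have l0 : 0 < l by rewrite divr_gt0.
  exists l => //.
  have [|B [w [a [B0 P m]]]] := @block_plan (fun i => G i + l * v i).
    move=> i; have lv : `|l * v i| < G i.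
      apply: lt_le_trans (Gmin i); rewrite normrM (gtr0_norm l0) /l mulrAC ltr_pdivrMr//.
      by rewrite ltr_pM2l// (bigD1 i)//= addrCA ltrDl ltr_pwDl// sumr_ge0.
    by move: lv; rewrite ltr_norml => /andP[]; lra.
  by exists (plan_cost w a - J), B, w, a.
exists C => B w a B0 P.
have := HC (fun i => mass (a i) - G i) (plan_cost w a - J).
move=> /(_ _)/wrap[]; first by exists B, w, a; split => // i; rewrite addrC subrK.
under eq_bigr do rewrite mulrBr.
by rewrite sumrB; lra.
Qed.

End Plans.

(** * The competitor *)

Section Increments.
Context (R : realType).

Lemma strict_inj (z : R -> R) s t : (forall s t, s < t -> z s < z t) -> z s = z t -> s = t.
Proof.
by move=> zi E; case: (ltgtP s t) => // /zi; rewrite E ltxx.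
Qed.

(** Slope one outside [[- B, B]] makes the function onto, so that equal levels can be matched at
    every time; the values inside are kept. *)
Definition linear_outside (B : R) (z : R -> R) (t : R) :=
  z (Num.max (- B) (Num.min B t)) + (t - Num.max (- B) (Num.min B t)).

Section LinearOutside.
Variables (z : R -> R) (B : R).
Hypotheses (B_gt0 : 0 < B) (z_cont : continuous z) (z_incr : forall s t, s < t -> z s < z t).
Notation zb := (linear_outside B z).
Let BB : - B <= B. Proof. by move: B_gt0; lra. Qed.

Lemma linear_outside_in t : - B <= t <= B -> zb t = z t.
Proof.
by move=> /andP[t1 t2]; rewrite /linear_outside (min_idPr t2) (max_idPr t1) subrr addr0.
Qed.

Lemma linear_outside_right t : B <= t -> zb t = z B + (t - B).
Proof. by move=> Bt; rewrite /linear_outside (min_idPl Bt) (max_idPr BB). Qed.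

Lemma linear_outside_left t : t <= - B -> zb t = z (- B) + (t + B).
Proof.
move=> tB; rewrite /linear_outside (min_idPr (le_trans tB BB)) (max_idPl tB); lra.
Qed.

Lemma linear_outside_incr s t : s < t -> zb s < zb t.
Proof.
have znd := strict_nd z_incr.
move=> st; rewrite /linear_outside.
set a := Num.max (- B) (Num.min B s); set b := Num.max (- B) (Num.min B t).
have : a = b \/ a < b.
  have [->|ab] := eqVneq a b; first by left.
  right; rewrite lt_neqAle ab/= /a /b ge_max le_max lexx/= le_max.
  by apply/orP; right; rewrite le_min ge_min lexx/= ge_min (ltW st) orbT.
have ba : b - a <= t - s.
  move: st; rewrite /a /b /Order.min; case: (ltP B s) => s1; case: (ltP B t) => t1 st;
  do 2?[rewrite (max_idPr BB)] => //; try lra.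
  - by case: (leP (- B) s) => ?; lra.
  - by case: (leP (- B) s) => ?; case: (leP (- B) t) => ?; lra.
move=> [ab|/z_incr ab]; last lra.
by rewrite ab; lra.
Qed.

Lemma linear_outside_cont : continuous zb.
Proof.
move=> t; have c : {for t, continuous (fun t => Num.max (- B) (Num.min B t))}.
  have c' : {for t, continuous ((cst B : R -> R) \min id)}.
    by apply: continuous_min => //; exact: cst_continuous.
  by apply: (@continuous_max _ _ (cst (- B)) _ t) c'; exact: cst_continuous.
rewrite /linear_outside; apply: cvgD.
  exact: (continuous_comp c (@z_cont _)).
by apply: cvgB => //; exact: cvg_id.
Qed.

Lemma linear_outside_onto y : exists t, zb t = y.
Proof.
pose a := - B - `|y - z (- B)|; pose b := B + `|y - z B|.
have ay : zb a <= y.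
  rewrite linear_outside_left /a; last by rewrite gerBl.
  have := ler_norm (- (y - z (- B))); rewrite normrN.
  by move: `| _ | => k; lra.
have yb : y <= zb b.
  rewrite linear_outside_right /b; last by rewrite lerDl.
  have := ler_norm (y - z B).
  by move: `| _ | => k; lra.
have ab : a <= b.
  rewrite /a /b; have := normr_ge0 (y - z (- B)); have := normr_ge0 (y - z B).
  by move: `| _ | `| _ | B_gt0 => k l; lra.
have yab := le_trans ay yb.
have [|t _ <-] := IVT ab (continuous_subspaceT linear_outside_cont) (v := y); last by exists t.
by rewrite (min_idPl yab) (max_idPr yab) ay.
Qed.

End LinearOutside.
End Increments.

Section Competitor.
Context (R : realType) (f : R -> R) (rhojam L kappa : R).
Notation mu := (@lebesgue_measure R).
Notation p0 := (dflux_inv f rhojam 0).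
Notation M := (max_flux f rhojam).
Notation gam := (segment_value f rhojam).
Notation h := (flux_conj f rhojam).
Hypothesis lp : legendre_pair p0 M kappa gam h.
Hypothesis legE : forall p, legendre f rhojam p = if p0 <= p then (h p)%:E else +oo%E.
Hypothesis L_gt0 : 0 < L.
Variables (q z : R -> R) (B : R).
Hypothesis q_incr : forall s t, s < t -> q s < q t.
Hypotheses (z_cont : continuous z) (z_incr : forall s t, s < t -> z s < z t).
Hypotheses (B_gt0 : 0 < B) (qz_right : forall t, B <= t -> q t < z t)
  (qz_left : forall t, t <= - B -> q t < z t).
Notation flux w := (fun t => lax_solution f rhojam w t L).
Notation qb := (linear_outside B q).
Notation zb := (linear_outside B z).
Let BB : - B <= B. Proof. by move: B_gt0; lra. Qed.

(* A departure at time t is matched with the arrival at time T t of equal cost. *)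
Lemma level_flow : exists T : R -> R,
  [/\ forall t, zb (T t) = qb t, forall s t, s <= t -> T s <= T t & forall t, t <= - B \/ B <= t -> T t < t].
Proof.
have zi := linear_outside_incr B_gt0 z_incr; have qi := linear_outside_incr B_gt0 q_incr.
have /choice[T TE] : forall t, exists s, zb s = qb t.
  by move=> t; exact: linear_outside_onto.
exists T; split => //.
- by move=> s t st; rewrite -(strict_le zi) !TE (strict_le qi).
- move=> t tB; rewrite ltNge -(strict_le zi) -ltNge TE; case: tB => tB.
    rewrite !linear_outside_left// ltrD2r; exact: qz_left.
  by rewrite !linear_outside_right// ltrD2r; exact: qz_right.
Qed.

Section Flow.
Variable T : R -> R.
Hypotheses (T_nd : forall s t, s <= t -> T s <= T t)
  (T_lt : forall t, t <= - B \/ B <= t -> T t < t).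

(** The formula of claim (i) at x = 0, taken here as the definition of a departure rate. *)
Definition flow_rate t := gam ((T t - t) / L).
Notation wc := flow_rate.
Notation ac := (flux wc).
Notation Wc := (cum_departures wc).
Notation Ac := (cum_departures ac).

Let wc_out t : t <= - B \/ B <= t -> wc t = 0.
Proof.
move=> /T_lt Tt; rewrite /wc (lp_gam0 lp)// (le_trans _ (ltW (lp_p0 lp)))//.
by rewrite ler_pdivrMr// mul0r subr_le0 ltW.
Qed.

Lemma flow_rate_rate : rate M wc.
Proof.
have b t : 0 <= wc t <= M by have /andP[-> /ltW->] := lp_gam_bnd lp ((T t - t) / L).
have mT : measurable_fun setT T by exact: nondecreasing_measurable.
have mg : measurable_fun setT gam by apply: nondecreasing_measurable => // x y; exact: (lp_gam_nd lp).
have m : measurable_fun setT wc.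
  apply: (measurableT_comp mg); apply: measurable_funM => //; exact: measurable_funB.
split => //.
apply/integrableP; split; first by apply/measurable_EFinP.
pose v := (cst M : R -> R) \_ (`]- B, B]).
apply: (@le_lt_trans _ _ (\int[mu]_(s in `](- B)%R, B]) M%:E)%E); last first.
  rewrite integral_cst//= lebesgue_measure_itv/=; case: ifP => _; rewrite ?mule0 ?ltry//.
rewrite [leRHS]integral_mkcond; apply: ge0_le_integral => //.
- by apply: measurableT_comp => //; apply/measurable_EFinP.
- by apply/(measurable_restrictT _ _).1 => //; exact: measurable_cst.
- move=> s _; rewrite patchE mem_setE in_itv/= ger0_norm; last by have /andP[] := b s.
  case: ifPn; first by rewrite lee_fin; have /andP[] := b s.
  by rewrite negb_and -leNgt -ltNge => /orP[|/ltW] ?; rewrite wc_out//; [left|right].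
Qed.
Let rwc := flow_rate_rate.

Lemma flow_rate_carried : carried B wc.
Proof.
split.
  rewrite /cum_departures (@eq_Rintegral _ _ _ _ _ (cst 0)); first by rewrite Rintegral_cst// mul0r.
  by move=> s; rewrite inE/= in_itv/= => sB; apply: wc_out; left.
have [_ _ iwc] := rwc; rewrite (mass_split B iwc) (@eq_Rintegral _ _ _ _ _ (cst 0)).
  by rewrite Rintegral_cst// mul0r addr0.
by move=> s; rewrite inE/= in_itv/= andbT => /ltW sB; apply: wc_out; right.
Qed.

(** For the arrival time [s = T t], the Lax cost [k] has formal slope [gam ((T t' - t') / L) - gam
    ((s - t') / L)], which by monotonicity of [T] is nonpositive before [t] and nonnegative after.
    So [t] is a minimizer. *)
Lemma flow_arrival t : Ac (T t) = Wc t + L * h ((T t - t) / L).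
Proof.
set s := T t; pose k t' := Wc t' + L * h ((s - t') / L).
have sub x y : gam ((s - x) / L) * (x - y) <= L * h ((s - y) / L) - L * h ((s - x) / L).
  have := lp_subgrad lp ((s - x) / L) ((s - y) / L).
  rewrite -(ler_pM2l L_gt0) mulrDr.
  have -> : L * (gam ((s - x) / L) * ((s - y) / L - (s - x) / L)) = gam ((s - x) / L) * (x - y).
    by field; rewrite gt_eqF.
  lra.
have lip x y : x <= y -> (gam ((s - x) / L) - gam ((s - y) / L)) * (y - x) <= kappa / L * (y - x) * (y - x).
  move=> xy; rewrite ler_wpM2r ?subr_ge0//.
  have -> : kappa / L * (y - x) = kappa * ((s - x) / L - (s - y) / L) by field; rewrite gt_eqF.
  by apply: (lp_gam_lip lp); rewrite ler_pM2r ?invr_gt0// lerB.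
have slope x y : x <= y -> gam ((s - y) / L) <= gam ((s - x) / L).
  by move=> xy; apply: (lp_gam_nd lp); rewrite ler_pM2r ?invr_gt0// lerB.
have mI x y : mu.-integrable `]x, y] (EFin \o wc) by exact: rate_int rwc _ _.
have kmin t' : k t <= k t'.
  have [tt|/ltW tt] := leP t t'.
    apply: (quadratic_increments_nd (m := id) (K := kappa / L) tt) => x y tx xy yt.
    have : gam ((s - y) / L) * (y - x) <= Wc y - Wc x.
      rewrite (cumB rwc xy); apply: Rintegral_ge_cst => // r /andP[xr ry].
      apply: le_trans (slope _ _ ry) _; apply: (lp_gam_nd lp).
      by rewrite ler_pM2r ?invr_gt0// lerB// T_nd// (le_trans tx) ?ltW.
    have := sub x y; have := lip x y xy; rewrite /k.
    move: (gam _) (gam _) (L * h _) (L * h _) (Wc x) (Wc y) (kappa / L * _ * _) => g1 g2 h1 h2 w1 w2 e.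
    lra.
  rewrite -lerN2; apply: (quadratic_increments_nd (D := fun t => - k t) (m := id) (K := kappa / L) tt) => x y tx xy yt.
  have : Wc y - Wc x <= gam ((s - x) / L) * (y - x).
    rewrite (cumB rwc xy); apply: Rintegral_le_cst => // r /andP[xr ry].
    apply: le_trans (slope _ _ (ltW xr)); apply: (lp_gam_nd lp).
    by rewrite ler_pM2r ?invr_gt0// lerB// T_nd// (le_trans ry).
  have := sub y x; have := lip x y xy; rewrite /k.
  move: (gam _) (gam _) (L * h _) (L * h _) (Wc x) (Wc y) (kappa / L * _ * _) => g1 g2 h1 h2 w1 w2 e.
  lra.
apply/eqP; rewrite eq_le; apply/andP; split.
  by rewrite addrC; exact: (cum_arrival_le lp legE rwc L_gt0 s t).
have [tau ->] := cum_arrivalE lp legE rwc L_gt0 s.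
by rewrite [leRHS]addrC; exact: kmin.
Qed.

End Flow.

Section FlowFacts.
Variables (T Wc Ac : R -> R) (Gc : R).
Hypotheses (TE : forall t, zb (T t) = qb t) (T_lt : forall t, t <= - B \/ B <= t -> T t < t).
Hypotheses (Wc_nd : forall s t, s <= t -> Wc s <= Wc t) (Ac_nd : forall s t, s <= t -> Ac s <= Ac t).
Hypotheses (Wc_ge0 : forall t, 0 <= Wc t) (Ac_ge0 : forall t, 0 <= Ac t).
Hypotheses (Wc_le : forall t, Wc t <= Gc) (Ac_le : forall t, Ac t <= Gc).
Hypotheses (WcNB : Wc (- B) = 0) (WcB : Wc B = Gc) (Ac_late : forall s, Ac s <= Wc (s - L * p0)).
Hypothesis AcT : forall t, Ac (T t) = Wc t + L * h ((T t - t) / L).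

Let Wc_left t : t <= - B -> Wc t = 0.
Proof. by move=> tB; apply/eqP; rewrite eq_le Wc_ge0 andbT -WcNB Wc_nd. Qed.

Let Wc_right t : B <= t -> Wc t = Gc.
Proof. by move=> tB; apply/eqP; rewrite eq_le Wc_le/= -WcB Wc_nd. Qed.

Let h_neg s t : s <= t -> h ((s - t) / L) = 0.
Proof.
move=> st; rewrite (lp_h0 lp)// (le_trans _ (ltW (lp_p0 lp)))//.
by rewrite ler_pdivrMr// mul0r subr_le0.
Qed.

Let Ac_left s : s <= - B -> Ac s = 0.
Proof.
move=> sB; apply/eqP; rewrite eq_le Ac_ge0 andbT.
apply: le_trans (Ac_late _) _; rewrite Wc_left//.
by apply: le_trans sB; rewrite gerBl mulr_ge0// ltW// (lp_p0 lp).
Qed.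

Let Ac_TB : Ac (T B) = Gc.
Proof.
have TB : T B < B by apply: T_lt; right.
by rewrite AcT Wc_right// h_neg ?mulr0 ?addr0// ltW.
Qed.

Lemma flow_arrival_full s : q B <= z s -> Ac s = Gc.
Proof.
have zi := linear_outside_incr B_gt0 z_incr; move=> qs.
have qbB : qb B = q B by rewrite linear_outside_in// BB lexx.
have TBs : T B <= s -> Ac s = Gc.
  by move=> le; apply/eqP; rewrite eq_le Ac_le/= -Ac_TB Ac_nd.
have [Bs|sB] := leP B s; first by apply: TBs; apply: le_trans Bs; apply/ltW/T_lt; right.
have [Bs|/ltW Bs] := leP (- B) s.
  by apply: TBs; rewrite -(strict_le zi) TE qbB linear_outside_in// Bs ltW.
have TBB : T B <= - B.
  rewrite -(strict_le zi) TE qbB linear_outside_in ?lexx ?BB//.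
  by apply: le_trans qs _; exact: strict_nd z_incr _ _ Bs.
(* Degenerate case: the last arrival precedes [- B], so the flow carries no mass. *)
by rewrite Ac_left// -Ac_TB Ac_left.
Qed.

(** Within [[- B, B]] this is [AcT]. A pair with [s <= - B] lies where nothing has arrived; then
    [AcT] forces [Wc t = 0] as well, and both sides vanish. *)
Lemma flow_level s t : t <= B -> z s = q t -> Ac s - Wc t = L * h ((s - t) / L).
Proof.
have zi := linear_outside_incr B_gt0 z_incr; move=> tB zq.
have qnd := strict_nd q_incr; have znd := strict_le z_incr.
have sB : s <= B by rewrite -znd zq; apply: le_trans (qnd _ _ tB) _; exact/ltW/qz_right.
have [Bt|/ltW Bt] := leP (- B) t; last first.
  have st : s <= t by rewrite -znd zq; exact/ltW/qz_left.
  by rewrite h_neg// mulr0 Ac_left ?Wc_left ?subrr// (le_trans st).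
have qbE : qb t = q t by rewrite linear_outside_in ?Bt.
have [Bs|/ltW Bs] := leP (- B) s.
  have <- : T t = s.
    by apply: (strict_inj zi); rewrite TE qbE linear_outside_in ?Bs.
  by rewrite AcT addrC addKr.
have Tt : T t <= - B.
  rewrite -(strict_le zi) TE qbE linear_outside_in ?lexx ?BB//.
  by rewrite -zq znd.
have := AcT t; rewrite Ac_left// => /esym/eqP.
rewrite paddr_eq0 ?Wc_ge0 ?mulr_ge0 ?(lp_h_ge0 lp) ?ltW// => /andP[/eqP-> _].
by rewrite Ac_left// h_neg ?mulr0 ?subrr// (le_trans Bs).
Qed.

Lemma flow_below t : t <= B -> (forall s, q t < z s) -> Wc t = 0.
Proof.
have zi := linear_outside_incr B_gt0 z_incr; move=> tB qz.
have [Bt|/ltW Bt] := leP (- B) t; last exact: Wc_left.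
have Tt : T t <= - B.
  rewrite -(strict_le zi) TE !linear_outside_in ?lexx ?BB ?Bt//; exact/ltW/qz.
have := AcT t; rewrite Ac_left// => /esym/eqP.
by rewrite paddr_eq0 ?Wc_ge0 ?mulr_ge0 ?(lp_h_ge0 lp) ?ltW// => /andP[/eqP-> _].
Qed.

End FlowFacts.

Lemma competitor : exists w, let a := flux w in
  [/\ rate M w, carried B w, carried B a & forall s, q B <= z s -> cum_departures a s = mass w] /\
  [/\ forall s t, t <= B -> z s = q t ->
      cum_departures a s - cum_departures w t = L * h ((s - t) / L) &
    forall t, t <= B -> (forall s, q t < z s) -> cum_departures w t = 0].
Proof.
have [T [TE T_nd T_lt]] := level_flow.
have rwc := flow_rate_rate T_nd T_lt; have [c1 c2] := flow_rate_carried T_nd T_lt.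
have AcT := flow_arrival T_nd T_lt.
have [rac _] := arrival_rate lp legE rwc L_gt0.
have ma := mass_arrival lp legE rwc L_gt0.
have late := cum_arrival_late lp legE rwc L_gt0.
have Wc_nd := cum_nd rwc; have Ac_nd := cum_nd rac.
have Wc0 := cum_ge0 rwc; have Ac0 := cum_ge0 rac.
have Wc_le := cum_le_mass rwc; have Ac_le := cum_le_mass rac; rewrite ma in Ac_le.
exists (flow_rate T).
have full := flow_arrival_full TE T_lt Wc_nd Ac_nd Wc0 Ac0 Wc_le Ac_le c1 c2 late AcT.
split; split => //.
- split; last by rewrite ma; apply: full; exact/ltW/qz_right.
  apply/eqP; rewrite eq_le Ac0 andbT; apply: le_trans (late _) _; rewrite -[X in _ <= X]c1.
  by apply: Wc_nd; rewrite gerBl mulr_ge0// ltW// (lp_p0 lp).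
- exact: (flow_level TE Wc_nd Wc0 Ac0 c1 late AcT).
- exact: (flow_below TE Wc_nd Wc0 Ac0 c1 late AcT).
Qed.

End Competitor.

(** * Lower bound *)

(** Applied to the number of drivers on the road. Either it vanishes at arbitrarily late times,
    which serve as [X], or it is positive from some time on and tends to 0, so its minima over
    longer and longer intervals move off to infinity. [B] is fixed before [X], as the surviving
    boundary term involves only [q B]. *)
Lemma record_low (R : realType) (I : R -> R) (B0 : R) : continuous I -> (forall t, 0 <= I t) ->
  (forall e, 0 < e -> exists Y, forall t, Y <= t -> I t < e) ->
  exists2 B, B0 <= B & forall Y, exists X, [/\ Y <= X, B <= X &
    forall t, B <= t -> t <= X -> I X <= I t].
Proof.
move=> Ic I0 Iinf; have [H|] := pselect (forall Y, exists2 X, Y <= X & I X = 0).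
  exists B0 => // Y; have [X YX IX] := H (Num.max Y B0); exists X.
  by move: YX; rewrite ge_max => /andP[-> ->]; split => // t _ _; rewrite IX.
move=> /existsNP[Y0 HY0].
have Ipos t : Y0 <= t -> 0 < I t.
  move=> Yt; rewrite lt_neqAle I0 andbT; apply/eqP => E; apply: HY0.
  by exists t.
pose B := Num.max Y0 B0; exists B => [|Y]; first by rewrite le_max lexx orbT.
pose Y1 := Num.max B Y.
have BY1 : B <= Y1 by rewrite le_max lexx.
have [c cI cmin] := EVT_min BY1 (continuous_subspaceT Ic).
have Ic0 : 0 < I c.
  by apply: Ipos; move: cI; rewrite in_itv/= => /andP[+ _]; apply: le_trans; rewrite le_max lexx.
have [Z0 HZ] := Iinf _ Ic0; pose Z := Num.max Z0 Y1.
have IZ : I Z < I c by apply: HZ; rewrite le_max lexx.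
have Y1Z : Y1 <= Z by rewrite le_max lexx orbT.
have BZ : B <= Z by exact: le_trans Y1Z.
have [X XI Xmin] := EVT_min BZ (continuous_subspaceT Ic).
move: (XI); rewrite in_itv/= => /andP[BX XZ].
have YX : Y1 <= X.
  rewrite leNgt; apply/negP => XY.
  have : I c <= I X by apply: cmin; rewrite in_itv/= BX ltW.
  have : I X <= I Z by apply: Xmin; rewrite in_itv/= BZ lexx.
  by move=> /le_lt_trans/(_ IZ); rewrite ltNge => /negP.
exists X; split => //; first by apply: le_trans YX; rewrite le_max lexx orbT.
by move=> t Bt tX; apply: Xmin; rewrite in_itv/= Bt (le_trans tX).
Qed.

Section LowerBound.
Context (R : realType).
Notation mu := (@lebesgue_measure R).
Variables (M : R) (k : R -> R).
Variables (q z w a wc ac : R -> R) (B X : R).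
Hypotheses (q_cont : continuous q) (q_incr : forall s t, s < t -> q s < q t).
Hypotheses (z_cont : continuous z) (z_incr : forall s t, s < t -> z s < z t).
Hypotheses (qz_right : forall t, B <= t -> q t < z t)
  (qz_left : forall t, t <= - B -> q t < z t).
Hypotheses (rw : rate M w) (ra : rate M a) (rwc : rate M wc) (rac : rate M ac).
Notation W := (cum_departures w).
Notation A := (cum_departures a).
Notation Wc := (cum_departures wc).
Notation Ac := (cum_departures ac).
Hypothesis lax : forall s t, A s <= k (s - t) + W t.
Hypotheses (cwc : carried B wc) (cac : carried B ac)
  (Ac_full : forall s, q B <= z s -> Ac s = mass wc)
  (level : forall s t, t <= B -> z s = q t -> Ac s - Wc t = k (s - t))
  (below : forall t, t <= B -> (forall s, q t < z s) -> Wc t = 0).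
Hypotheses (BX : B <= X) (low : forall t, B <= t -> t <= X -> W X - A X <= W t - A t).
Hypotheses (iw : mu.-integrable `]-oo, X] (EFin \o (fun s => q s * w s)))
  (ia : mu.-integrable `]-oo, X] (EFin \o (fun s => z s * a s))).

Let gain y := (sublevel_mass q w y - sublevel_mass z a y)
  - (sublevel_mass q wc y - sublevel_mass z ac y).

Let qzB : q B < z B. Proof. exact: qz_right. Qed.
Let qnd := strict_nd q_incr.
Let znd := strict_nd z_incr.

Let below_all (x : R -> R) y T : (forall s t, s <= t -> x s <= x t) ->
  (forall s, s <= T -> y < x s) -> forall s, y < x s.
Proof.
move=> xnd xT s; have [/xT//|/ltW Ts] := leP s T.
by apply: lt_le_trans (xT T (lexx _)) _; exact: xnd.
Qed.

Lemma gain_level s t : t <= B -> z s = q t -> gain (q t) = k (s - t) - (A s - W t).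
Proof.
move=> tB zq; rewrite /gain -[in sublevel_mass z a _]zq -[in sublevel_mass z ac _]zq.
by rewrite !sublevel_mass_cum// -(level tB zq); ring.
Qed.

Lemma gain_below t : t <= B -> (forall s, q t < z s) -> gain (q t) = W t.
Proof.
move=> tB H; rewrite /gain !sublevel_mass_cum// !(sublevel_mass_below _ H) below//.
by rewrite !subr0.
Qed.

(** A level under the range of [q] is also under the range of [z], since [q] lies below [z] near
    -oo; such levels contribute nothing. *)
Lemma gain_cases y : y <= q B -> gain y = 0 \/ exists t, [/\ t <= B, q t = y &
  (exists2 s, z s = q t & gain y = k (s - t) - (A s - W t)) \/
  (forall s, q t < z s) /\ gain y = W t].
Proof.
move=> yB; have yzB : y <= z B by exact: le_trans yB (ltW qzB).
have [[t tB qt]|Hq] := level_cases q_cont yB.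
  right; exists t; split => //; have [[s sB zs]|Hz] := level_cases z_cont yzB.
    have zq : z s = q t by rewrite zs.
    by left; exists s => //; rewrite -qt (gain_level tB zq).
  have Hz' s : q t < z s by rewrite qt; exact: below_all znd Hz s.
  by right; rewrite -qt gain_below.
have Hq' := below_all qnd Hq.
left; have [[s sB zs]|Hz] := level_cases z_cont yzB; last first.
  by rewrite /gain !(sublevel_mass_below _ Hq') !(sublevel_mass_below _ (below_all znd Hz)) !subrr.
pose t := Num.min s (- B).
have /qz_left qt : t <= - B by rewrite ge_min lexx orbT.
have /znd tz : t <= s by rewrite ge_min lexx.
by have := lt_le_trans qt tz; rewrite zs ltNge => /negP[]; exact/ltW/Hq'.
Qed.

(** Past [B] the competitor has finished departing and arriving, so the gain is at least the number
    [W t - A t] of drivers on the road, which is smallest at [X]. *)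
Lemma gain_past y : q B < y -> y <= q X -> W X - A X <= gain y.
Proof.
move=> By yX; have [[t tX qt]|] := level_cases q_cont yX; last first.
  by move=> /(_ B BX); rewrite ltNge ltW.
have Bt : B <= t by rewrite -(strict_le q_incr) qt ltW.
apply: le_trans (low Bt tX) _.
have -> : gain y = (W t - sublevel_mass z a y) - (Wc t - sublevel_mass z ac y).
  by rewrite /gain -qt !(sublevel_mass_cum _ q_incr).
have WcG : Wc t = mass wc.
  apply/eqP; rewrite eq_le (cum_le_mass rwc)/=; have [_ <-] := cwc; exact: cum_nd rwc _ _ Bt.
have yz : y <= z X by apply: le_trans yX _; apply/ltW/qz_right.
suff [-> le] : sublevel_mass z ac y = mass wc /\ sublevel_mass z a y <= A t.
  by rewrite WcG subrr subr0 lerB.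
have [[s _ zs]|Hz] := level_cases z_cont yz.
  rewrite -zs (sublevel_mass_cum ac z_incr) (sublevel_mass_cum a z_incr); split.
    by apply: Ac_full; rewrite zs ltW.
  apply: (cum_nd ra); rewrite -(strict_le z_incr) zs -qt; exact/ltW/qz_right.
have Hz' := below_all znd Hz.
rewrite !(sublevel_mass_below _ Hz'); split; last exact: cum_ge0 ra t.
rewrite -(Ac_full (s := - B)); first by have [-> _] := cac.
by rewrite ltW// (lt_trans By).
Qed.

Lemma late_full y : q X < y -> y <= z X -> sublevel_mass z ac y = mass wc.
Proof.
move=> Xy yX; have By : q B < y by apply: le_lt_trans Xy; exact: qnd.
have [[s _ zs]|Hz] := level_cases z_cont yX.
  by rewrite -zs (sublevel_mass_cum _ z_incr)// Ac_full// zs ltW.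
rewrite (sublevel_mass_below _ (below_all znd Hz)) -(Ac_full (s := - B)).
  by have [-> _] := cac.
by rewrite ltW// (lt_trans By)// (below_all znd Hz).
Qed.

(** Every failure of equality in the Lax inequality, over the levels from [q t1] to [q t2], adds to
    the cost in excess of the competitor's. *)
Lemma travel_slack (t1 t2 delta : R) : t1 <= t2 -> t2 <= B ->
  (forall s t, t1 < t -> t <= t2 -> z s = q t -> delta <= k (s - t) - (A s - W t)) ->
  (forall t, t1 < t -> t <= t2 -> (forall s, q t < z s) -> delta <= W t) ->
  mass (fun s => z s * ac s) - mass (fun s => q s * wc s)
    + delta * (q t2 - q t1) - (W X - A X) * q B <= travel_cost q z X w a.
Proof.
move=> t12 t2B H1 H2.
have cwX := carried_widen rwc BX cwc; have caX := carried_widen rac BX cac.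
have mE : mass ac = mass wc.
  by have [_ <-] := cac; apply: Ac_full; exact: ltW.
rewrite (carried_Rintegral rac znd caX) (carried_Rintegral rwc qnd cwX).
have iT (x v : R -> R) : (forall s t, s <= t -> x s <= x t) -> rate M v -> carried X v ->
    mu.-integrable `]-oo, X] (EFin \o (fun s => x s * v s)).
  by move=> xnd rv cv; apply: lebesgue_integrableS (carried_integrable rv xnd cv).
apply: (@travel_cost_lower_bound _ q z w a wc ac M X B (mass wc) (q t1) (q t2) delta) => //.
- exact: iT.
- exact: iT.
- exact/ltW/qz_right.
- by have [_ ->] := cwX.
- by have [_ ->] := caX.
- exact: late_full.
- move=> y yB; change (0 <= gain y); have [->//|[t [tB <- [[s zs ->]|[_ ->]]]]] := gain_cases yB.
    by have := lax s t; rewrite subr_ge0 lerBlDr.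
  exact: cum_ge0 rw t.
- move=> y y1 y2; change (delta <= gain y).
  have [t [t1t tt2 qt]] : exists t, [/\ t1 < t, t <= t2 & q t = y].
    have [|t tI qt] := IVT t12 (continuous_subspaceT q_cont) (v := y).
      by rewrite (min_idPl (qnd t12)) (max_idPr (qnd t12)) ltW.
    exists t; move: tI; rewrite in_itv/= => /andP[t1t ->]; split => //.
    by rewrite lt_neqAle t1t andbT; apply: contraTneq y1 => ->; rewrite qt ltxx.
  have tB := le_trans tt2 t2B.
  rewrite -qt; have [H|] := pselect (forall s, q t < z s); first by rewrite gain_below// H2.
  have tzB : q t <= z B by apply: le_trans (ltW qzB); exact: qnd.
  have [[s _ zs] _|Hz []] := level_cases z_cont tzB; last exact: below_all znd Hz.
  by rewrite (gain_level tB zs) H1.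
- exact: qnd.
- exact: qnd.
- by move=> y; exact: gain_past.
Qed.

End LowerBound.

(** * Minimum of the shifted arrival costs *)

Section ShiftedMin.
Context (R : realType) (n : nat) (psi : 'I_n.+1 -> R -> R) (C : 'I_n.+1 -> R).
Notation z := (shifted_min psi C).

Lemma shifted_min_le i s : z s <= psi i s - C i.
Proof.
rewrite /shifted_min; elim: (index_enum _) (mem_index_enum i) => //= j r IH.
by rewrite inE big_cons ge_min => /predU1P[->|/IH ->]; rewrite ?lexx ?orbT.
Qed.

Lemma shifted_min_attained s : exists i, z s = psi i s - C i.
Proof.
rewrite /shifted_min; elim: (index_enum _) => [|j r [i IH]]; first by exists ord0; rewrite big_nil.
by rewrite big_cons IH; case: leP => _; [exists j|exists i].
Qed.

Lemma shifted_min_cont : (forall i, continuous (psi i)) -> continuous z.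
Proof.
move=> pc; have c i : continuous (fun s => psi i s - C i).
  by move=> s; apply: cvgB; [exact: pc|exact: cvg_cst].
rewrite /shifted_min; elim: (index_enum _) => [|j r IH] s.
  by under eq_fun do rewrite big_nil; exact: c.
under eq_fun do rewrite big_cons.
by have := @continuous_min _ _ _ _ s (c j s) (IH s).
Qed.

Lemma shifted_min_incr : (forall i s t, s < t -> psi i s < psi i t) ->
  forall s t, s < t -> z s < z t.
Proof.
move=> pi s t st; have [i ->] := shifted_min_attained t.
by apply: le_lt_trans (shifted_min_le i s) _; rewrite ltrD2r; exact: pi.
Qed.

Hypothesis psi_cont : forall i, continuous (psi i).

Definition active i s : R := if psi i s - C i <= z s then 1 else 0.
Definition share i s : R := active i s / \sum_j active j s.

Lemma active_sum_gt0 s : 0 < \sum_j active j s.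
Proof.
have [i iE] := shifted_min_attained s; rewrite (bigD1 i)//= ltr_pwDl ?sumr_ge0//.
  by rewrite /active iE lexx.
by move=> j _; rewrite /active; case: ifP.
Qed.

Lemma share_sum s : \sum_i share i s = 1.
Proof. by rewrite -mulr_suml divff// gt_eqF// active_sum_gt0. Qed.

Lemma share01 i s : 0 <= share i s <= 1.
Proof.
have sh0 j : 0 <= share j s by rewrite divr_ge0 ?(ltW (active_sum_gt0 _))// /active; case: ifP.
by rewrite sh0 -(share_sum s) (bigD1 i)//= lerDl sumr_ge0.
Qed.

Lemma share_active i s : share i s * (psi i s - C i) = share i s * z s.
Proof.
rewrite /share /active; case: (leP (psi i s - C i) (z s)) => [le|_]; last by rewrite !mul0r.
by congr (_ * _); apply/eqP; rewrite eq_le le shifted_min_le.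
Qed.

Lemma share_measurable i : measurable_fun setT (share i).
Proof.
have zc := shifted_min_cont psi_cont.
have mp j : measurable_fun setT (psi j) by exact: continuous_measurable_fun.
have mz : measurable_fun setT z by exact: continuous_measurable_fun.
have ma j : measurable_fun setT (active j).
  apply: measurable_fun_ifT => //; apply: measurable_fun_ler => //.
  by apply: measurable_funB.
apply: measurable_funM => //; apply: (measurableT_comp (@measurable_invr R)).
by apply: measurable_sum.
Qed.

End ShiftedMin.

(** * Slackness of the optimum *)

(** [v] is a supposed positive slack; the truncation of the integrals and the boundary term [m]
    consume at most a quarter of it each. *)
Lemma slack_algebra (R : realFieldType) (v r r0 s c d o m g : R) : 0 < v -> v = r0 + g ->
  m <= v / 4 -> 0 <= s -> r0 <= r -> r + s + c < o + v / 4 -> o <= d -> d + g - m <= c -> False.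
Proof. lra. Qed.

Section TruncatedIntegrals.
Context (R : realType).
Notation mu := (@lebesgue_measure R).

Lemma integral_tail (F : R -> R) : mu.-integrable setT (EFin \o F) ->
  forall e, 0 < e -> exists Y, forall X, Y <= X ->
    `|\int[mu]_(s in `]-oo, X]) F s - \int[mu]_s F s| < e.
Proof.
move=> iF e e0; have mI (i : interval R) : measurable [set` i] by exact: measurable_itv.
have iN := integrable_norm iF.
have iNS (i : interval R) : mu.-integrable [set` i] (EFin \o (fun s => `|F s|)).
  exact: lebesgue_integrableS iN.
have [B B0] := mass_concentrated iN (fun=> normr_ge0 _) e0.
rewrite ltrBlDr -ltrBlDl => HB; exists B => X BX; rewrite -/(mass F) (mass_split X iF).
rewrite -/(cum_departures F X) opprD addrA subrr add0r normrN.
have iS : mu.-integrable `]X, +oo[ (EFin \o F) by exact: lebesgue_integrableS iF.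
apply: le_lt_trans (le_normr_Rintegral _ iS) _ => //; apply: le_lt_trans HB.
rewrite (mass_split X iN) lerBrDl lerD2r.
apply: le_Rintegral_subset => // x /=; last by rewrite normr_ge0.
by rewrite !in_itv/= => /andP[_ xB]; exact: le_trans BX.
Qed.

Lemma bounded_rate_integrable (M X K : R) (x v : R -> R) : rate M v -> measurable_fun setT x ->
  (forall s, s <= X -> `|x s| <= K) ->
  mu.-integrable `]-oo, X] (EFin \o (fun s => x s * v s)).
Proof.
move=> rv mx xK; have mI : measurable (`]-oo, X] : set R) by exact: measurable_itv.
have [mv v01 _] := rv.
have iK : mu.-integrable `]-oo, X] (EFin \o (fun s => K * v s)).
  by apply: integrableZ_real => //; exact: rate_int rv _ mI.
apply: le_integrable iK => //.
  by apply/measurable_EFinP; apply: measurable_funTS; exact: measurable_funM.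
move=> s /=; rewrite in_itv/= => sX; have /andP[v0 _] := v01 s.
rewrite lee_fin !normrM ler_wpM2r//; apply: le_trans (xK _ sX) _; exact: ler_norm.
Qed.

Lemma carried_le (M B : R) (v v' : R -> R) : rate M v -> rate M v' ->
  (forall s, v s <= v' s) -> carried B v' -> carried B v.
Proof.
move=> rv rv' le [c1 c2]; have mI (i : interval R) : measurable [set` i] by exact: measurable_itv.
have leI (i : interval R) : \int[mu]_(s in [set` i]) v s <= \int[mu]_(s in [set` i]) v' s.
  by apply: le_Rintegral => //; [exact: rate_int rv _ (mI i)|exact: rate_int rv' _ (mI i)].
split; apply/eqP; rewrite eq_le.
  by rewrite (cum_ge0 rv) andbT -c1; exact: leI.
have [[_ _ iv] [_ _ iv']] := (rv, rv').
rewrite (cum_le_mass rv)/= (mass_split B iv) gerDl.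
apply: le_trans (leI _) _; move: c2; rewrite (mass_split B iv') => /eqP.
by rewrite -[X in X == _]addr0 (inj_eq (addrI _)) => /eqP <-.
Qed.

End TruncatedIntegrals.

Section Optimality.
Context (R : realType) (f : R -> R) (rhojam L kappa : R).
Notation mu := (@lebesgue_measure R).
Notation p0 := (dflux_inv f rhojam 0).
Notation M := (max_flux f rhojam).
Notation gam := (segment_value f rhojam).
Notation h := (flux_conj f rhojam).
Notation flux w := (fun t => lax_solution f rhojam w t L).
Hypothesis lp : legendre_pair p0 M kappa gam h.
Hypothesis legE : forall p, legendre f rhojam p = if p0 <= p then (h p)%:E else +oo%E.
Hypothesis L_gt0 : 0 < L.
Variables (n : nat) (q : R -> R) (psi : 'I_n.+1 -> R -> R).
Hypotheses (q_cont : continuous q) (q_incr : forall s t, s < t -> q s < q t).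
Hypotheses (psi_cont : forall i, continuous (psi i))
  (psi_incr : forall i s t, s < t -> psi i s < psi i t) (psi_pos : forall i s, 0 < psi i s).

Section Multipliers.
Variable C : 'I_n.+1 -> R.
Notation z := (shifted_min psi C).
Let z_cont := @shifted_min_cont R n psi C psi_cont.
Let z_incr := @shifted_min_incr R n psi C psi_incr.
Let mz : measurable_fun setT z. Proof. exact: continuous_measurable_fun. Qed.
Let mpsi i : measurable_fun setT (psi i). Proof. exact: continuous_measurable_fun. Qed.

(** Distributing the arrivals of the competitor by [share] turns it into a plan whose cost net of
    multipliers is its cost for the single arrival cost [z]. *)
Lemma competitor_plan (B : R) : 0 < B -> (forall t, B <= t -> q t < z t) ->
  (forall t, t <= - B -> q t < z t) ->
  exists w, let a := flux w in
  [/\ rate M w, carried B w, carried B a & forall s, q B <= z s -> cum_departures a s = mass w] /\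
  [/\ forall s t, t <= B -> z s = q t ->
      cum_departures a s - cum_departures w t = L * h ((s - t) / L),
    forall t, t <= B -> (forall s, q t < z s) -> cum_departures w t = 0 &
    exists2 ai : 'I_n.+1 -> R -> R, plan f rhojam L B w ai &
      plan_cost q psi w ai - \sum_i C i * mass (ai i) =
        mass (fun s => z s * a s) - mass (fun s => q s * w s)].
Proof.
move=> B0 qz1 qz2.
have [w [[rw cw ca full] [lev bel]]] := competitor lp legE L_gt0 q_incr z_cont z_incr B0 qz1 qz2.
exists w; split => //; split => //.
set a := flux w in ca full lev *.
have [ra _] : rate M a /\ _ := arrival_rate lp legE rw L_gt0.
have [ma a01 _] := ra.
pose ai i s := share psi C i s * a s.
have rai i : rate M (ai i).
  have m : measurable_fun setT (ai i) by apply: measurable_funM => //; exact: share_measurable.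
  have b s : 0 <= ai i s <= a s.
    have /andP[s0 s1] := share01 psi C i s; have /andP[a0 _] := a01 s.
    by rewrite mulr_ge0//= ler_piMl.
  split => //.
    by move=> s; have /andP[-> /le_trans->//] := b s; have /andP[] := a01 s.
  have [_ _ ia] := ra; apply: le_integrable ia => //; first exact/measurable_EFinP.
  move=> s _; have /andP[s0 s1] := b s.
  by rewrite lee_fin !ger0_norm// (le_trans s0).
have ai_le i s : ai i s <= a s.
  have /andP[_ s1] := share01 psi C i s; have /andP[a0 _] := a01 s.
  by rewrite /ai ler_piMl.
have cai i : carried B (ai i) by apply: carried_le (rai i) ra _ ca.
have tot : total_rate ai = a.
  by apply/funext => s; rewrite /total_rate -mulr_suml share_sum mul1r.
exists ai.
  split => //.
  - by move=> i; case: (rai i).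
  - by move=> i t; have [_ /(_ t)/andP[]] := rai i.
  - by rewrite tot.
  - by rewrite tot; exact: (mass_arrival lp legE rw L_gt0).
  - by move=> s t; rewrite tot; exact: (cum_arrival_le lp legE rw L_gt0 s t).
have znd := strict_nd z_incr.
have ip i := carried_integrable (rai i) (strict_nd (psi_incr i)) (cai i).
have iz i := carried_integrable (rai i) znd (cai i).
have ic i : mu.-integrable setT (EFin \o (fun s => C i * ai i s)).
  by apply: integrableZ_real => //; have [] := rai i.
have E i : mass (fun s => psi i s * ai i s) - C i * mass (ai i) = mass (fun s => z s * ai i s).
  have -> : C i * mass (ai i) = mass (fun s => C i * ai i s).
    by rewrite /mass RintegralZl//; have [] := rai i.
  rewrite /mass -RintegralB//; apply: eq_Rintegral => s _.
  have sa := share_active psi C i s.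
  transitivity (share psi C i s * (psi i s - C i) * a s); first by rewrite /ai; ring.
  by rewrite sa /ai; ring.
rewrite /plan_cost addrAC; congr (_ - _).
rewrite -sumrB (eq_bigr _ (fun i _ => E i)).
have [_ <-] := Rintegral_sum_ord measurableT iz.
apply: eq_Rintegral => s _; rewrite -mulr_sumr; congr (_ * _).
by rewrite -[RHS](congr1 (@^~ s) tot).
Qed.

End Multipliers.

Section Optimum.
Variables (G : 'I_n.+1 -> R) (ub : 'I_n.+1 -> R -> R).
Hypothesis G_gt0 : forall i, 0 < G i.
Notation phis := (fun (_ : 'I_n.+1) (t : R) => (- q t)%R).
Hypothesis ub_opt : optimal f rhojam L phis psi G ub.
Notation w := (total_rate ub).
Notation W := (cum_departures w).
Notation u := (flux w).
Notation U := (cum_departures u).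
Notation ui i := (fun s => group_flux f rhojam ub i s L).
Notation cd := (cost_density f rhojam L phis psi ub).

Lemma optimal_rates : [/\ forall i, measurable_fun setT (ub i), forall i t, 0 <= ub i t, rate M w &
  forall i, mass (ub i) = G i].
Proof.
have [[mub ub0 Gub ubM] _ _] := ub_opt.
have iub i : mu.-integrable setT (EFin \o ub i).
  apply/integrableP; split; first by apply/measurable_EFinP; exact: mub.
  under eq_integral do rewrite /= ger0_norm//.
  by rewrite Gub ltry.
split => //.
  split.
  - exact: measurable_sum.
  - by move=> t; rewrite ubM andbT sumr_ge0.
  - by have [] := Rintegral_sum_ord measurableT iub.
by move=> i; rewrite /mass /Rintegral Gub.
Qed.

Let mub i : measurable_fun setT (ub i). Proof. by have [] := optimal_rates. Qed.
Let ub0 i t : 0 <= ub i t. Proof. by have [] := optimal_rates. Qed.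
Let rw : rate M w. Proof. by have [] := optimal_rates. Qed.
Let mG i : mass (ub i) = G i. Proof. by have [] := optimal_rates. Qed.
Let ru : rate M u. Proof. by have [] := arrival_rate lp legE rw L_gt0. Qed.
Let rui i : rate M (ui i). Proof. exact: (group_flux_rate lp legE mub ub0 rw L_gt0). Qed.
Let mui i : mass (ui i) = G i.
Proof. by rewrite (mass_group_flux lp legE mub ub0 rw L_gt0) mG. Qed.
Let icd i : mu.-integrable setT (EFin \o cd i). Proof. by have [_ hc _] := ub_opt; exact: hc. Qed.

Definition optimal_value : R := \sum_i \int[mu]_s cd i s.

(** Realignment bounds the cost of every plan with masses [G] from below by the optimal value, which
    is all the duality needs. *)
Lemma optimal_multipliers : exists C : 'I_n.+1 -> R, forall B v a, 0 < B -> plan f rhojam L B v a ->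
  optimal_value - \sum_i C i * G i <= plan_cost q psi v a - \sum_i C i * mass (a i).
Proof.
apply: (dual_multipliers lp L_gt0 q_incr psi_incr G_gt0) => B v a B0 P aG.
have [vb [adm hc le]] := realign_cost lp legE L_gt0 q_incr psi_cont psi_incr B0 P aG.
have [_ _ /(_ vb adm hc) opt] := ub_opt.
rewrite -lee_fin; apply: le_trans le; apply: le_trans opt.
rewrite /optimal_value -sumEFin /total_cost le_eqVlt; apply/orP; left; apply/eqP.
by apply: eq_bigr => i _; rewrite fineK//; apply: integrable_fin_num => //; exact: icd.
Qed.

Section Slack.
Variables (C : 'I_n.+1 -> R) (B0 : R).
Notation z := (shifted_min psi C).
Hypothesis C_mult : forall B v a, 0 < B -> plan f rhojam L B v a ->
  optimal_value - \sum_i C i * G i <= plan_cost q psi v a - \sum_i C i * mass (a i).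
Hypotheses (B0_gt0 : 0 < B0) (qz_right : forall t, B0 <= t -> q t < z t)
  (qz_left : forall t, t <= - B0 -> q t < z t).
Let z_cont := @shifted_min_cont R n psi C psi_cont.
Let z_incr := @shifted_min_incr R n psi C psi_incr.
Let mz : measurable_fun setT z. Proof. exact: continuous_measurable_fun. Qed.
Let mpsi i : measurable_fun setT (psi i). Proof. exact: continuous_measurable_fun. Qed.

(** Excess paid when group [i] arrives at a time where its shifted cost is not the minimal one. *)
Definition multiplier_slack i s := (psi i s - C i - z s) * ui i s.

Let slack0 i s : 0 <= multiplier_slack i s.
Proof.
by rewrite mulr_ge0// ?subr_ge0 ?shifted_min_le//; have [_ /(_ s)/andP[]] := rui i.
Qed.

(** On []-oo, X]] each [psi i] is between 0 and its value at [X], so the factor is bounded. *)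
Lemma multiplier_slack_integrable i X : mu.-integrable `]-oo, X] (EFin \o multiplier_slack i).
Proof.
pose K := psi i X + `|C i| + \sum_k (psi k X + `|C k|).
apply: (bounded_rate_integrable (K := K) (rui i)).
  by apply: measurable_funB => //; exact: measurable_funB.
move=> s sX; rewrite ger0_norm ?subr_ge0 ?shifted_min_le//.
have [k ->] := shifted_min_attained psi C s.
rewrite /K (bigD1 k)//=.
have : 0 <= \sum_(i0 < n.+1 | i0 != k) (psi i0 X + `|C i0|).
  by apply: sumr_ge0 => j _; rewrite addr_ge0// ltW.
have := strict_nd (@psi_incr i) sX; have := psi_pos k s; have := psi_pos k X.
have := ler_norm (C k); have := ler_norm (- C i); rewrite normrN.
by move: (psi i s) (psi i X) (psi k s) (psi k X) `|C i| `|C k| (\sum_(_ < _ | _) _) => *; lra.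
Qed.

Lemma shifted_min_integrable X : mu.-integrable `]-oo, X] (EFin \o (fun s => z s * u s)).
Proof.
pose K := \sum_k (psi k X + `|C k|).
apply: (bounded_rate_integrable (K := K) ru) => // s sX.
have [k ->] := shifted_min_attained psi C s.
rewrite /K (bigD1 k)//=.
have : 0 <= \sum_(i0 < n.+1 | i0 != k) (psi i0 X + `|C i0|).
  by apply: sumr_ge0 => j _; rewrite addr_ge0// ltW.
have := strict_nd (@psi_incr k) sX; have := psi_pos k s; have := psi_pos k X.
have := ler_norm (C k); have := ler_norm (- C k); rewrite normrN ler_norml.
by move: (psi k s) (psi k X) `|C k| (\sum_(_ < _ | _) _) => *; apply/andP; split; lra.
Qed.

Let ipsi i X : mu.-integrable `]-oo, X] (EFin \o (fun s => psi i s * ui i s)).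
Proof.
apply: (bounded_rate_integrable (K := psi i X) (rui i)) => // s sX.
by rewrite gtr0_norm//; exact: strict_nd (@psi_incr i) _ _ sX.
Qed.

Let mI X : measurable (`]-oo, X] : set R). Proof. exact: measurable_itv. Qed.

Let icdX i X : mu.-integrable `]-oo, X] (EFin \o cd i).
Proof. exact: lebesgue_integrableS (icd i). Qed.

(** Integrability of the departure part alone follows on half-lines, where the arrival part is
    integrable by positivity and monotonicity. *)
Let iq i X : mu.-integrable `]-oo, X] (EFin \o (fun s => q s * ub i s)).
Proof.
have -> : (fun s => q s * ub i s) = (fun s => psi i s * ui i s - cd i s).
  by apply/funext => s; rewrite /cost_density; ring.
exact: integrableB_real.
Qed.

Let qw_sum : (fun s => q s * w s) = (fun s => \sum_i q s * ub i s).
Proof. by apply/funext => s; rewrite -mulr_sumr. Qed.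

Lemma departure_cost_integrable X : mu.-integrable `]-oo, X] (EFin \o (fun s => q s * w s)).
Proof. by rewrite qw_sum; have [] := Rintegral_sum_ord (mI X) (fun i => iq i X). Qed.

Let dual_density s := \sum_i (cd i s - C i * ui i s).

Let iCu i : mu.-integrable setT (EFin \o (fun s => C i * ui i s)).
Proof. by apply: integrableZ_real => //; have [] := rui i. Qed.

Let iCuX i X : mu.-integrable `]-oo, X] (EFin \o (fun s => C i * ui i s)).
Proof. exact: lebesgue_integrableS (iCu i). Qed.

Let idual i : mu.-integrable setT (EFin \o (fun s => cd i s - C i * ui i s)).
Proof. exact: integrableB_real. Qed.

Let dual_total : \int[mu]_s dual_density s = optimal_value - \sum_i C i * G i.
Proof.
have [_ ->] := Rintegral_sum_ord measurableT idual.
rewrite /optimal_value -sumrB; apply: eq_bigr => i _.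
by rewrite RintegralB// RintegralZl ?[X in _ * X]mui//; have [] := rui i.
Qed.

Lemma truncated_cost X : \int[mu]_(s in `]-oo, X]) dual_density s =
  \sum_i \int[mu]_(s in `]-oo, X]) multiplier_slack i s + travel_cost q z X w u.
Proof.
have iz i : mu.-integrable `]-oo, X] (EFin \o (fun s => z s * ui i s)).
  have -> : (fun s => z s * ui i s) = (fun s => psi i s * ui i s - C i * ui i s - multiplier_slack i s).
    by apply/funext => s; rewrite /multiplier_slack; ring.
  apply: integrableB_real => //; last exact: multiplier_slack_integrable.
  exact: integrableB_real.
have id i : mu.-integrable `]-oo, X] (EFin \o (fun s => cd i s - C i * ui i s)).
  exact: integrableB_real.
have [_ ->] := Rintegral_sum_ord (mI X) id.
rewrite /travel_cost qw_sum; have [_ ->] := Rintegral_sum_ord (mI X) (fun i => iq i X).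
have -> : (fun s => z s * u s) = (fun s => \sum_i z s * ui i s).
  by apply/funext => s; rewrite -mulr_sumr (group_flux_sum f rhojam L ub s).
have [_ ->] := Rintegral_sum_ord (mI X) iz.
rewrite -sumrB -big_split/=; apply: eq_bigr => i _.
have ims := multiplier_slack_integrable i X.
rewrite -[in X in _ + X]RintegralB//.
rewrite -RintegralD//; last exact: integrableB_real.
by apply: eq_Rintegral => s _; rewrite /multiplier_slack /cost_density; ring.
Qed.

Let k d := L * h (d / L).
Let transit t := W t - U t.

Let h0 : h 0 = 0. Proof. exact: (lp_h0 lp (ltW (lp_p0 lp))). Qed.

Let transit_ge0 t : 0 <= transit t.
Proof.
have := cum_arrival_le lp legE rw L_gt0 t t.
by rewrite subrr mul0r h0 mulr0 add0r subr_ge0.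
Qed.

Let transit_inf e : 0 < e -> exists Y, forall t, Y <= t -> transit t < e.
Proof.
move=> e0; have [Y _ HY] := cum_tails ru e0; exists Y => t /((HY t).2).
rewrite (mass_arrival lp legE rw L_gt0); have := cum_le_mass rw t.
by rewrite /transit; move: (U t) (W t) (mass w) => *; lra.
Qed.

(** Slack of either kind, in the choice of arriving group or in the Lax inequality, would make the
    competitor strictly cheaper than the dual bound [C_mult] permits. *)
Lemma no_slack (t1 t2 delta X0 : R) (j : 'I_n.+1) : t1 <= t2 ->
  (forall s t, t1 < t -> t <= t2 -> z s = q t -> delta <= L * h ((s - t) / L) - (U s - W t)) ->
  (forall t, t1 < t -> t <= t2 -> (forall s, q t < z s) -> delta <= W t) ->
  \int[mu]_(s in `]-oo, X0]) multiplier_slack j s + delta * (q t2 - q t1) <= 0.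
Proof.
move=> t12 H1 H2; set v := (X in X <= 0); rewrite leNgt; apply/negP => v0.
have tc : continuous transit.
  by move=> t; apply: cvgB; [exact: cum_continuous rw t|exact: cum_continuous ru t].
(* [B] lies beyond [t2], so that the levels with slack are below [q B]. *)
have [B B0B low] := record_low (Num.max B0 t2) tc transit_ge0 transit_inf.
move: B0B; rewrite ge_max => /andP[B0B t2B].
have Bgt0 : 0 < B by exact: lt_le_trans B0B.
have qr t : B <= t -> q t < z t by move=> Bt; apply: qz_right; exact: le_trans Bt.
have ql t : t <= - B -> q t < z t by move=> Bt; apply: qz_left; rewrite (le_trans Bt)// lerN2.
have [wc [[rwc cwc cac full] [lev bel [ai P PE]]]] := competitor_plan Bgt0 qr ql.
have [rac _] := arrival_rate lp legE rwc L_gt0.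
have v4 : 0 < v / 4 by rewrite divr_gt0.
have idd : mu.-integrable setT (EFin \o dual_density) by have [] := Rintegral_sum_ord measurableT idual.
have [Y1 HY1] := integral_tail idd v4.
(* The boundary term is [transit X * q B]; [q B] is now fixed, so late [X] make it at most
   [v / 4]. *)
pose qB := `|q B| + 1; have qB0 : 0 < qB by rewrite ltr_wpDl.
have [Y2 HY2] := transit_inf (divr_gt0 v4 qB0).
have [X [YX BX lowX]] := low (Num.max (Num.max Y1 Y2) X0).
move: YX; rewrite !ge_max => /andP[/andP[Y1X Y2X] X0X].
have lax s t : U s <= k (s - t) + W t by exact: (cum_arrival_le lp legE rw L_gt0 s t).
have := travel_slack (k := k) q_cont q_incr z_cont z_incr qr ql rw ru rwc rac lax
  cwc cac full lev bel BX lowX (departure_cost_integrable X) (shifted_min_integrable X) t12 t2B H1 H2.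
rewrite -PE -/(transit X).
have := C_mult Bgt0 P; rewrite -dual_total.
have := HY1 X Y1X; rewrite truncated_cost (bigD1 j)//= ltr_distl => /andP[_].
have : \int[mu]_(s in `]-oo, X0]) multiplier_slack j s <= \int[mu]_(s in `]-oo, X]) multiplier_slack j s.
  apply: le_Rintegral_subset => //; last exact: multiplier_slack_integrable.
  by move=> s /=; rewrite !in_itv/= => /le_trans; apply.
have : 0 <= \sum_(i < n.+1 | i != j) \int[mu]_(s in `]-oo, X]) multiplier_slack i s.
  by apply: sumr_ge0 => i _; exact: Rintegral_ge0.
have : transit X * q B <= v / 4.
  apply: (@le_trans _ _ (v / 4 / qB * qB)); last by rewrite divfK// gt_eqF.
  apply: (@le_trans _ _ (transit X * qB)).
    by rewrite ler_wpM2l// /qB (le_trans (ler_norm _))// lerDl.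
  by rewrite ler_wpM2r// ltW// HY2.
have vE : v = \int[mu]_(s in `]-oo, X0]) multiplier_slack j s + delta * (q t2 - q t1) by [].
exact: slack_algebra v0 vE.
Qed.

Let W_lip t d : 0 <= d -> W t - M * d <= W (t - d).
Proof.
move=> d0; have := cum_lip rw (_ : t - d <= t); rewrite gerBl => /(_ d0).
by rewrite subKr; move: (W _) (W _) (M * d) => *; lra.
Qed.

Let int_slack_ge0 i X : 0 <= \int[mu]_(s in `]-oo, X]) multiplier_slack i s.
Proof. by apply: Rintegral_ge0 => s _; exact: slack0. Qed.

(** Otherwise, [W] being [M]-Lipschitz, at least half of [W t] has departed by any time within [eta]
    of [t], a positive slack on an interval of levels. *)
Lemma departures_below t : (forall s, q t < z s) -> W t = 0.
Proof.
move=> qz; have W0 := cum_ge0 rw; have M0 := lp_M_ge0 lp.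
apply/eqP; rewrite eq_le W0 andbT leNgt; apply/negP => Wt.
pose eta := W t / (2 * (M + 1)).
have M1 : 0 < 2 * (M + 1) by rewrite mulr_gt0// ltr_wpDl.
have eta0 : 0 < eta by rewrite divr_gt0.
have etaM : M * eta <= W t / 2.
  have -> : W t / 2 = (M + 1) * eta by rewrite /eta; field; rewrite gt_eqF// ltr_wpDl.
  by rewrite ler_wpM2r// ?(ltW eta0)// lerDl.
have le1 : t - eta <= t by rewrite gerBl ltW.
have := @no_slack (t - eta) t (W t / 2) 0 ord0 le1 => /(_ _ _)/wrap[].
- move=> s t' _ t't zs; have := qz s; rewrite zs ltNge => /negP[].
  exact: strict_nd q_incr _ _ t't.
- move=> t' tt' _ _; apply: le_trans (cum_nd rw (ltW tt')); apply: le_trans (W_lip t (ltW eta0)).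
  by move: etaM; move: (M * eta) (W t) => *; lra.
have := q_incr (_ : t - eta < t); rewrite gtrBl => /(_ eta0) qq.
have := int_slack_ge0 ord0 0; have : 0 < W t / 2 * (q t - q (t - eta)).
  by rewrite mulr_gt0 ?divr_gt0// subr_gt0.
by move: (\int[_]_(_ in _) _) (_ * _) => *; lra.
Qed.

(** A defect [D] at one level persists as [D / 2] on nearby lower levels: [U] only decreases there,
    while [h] and [W] lose at most [M * eta <= D / 4] each. *)
Lemma level_saturated s t : z s = q t -> U s - W t = L * h ((s - t) / L).
Proof.
move=> zs; have M0 := lp_M_ge0 lp; pose D := L * h ((s - t) / L) - (U s - W t).
have : 0 <= D by have := cum_arrival_le lp legE rw L_gt0 s t; rewrite subr_ge0 lerBlDr.
rewrite le_eqVlt => /predU1P[/esym/subr0_eq->//|D0].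
have M1 : 0 < 4 * (M + 1) by rewrite mulr_gt0// ltr_wpDl.
pose eta := D / (4 * (M + 1)); have eta0 : 0 < eta by rewrite divr_gt0.
have etaM : M * eta <= D / 4.
  have -> : D / 4 = (M + 1) * eta by rewrite /eta; field; rewrite gt_eqF// ltr_wpDl.
  by rewrite ler_wpM2r// ?(ltW eta0)// lerDl.
have s0s : s - eta < s by rewrite gtrBl.
have [t1 [t1ge t1lt zq]] : exists t1, [/\ t - eta <= t1, t1 < t & z (s - eta) < q t1].
  have zz := z_incr s0s; have tt : t - eta <= t by rewrite gerBl ltW.
  (* The level chosen is above [z (s - eta)], so that matched arrivals stay within [eta] of [s], and
     not under [q (t - eta)]. *)
  have [|c] := IVT tt (continuous_subspaceT q_cont) (v := Num.max (q (t - eta)) ((z (s - eta) + q t) / 2)).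
    have qq := strict_nd q_incr tt.
    rewrite (min_idPl qq) (max_idPr qq) le_max lexx/= ge_max qq/= ler_pdivrMr//.
    by rewrite -zs; move: zz; move: (z _) (z _) => *; lra.
  rewrite in_itv/= => /andP[c1 c2] qc; exists c; split => //.
    rewrite lt_neqAle c2 andbT; apply/eqP => ct; move: qc; rewrite ct => /eqP.
    rewrite eq_sym -[X in _ == X]zs; apply/negP; rewrite lt_eqF// gt_max zs q_incr ?gtrBl//=.
    by rewrite ltr_pdivrMr// -zs; move: zz; move: (z _) (z _) => *; lra.
  rewrite qc lt_max; apply/orP; right; rewrite ltr_pdivlMr// -zs.
  by move: zz; move: (z _) (z _) => *; lra.
have h_nd : L * h ((s - t) / L) - M * eta <= L * h ((s - eta - t) / L).
  have := lp_h_lip lp ((s - eta - t) / L) ((s - t) / L).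
  have -> : (s - t) / L - (s - eta - t) / L = eta / L by field; rewrite gt_eqF.
  rewrite (gtr0_norm (divr_gt0 eta0 L_gt0)) => /(le_trans (ler_norm _)).
  rewrite -(ler_pM2l L_gt0) mulrBr.
  have -> : L * (M * (eta / L)) = M * eta by field; rewrite gt_eqF.
  by move: (L * _) (L * _) (M * _) => *; lra.
have h_incr a b : a <= b -> L * h (a / L) <= L * h (b / L).
  move=> ab; rewrite ler_pM2l//; have := lp_subgrad lp (a / L) (b / L).
  apply: le_trans; rewrite lerDl mulr_ge0 ?(lp_gam_ge0 lp)// subr_ge0.
  by rewrite ler_pM2r// invr_gt0.
have := @no_slack t1 t (D / 2) 0 ord0 (ltW t1lt) => /(_ _ _)/wrap[].
- move=> s' t' t1t' t't zs'.
  have s's : s' <= s by rewrite -(strict_le z_incr) zs' zs; exact: strict_nd q_incr _ _ t't.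
  have ss' : s - eta <= s'.
    rewrite -(strict_le z_incr) zs' ltW// (lt_trans zq)//; exact: q_incr.
  have Us := cum_nd ru s's.
  have Wt : W t - M * eta <= W t'.
    by apply: le_trans (W_lip t (ltW eta0)) _; apply: (cum_nd rw); apply: le_trans (ltW t1t').
  have hs : L * h ((s - eta - t) / L) <= L * h ((s' - t') / L) by apply: h_incr; apply: lerB.
  move: Us Wt hs h_nd etaM; rewrite /D.
  move: (L * _) (L * _) (L * _) (U _) (U _) (W _) (W _) (M * _) => *; lra.
- move=> t' t1t' _ /(_ (s - eta)); rewrite ltNge => /negP[].
  by rewrite ltW// (lt_trans zq)//; exact: q_incr.
have := q_incr t1lt => qq.
have := int_slack_ge0 ord0 0; have : 0 < D / 2 * (q t - q t1).
  by rewrite mulr_gt0 ?divr_gt0// subr_gt0.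
by move: (\int[_]_(_ in _) _) (_ * _) => *; lra.
Qed.

Lemma multiplier_slack_null i X : mu.-negligible [set s | s <= X /\ 0 < multiplier_slack i s].
Proof.
have E : \int[mu]_(s in `]-oo, X]) multiplier_slack i s = 0.
  apply/eqP; rewrite eq_le int_slack_ge0 andbT.
  (* With [t1 = t2] the range of levels is empty and only the multiplier slack remains. *)
  have := @no_slack 0 0 0 X i (lexx _) => /(_ _ _)/wrap[].
  + by move=> s t t0 /(lt_le_trans t0); rewrite ltxx.
  + by move=> t t0 /(lt_le_trans t0); rewrite ltxx.
  by rewrite mul0r addr0.
have imX := multiplier_slack_integrable i X.
have /integrableP[mm _] := imX.
have E' : (\int[mu]_(s in `]-oo, X]) `|(multiplier_slack i s)%:E| = 0)%E.
  rewrite -[LHS]fineK; last by apply: integrable_fin_num => //; exact: integrable_abse imX.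
  congr EFin; rewrite -[RHS]E /Rintegral; congr fine; apply: eq_integral => s _.
  by rewrite gee0_abs// lee_fin.
have : ae_eq mu ([set` `]-oo, X]] : set (measurableTypeR R)) (fun s => (multiplier_slack i s)%:E) (cst 0%E).
  exact/ae_eq_integral_abs.
apply: null_subset => s [sX ms] /= /(_ _)/wrap[]; first by rewrite in_itv.
by move=> [] ms0; move: ms; rewrite ms0 ltxx.
Qed.

End Slack.

End Optimum.

End Optimality.

(** * Characteristics *)

Section Characteristics.
Context (R : realType) (p0 M kappa : R) (gam h : R -> R).
Hypothesis lp : legendre_pair p0 M kappa gam h.
Variables (L B : R) (W U q z : R -> R).
Hypothesis L_gt0 : 0 < L.
Hypothesis W_nd : forall s t, s <= t -> W s <= W t.
Hypotheses (U_nd : forall s t, s <= t -> U s <= U t) (U_ge0 : forall t, 0 <= U t).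
Hypothesis U_le : forall s t, U s <= L * h ((s - t) / L) + W t.
Hypotheses (q_cont : continuous q) (q_incr : forall s t, s < t -> q s < q t).
Hypotheses (z_cont : continuous z) (z_incr : forall s t, s < t -> z s < z t).
Hypothesis qz_left : forall t, t <= - B -> q t < z t.
Hypothesis U_level : forall s t, z s = q t -> U s - W t = L * h ((s - t) / L).
Hypothesis W_below : forall t, (forall s, q t < z s) -> W t = 0.
Notation opt := (optimal_departure p0 h W).

(* The segments from (t, 0) to (s, L) filling the strip: those joining level
   sets of the costs, as long as they are not faster than free flow. *)
Definition characteristic t s :=
  [/\ q t <= z s, t <= s - L * p0 & z s = q t \/ s = t + L * p0].

(** On a level segment this is [U_level]. On a free-flow segment it suffices that [W t <= U s]:
    either some earlier arrival has the level of [t], and [U_level] gives equality there because [h]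
    vanishes, or nobody departed by [t]. *)
Lemma characteristic_optimal t s : characteristic t s -> opt L s t.
Proof.
move=> [c1 c2 E]; split => // t'.
rewrite /arrival_cost; apply: (@le_trans _ _ (U s)); last exact: U_le.
have fast s' : s' <= t + L * p0 -> h ((s' - t) / L) = 0.
  by move=> s't; apply: (lp_h0 lp); rewrite ler_pdivrMr// lerBlDl [p0 * L]mulrC.
have [E'|E'] : z s = q t \/ (s = t + L * p0 /\ q t < z s).
- case: E => E; [by left|]; move: c1; rewrite le_eqVlt => /predU1P[->|]; by [left|right].
- by rewrite -(U_level E') subrK.
have {E'} [E' qz] := E'; rewrite fast ?E'// mulr0 add0r.
have [[s2 s2s zs]|H] := level_cases z_cont (ltW qz).
  have := U_level zs; rewrite fast ?mulr0; last by rewrite (le_trans s2s)// E'.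
  by move=> /subr0_eq <-; rewrite -E' U_nd.
rewrite W_below ?U_ge0// => s'; have [/H//|/ltW ss'] := leP s' s.
by apply: lt_le_trans qz _; exact: strict_nd z_incr _ _ ss'.
Qed.

Lemma characteristic_inj t t2 s : characteristic t s -> characteristic t2 s -> t = t2.
Proof.
suff H x y : characteristic x s -> characteristic y s -> x < y -> False.
  by move=> c1 c2; case: (ltgtP t t2) => // lt; exfalso; [exact: H c1 c2 lt|exact: H c2 c1 lt].
move=> [_ _ E] [y1 y2 _] xy.
case: E => E; first by have := q_incr xy; rewrite -E ltNge y1.
by move: y2; rewrite E addrK leNgt xy.
Qed.

(** [S t] is the endpoint of the line from (t, 0) through the given point. The minimum [m] of the
    two constraints changes sign, and at a zero one of them is an equality. *)
Lemma characteristic_through t' x : 0 < x <= L ->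
  exists t s, characteristic t s /\ t' = t + x / L * (s - t).
Proof.
move=> /andP[x0 xL]; pose S t := t + (t' - t) * (L / x).
have LX : 1 <= L / x by rewrite ler_pdivlMr// mul1r.
have Sc : continuous S.
  move=> t; apply: cvgD; first exact: cvg_id.
  by apply: cvgMl; apply: cvgB; [exact: cvg_cst|exact: cvg_id].
pose m t := Num.min (z (S t) - q t) (S t - L * p0 - t).
have mc : continuous m.
  move=> t; have c1 : {for t, continuous (fun t => z (S t) - q t)}.
    by apply: cvgB; [exact: (continuous_comp (Sc t) (@z_cont _))|exact: q_cont].
  have c2 : {for t, continuous (fun t => S t - L * p0 - t)}.
    by apply: cvgB; [apply: cvgB; [exact: Sc|exact: cvg_cst]|exact: cvg_id].
  exact: (continuous_min c1 c2).
have p00 := lp_p0 lp.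
have Lp0 : 0 < L * p0 by rewrite mulr_gt0.
pose a := Num.min (- B) (t' - L * p0).
have aB : a <= - B by rewrite ge_min lexx.
have at' : a <= t' - L * p0 by rewrite ge_min lexx orbT.
have Sa : a + L * p0 <= S a.
  rewrite /S lerD2l; apply: (@le_trans _ _ (t' - a)); first by move: at'; lra.
  by rewrite ler_peMr// subr_ge0; move: at' Lp0; lra.
have ma : 0 <= m a.
  rewrite /m le_min; apply/andP; split.
    rewrite subr_ge0 ltW// (lt_le_trans (qz_left aB))//; apply: (strict_nd z_incr).
    by apply: le_trans Sa; rewrite lerDl ltW.
  by move: Sa; lra.
have mt : m t' <= 0.
  by rewrite /m ge_min /S subrr mul0r addr0; apply/orP; right; move: Lp0; lra.
have aleq : a <= t' by move: at' Lp0; lra.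
have [|t _ mt0] := IVT aleq (continuous_subspaceT mc) (v := 0).
  have mm := le_trans mt ma.
  by rewrite (min_idPr mm) (max_idPl mm) mt.
exists t, (S t); split; last by rewrite /S; field; rewrite !gt_eqF.
move: mt0; rewrite /m; case: leP => [AB A0|BA B0]; split.
- by rewrite -subr_ge0 A0.
- by rewrite -subr_ge0 -A0.
- by left; exact: subr0_eq.
- by rewrite -subr_ge0 -B0 ltW.
- by rewrite -subr_ge0 B0.
- by right; rewrite -[LHS](subrK (L * p0)) (subr0_eq B0).
Qed.

Lemma optimal_midpoint t s (x : R) : opt L s t -> 0 < x < L ->
  opt x (t + x / L * (s - t)) t /\ forall tau, opt x (t + x / L * (s - t)) tau -> tau = t.
Proof.
by move=> o /andP[x0 xL]; exact: (optimal_departure_unique lp W_nd x0 xL o (erefl _)).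
Qed.

Lemma characteristic_unique t s (x : R) : characteristic t s -> 0 < x <= L ->
  opt x (t + x / L * (s - t)) t /\ forall tau, opt x (t + x / L * (s - t)) tau -> tau = t.
Proof.
move=> c /andP[x0]; have o := characteristic_optimal c.
rewrite le_eqVlt => /predU1P[->|xL]; last by apply: optimal_midpoint => //; rewrite x0.
have -> : t + L / L * (s - t) = s by rewrite divff ?gt_eqF//; ring.
split=> // tau otau.
have L2 : 0 < L / 2 < L by rewrite divr_gt0//= ltr_pdivrMr// ltr_pMr// ltr1n.
have [_ uniq] := optimal_midpoint otau L2.
have L2' : 0 < L / 2 <= L by case/andP: L2 => -> /ltW.
have [t1 [s1 [c1 E]]] := characteristic_through (tau + L / 2 / L * (s - tau)) L2'.
have [oc1 _] := optimal_midpoint (characteristic_optimal c1) L2.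
have t1E : t1 = tau by apply: uniq; rewrite E.
have s1E : s1 = s.
  have L20 : L / 2 / L != 0 by rewrite gt_eqF// !divr_gt0.
  by move: E; rewrite t1E => /addrI/(mulfI L20)/addIr.
by apply: (characteristic_inj (s := s)) => //; rewrite -t1E -s1E.
Qed.

(* A segment joining level sets faster than free flow meets only
   characteristics that carry nothing. *)
Lemma level_segment_value t T (a : R) : z T = q t -> 0 < a <= 1 ->
  forall tau, opt (a * L) (t + a * (T - t)) tau ->
  gam ((t + a * (T - t) - tau) / (a * L)) = gam ((T - t) / L).
Proof.
move=> zq /andP[a0 a1] tau o.
have aL : 0 < a * L <= L by rewrite mulr_gt0//= ger_pMl.
have [t1 [s1 [c1 E]]] := characteristic_through (t + a * (T - t)) aL.
have [_ uniq] := characteristic_unique c1 aL.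
have tauE : tau = t1 by apply: uniq; rewrite -E.
have aLL : a * L / L = a by rewrite mulfK// gt_eqF.
rewrite aLL in E.
have -> : (t + a * (T - t) - tau) / (a * L) = (s1 - t1) / L.
  by rewrite tauE E; field; rewrite !gt_eqF.
move: (c1) => [q1 q2 alt].
have E' : (1 - a) * t + a * T = (1 - a) * t1 + a * s1 by move: E; lra.
(* Level segments are ordered at both ends alike, so two of them meeting at an interior point
   coincide. *)
have strict x y x' y' : x < y -> x' < y' -> (1 - a) * x + a * x' < (1 - a) * y + a * y'.
  by move=> xy xy'; apply: ler_ltD; [rewrite ler_wpM2l ?subr_ge0// ltW|rewrite ltr_pM2l].
case: alt => alt.
  have [tt|tt|tt] := ltgtP t t1.
  - have TT : T < s1.
      rewrite ltNge; apply/negP => /(strict_nd z_incr); rewrite alt zq.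
      by rewrite leNgt q_incr.
    by have := strict _ _ _ _ tt TT; rewrite E' ltxx.
  - have TT : s1 < T.
      rewrite ltNge; apply/negP => /(strict_nd z_incr); rewrite alt zq.
      by rewrite leNgt q_incr.
    by have := strict _ _ _ _ tt TT; rewrite E' ltxx.
  - by rewrite -tt (strict_inj z_incr (_ : z s1 = z T)) // alt zq tt.
(* The characteristic is free flow and carries 0. A level segment of slope at least [p0] is itself a
   characteristic, hence the same one. *)
have -> : (s1 - t1) / L = p0 by rewrite alt; field; rewrite gt_eqF.
rewrite (lp_gam0 lp (lexx p0)); have [le|lt] := leP p0 ((T - t) / L); last by rewrite (lp_gam0 lp)// ltW.
have c : characteristic t T.
  split; rewrite ?zq//; last by left.
  by move: le; rewrite ler_pdivlMr// [p0 * L]mulrC; lra.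
have [ot' _] := characteristic_unique c aL.
have tE : t = t1 by apply: uniq; move: ot'; rewrite !aLL E.
have sE : T = s1.
  by move: E; rewrite -tE => /addrI/mulfI; rewrite gt_eqF// => /(_ isT)/addIr.
rewrite sE alt -tE; have -> : (t + L * p0 - t) / L = p0 by field; rewrite gt_eqF.
by rewrite (lp_gam0 lp).
Qed.

(** [t] minimizes the Lax cost for the arrival time [T]. The slope is taken at [t'], which is
    harmless in the limit as [gam] is continuous. *)
Lemma level_supporting_slope t T t' : z T = q t ->
  gam ((T - t') / L) * (t' - t) <= W t' - W t.
Proof.
move=> zT; have := U_le T t'; rewrite -[U T](subrK (W t)) (U_level zT).
have := lp_subgrad lp ((T - t') / L) ((T - t) / L).
have -> : (T - t) / L - (T - t') / L = (t' - t) / L by rewrite -mulrBl; congr (_ / _); ring.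
rewrite -(ler_pM2l L_gt0) mulrDr.
have -> : L * (gam ((T - t') / L) * ((t' - t) / L)) = gam ((T - t') / L) * (t' - t).
  by field; rewrite gt_eqF.
by move: (L * h ((T - t') / L)) (L * h ((T - t) / L)) (gam _ * _) (W t) (W t') => *; lra.
Qed.

Lemma lp_gam_continuous : continuous gam.
Proof.
move=> p; apply/(cvgrPdist_lt _ _).2 => e e0.
have ek : 0 < e / kappa by rewrite divr_gt0// (lp_kappa lp).
near=> p'.
have pp' : `|p - p'| < e / kappa by near: p'; exact: cvgr_dist_lt.
apply: (@le_lt_trans _ _ (kappa * `|p - p'|)).
  have [pp|/ltW pp] := leP p p'.
    rewrite ler0_norm ?subr_le0 ?(lp_gam_nd lp)// (ler0_norm (_ : p - p' <= 0)) ?subr_le0//.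
    by rewrite !opprB (lp_gam_lip lp).
  rewrite ger0_norm ?subr_ge0 ?(lp_gam_nd lp)// (ger0_norm (_ : 0 <= p - p')) ?subr_ge0//.
  by rewrite (lp_gam_lip lp).
by rewrite mulrC -ltr_pdivlMr// (lp_kappa lp).
Unshelve. all: by end_near.
Qed.

Lemma slope_value_continuous T t : {for t, continuous (fun t' : R => gam ((T - t') / L))}.
Proof.
have sc : {for t, continuous (fun t' : R => (T - t') / L)}.
  by apply: cvgMl; apply: cvgB; [exact: cvg_cst|exact: cvg_id].
exact: (continuous_comp sc (@lp_gam_continuous _)).
Qed.

End Characteristics.

(** * Departure rate as derivative of cumulative departures *)

Section Differentiation.
Context (R : realType).
Notation mu := (@lebesgue_measure R).

Lemma cum_derivative (M : R) (w : R -> R) : rate M w ->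
  {ae mu, forall t, derivable (cum_departures w) t 1 /\ derive1 (cum_departures w) t = w t}.
Proof.
move=> rw; apply: FTC1Ny.
  by move=> y; exact: rate_int rw _ (measurable_itv _).
by apply: open_integrable_locally; [exact: openT|case: rw].
Qed.

(** Dividing by [t' - t] bounds the difference quotients below by [g] on the right and above by [g]
    on the left. *)
Lemma supporting_slope (W g : R -> R) (t : R) : derivable W t 1 -> {for t, continuous g} ->
  (forall t', g t' * (t' - t) <= W t' - W t) -> derive1 W t = g t.
Proof.
move=> dW gc H; rewrite derive1E.
have /cvg_ex[l Hl] := dW.
have -> : 'D_1 W t = l by exact: cvg_lim Hl.
have qE e : e^-1 *: ((W \o shift t) e%:A - W t) = (W (t + e) - W t) / e.
  by rewrite /= [e%:A]mulr1 [LHS]mulrC [e + t]addrC.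
have gt0 : g (t + e) @[e --> (0 : R)] --> g t.
  have st : t + e @[e --> (0 : R)] --> t.
    by rewrite -[X in _ --> X]addr0; apply: cvgD; [exact: cvg_cst|exact: cvg_id].
  exact: (cvg_comp _ _ st gc).
have Hr : (W (t + e) - W t) / e @[e --> 0^'+] --> l.
  by apply: cvg_dnbhs_at_right; under eq_fun do rewrite -qE.
have Hlt : (W (t + e) - W t) / e @[e --> 0^'-] --> l.
  by apply: cvg_dnbhs_at_left; under eq_fun do rewrite -qE.
have gr := cvg_at_right_filter gt0; have gl := cvg_at_left_filter gt0.
apply/eqP; rewrite eq_le; apply/andP; split.
  rewrite -(cvg_lim _ Hlt)// -(cvg_lim _ gl)//; apply: ler_lim; [by apply/cvg_ex; exists l|by apply/cvg_ex; exists (g t)|].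
  near=> e; have e0 : e < 0 by near: e; exact: nbhs_left_lt.
  by rewrite ler_ndivrMr//; have := H (t + e); rewrite addrAC subrr add0r.
rewrite -(cvg_lim _ Hr)// -(cvg_lim _ gr)//; apply: ler_lim; [by apply/cvg_ex; exists (g t)|by apply/cvg_ex; exists l|].
near=> e; have e0 : 0 < e by near: e; exact: nbhs_right_gt.
by rewrite ler_pdivlMr//; have := H (t + e); rewrite addrAC subrr add0r.
Unshelve. all: by end_near.
Qed.

End Differentiation.

Section Costs.
Context (R : realType).

Lemma positive_derivative (g : R -> R) :
  (forall t : R, derivable g t 1 /\ 0 < derive1 g t) ->
  continuous g /\ forall s t, s < t -> g s < g t.
Proof.
move=> dg; have gc : continuous g.
  by move=> t; apply: differentiable_continuous; apply/derivable1_diffP; have [] := dg t.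
split=> // s t st; apply: (@gtr0_derive1_lt_cc _ g s t); rewrite ?in_itv/= ?lexx ?ltW//.
- by move=> x _; have [] := dg x.
- by move=> x _; have [] := dg x.
- exact: continuous_subspaceT.
Qed.

(** The group attaining the minimum varies with time, so [B] exceeds the thresholds of all groups at
    once. *)
Lemma shifted_cost_gap (n : nat) (phi : R -> R) (psi : 'I_n.+1 -> R -> R) (C : 'I_n.+1 -> R) :
  (forall i, phi t + psi i t @[t --> +oo] --> +oo) ->
  (forall i, phi t + psi i t @[t --> -oo] --> +oo) ->
  exists2 B, 0 < B & forall t, B <= t \/ t <= - B -> 0 < phi t + shifted_min psi C t.
Proof.
move=> Hp Hn.
have /choice[Y HY] i : exists Y, forall t, `|t| > Y -> C i < phi t + psi i t.
  have /cvgryPgt/(_ (C i))[Yp [_ HYp]] := Hp i.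
  have /cvgryPgt/(_ (C i))[Yn [_ HYn]] := Hn i.
  exists (`|Yp| + `|Yn|) => t; case: (leP 0 t) => t0; rewrite ?(ger0_norm t0) ?(ltr0_norm t0) => Yt.
    apply: HYp; apply: le_lt_trans (ler_norm _) _; apply: le_lt_trans Yt.
    by rewrite lerDl.
  apply: HYn; rewrite -ltrN2; apply: le_lt_trans (ler_norm _) _; rewrite normrN.
  by apply: le_lt_trans Yt; rewrite lerDr.
have S0 : 0 <= \sum_i `|Y i| by exact: sumr_ge0.
exists (1 + \sum_i `|Y i|) => [|t Bt]; first by rewrite ltr_pwDl.
have [i ->] := shifted_min_attained psi C t.
rewrite addrA subr_gt0; apply: HY; apply: le_lt_trans (ler_norm _) _.
apply: (@lt_le_trans _ _ (1 + \sum_i `|Y i|)); last first.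
  case: Bt => Bt; first by apply: le_trans Bt (ler_norm _).
  by rewrite -normrN; apply: le_trans (ler_norm _); rewrite lerNr.
by rewrite (bigD1 i)//= addrCA ltrDl ltr_pwDl// sumr_ge0.
Qed.

End Costs.

Theorem theorem3p1 (R : realType) (n : nat) (L rhojam : R) (f : R -> R)
    (G : 'I_n.+1 -> R) (phi : R -> R) (psi : 'I_n.+1 -> R -> R)
    (ub : 'I_n.+1 -> R -> R)
    (L_gt0 : 0 < L) (rhojam_gt0 : 0 < rhojam) (G_gt0 : forall i, 0 < G i)
    (f_C2 : C2_on `[0, rhojam] f)
    (f_concave : forall r : R, 0 <= r <= rhojam ->
       deriv_on `[0, rhojam] (deriv_on `[0, rhojam] f) r < 0)
    (f0 : f 0 = 0) (f_jam : f rhojam = 0)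
    (phi_decr : forall t : R, derivable phi t 1 /\ derive1 phi t < 0)
    (psi_pos : forall i t, 0 < psi i t)
    (psi_incr : forall i (t : R), derivable (psi i) t 1 /\ 0 < derive1 (psi i) t)
    (cost_pinfty : forall i, phi t + psi i t @[t --> +oo] --> +oo)
    (cost_ninfty : forall i, phi t + psi i t @[t --> -oo] --> +oo)
    (ub_opt : optimal f rhojam L (fun=> phi) psi G ub) :
  let u := lax_solution f rhojam (total_rate ub) in
  (forall t x, 0 < x <= L -> ~ has_shock f rhojam (total_rate ub) t x) /\
  exists C : 'I_n.+1 -> R,
    let psim := shifted_min psi C in
    [/\ forall t, (exists s, phi t + psim s <= 0) ->
          exists T, [/\ phi t + psim T = 0,
            forall T', phi t + psim T' = 0 -> T' = T &
            forall a, 0 < a <= 1 ->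
              u (t + a * (T - t)) (a * L)
                = segment_value f rhojam ((T - t) / L)],
        {ae lebesgue_measure, forall t, forall T, phi t + psim T = 0 ->
          u t 0 = segment_value f rhojam ((T - t) / L)} &
        forall i, ess_supp (fun s => group_flux f rhojam ub i s L)
                    `<=` [set s | psim s = psi i s - C i]].
Proof.
move=> u.
have [kappa [lp legE]] := flux_legendre_pair rhojam_gt0 f_C2 f_concave f0 f_jam.
pose q t := - phi t; have phiE : phi = fun t => - q t by apply/funext => t; rewrite opprK.
have [q_cont q_incr] : continuous q /\ forall s t, s < t -> q s < q t.
  apply: positive_derivative => t; have [d1 d2] := phi_decr t; split; first exact: derivableN.
  by rewrite derive1E deriveN// -derive1E oppr_gt0.
have psi_cont i : continuous (psi i) by have [] := positive_derivative (psi_incr i).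
have psi_lt i s t : s < t -> psi i s < psi i t by have [_] := positive_derivative (psi_incr i); apply.
have opt := ub_opt; rewrite phiE in opt.
have [mub ub0 rw mG] := optimal_rates opt.
have [ru UE] := arrival_rate lp legE rw L_gt0.
have [C Cm] := optimal_multipliers lp legE L_gt0 q_incr psi_cont psi_lt G_gt0 opt.
pose z := shifted_min psi C.
have z_cont : continuous z := @shifted_min_cont _ _ _ C psi_cont.
have z_incr : forall s t, s < t -> z s < z t := @shifted_min_incr _ _ _ C psi_lt.
have [B B0 gap] := shifted_cost_gap C cost_pinfty cost_ninfty.
have qz t : B <= t \/ t <= - B -> q t < z t.
  by move=> /gap gt0; rewrite -subr_gt0 opprK addrC.
have qz_right t : B <= t -> q t < z t by move=> ?; apply: qz; left.
have qz_left t : t <= - B -> q t < z t by move=> ?; apply: qz; right.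
have W_below := departures_below lp legE L_gt0 q_cont q_incr psi_cont psi_lt psi_pos opt Cm B0 qz_right qz_left.
have U_level := level_saturated lp legE L_gt0 q_cont q_incr psi_cont psi_lt psi_pos opt Cm B0 qz_right qz_left.
have slack := multiplier_slack_null lp legE L_gt0 q_cont q_incr psi_cont psi_lt psi_pos opt Cm B0 qz_right qz_left.
have U_le := cum_arrival_le lp legE rw L_gt0.
pose W := cum_departures (total_rate ub).
pose U := cum_departures (fun t => lax_solution f rhojam (total_rate ub) t L).
have W_nd : forall s t, s <= t -> W s <= W t := cum_nd rw.
have U_nd : forall s t, s <= t -> U s <= U t := cum_nd ru.
have U_ge0 : forall t, 0 <= U t := cum_ge0 ru.
have through := characteristic_through lp L_gt0 q_cont z_cont z_incr qz_left.
have unique := characteristic_unique lp L_gt0 W_nd U_nd U_ge0 U_le q_cont q_incr z_cont z_incr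
  qz_left U_level W_below.
have value := level_segment_value lp L_gt0 W_nd U_nd U_ge0 U_le q_cont q_incr z_cont z_incr
  qz_left U_level W_below.
split=> [t x xL [tau1 [tau2 [m1 m2 ne]]]|].
  have x0 : 0 < x by case/andP: xL.
  have [t1 [s1 [c1 E]]] := through t x xL.
  have [_ uniq] := unique t1 s1 x c1 xL; rewrite -E in uniq.
  have tauE tau : lax_minimizer f rhojam (total_rate ub) t x tau -> tau = t1.
    by move=> /(lax_minimizerP lp legE rw t tau x0).1; exact: uniq.
  by apply: ne; rewrite (tauE _ m1) (tauE _ m2).
have curveE t T : phi t + z T = 0 -> z T = q t by move=> /addr0_eq <-.
exists C; rewrite /= -/z; split.
- move=> t [s0 zs0].
  have [T _ zT] : exists2 T, s0 <= T & z T = q t.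
    (* Late enough that [q t <= q X < z X], the upper end for the intermediate value theorem. *)
    pose X := Num.max s0 (Num.max t B).
    have sX : s0 <= X by rewrite le_max lexx.
    have qX : q t <= z X.
      apply/ltW; apply: le_lt_trans (qz_right X _); last by rewrite !le_max lexx !orbT.
      by apply: (strict_nd q_incr); rewrite !le_max lexx !orbT.
    have zq : z s0 <= q t by rewrite -subr_le0 opprK addrC.
    have [|c] := IVT sX (continuous_subspaceT z_cont) (v := q t).
      by have zX := le_trans zq qX; rewrite (min_idPl zX) (max_idPr zX) zq.
    by rewrite in_itv/= => /andP[sc _] zc; exists c.
  exists T; split.
  + by rewrite zT /q subrr.
  + by move=> T' /curveE zT'; apply: (strict_inj z_incr); rewrite zT zT'.
  + move=> a a01; have aL0 : 0 < a * L by case/andP: a01 => a0 _; rewrite mulr_gt0.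
    rewrite /u (lax_solutionE lp legE rw _ aL0); apply: value => //.
    exact: (lax_tauP lp legE rw _ aL0).
- have := cum_derivative rw; apply: filterS; first exact: (ae_filter_ringOfSetsType lebesgue_measure).
  move=> t [dWt Wt] T /curveE zT.
  rewrite /u /lax_solution eqxx -Wt.
  apply: (@supporting_slope _ W (fun t' => segment_value f rhojam ((T - t') / L))) => //.
    exact: (slope_value_continuous lp).
  by move=> t'; exact: (level_supporting_slope lp L_gt0 U_le U_level _ zT).
- move=> i t ti; apply/eqP; apply/negPn/negP => ne.
  have lt : z t < psi i t - C i by rewrite lt_neqAle ne shifted_min_le.
  (* A neighbourhood where the slack of group [i] is positive wherever it arrives; the cut at
     [t + 1] is there because nullity is known on half-lines []-oo, X]]. *)
  apply: (ti [set s | z s < psi i s - C i /\ s < t + 1]).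
    have c : {for t, continuous (fun s => psi i s - C i - z s)}.
      by apply: cvgB; [apply: cvgB; [exact: psi_cont|exact: cvg_cst]|exact: z_cont].
    have gap0 : 0 < psi i t - C i - z t by rewrite subr_gt0.
    near=> s; split; last by near: s; apply: lt_nbhsl; rewrite ltrDl.
    by rewrite -subr_gt0; near: s; exact: (cvgr_gt _ c).
  apply: null_subset (slack i (t + 1)) => s /= [[zs st] us]; split; first exact: ltW.
  by rewrite /multiplier_slack mulr_gt0// subr_gt0.
Unshelve. all: by end_near.
Qed.
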